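(* Let $\alpha>0$ be real, $n\ge0$ an integer, $0\le\beta<1$, and let $f\in T_n^\alpha(\beta)$. Let $c$ be real with $\alpha+c>0$ and let $\sigma>0$, $\gamma>0$ be real. Define $\phi_1,\phi_2,\phi_3$ by $$\phi_1(z)^\alpha=\frac{\alpha+c}{z^c}\int_0^zt^{c-1}f(t)^\alpha\,dt,$$ $$\phi_2(z)^\alpha=\frac{2^\sigma}{z\Gamma(\sigma)}\int_0^z\left(\log\frac{z}{t}\right)^{\sigma-1}f(t)^\alpha\,dt,$$ $$\phi_3(z)^\alpha=\binom{\sigma+\gamma}{\gamma}\frac{\sigma}{z^\gamma}\int_0^z\left(1-\frac{t}{z}\right)^{\sigma-1}t^{\gamma-1}f(t)^\alpha\,dt.$$ Then $\phi_j\in T_n^\alpha(\beta)$ for $j=1,2,3$.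
   Context: $E=\{z\in\mathbb{C}:|z|<1\}$. $\mathbb{A}$ is the class of functions $f(z)=z+a_2z^2+\cdots$ analytic in $E$. $D^n$ is the Salagean derivative operator: $D^0h(z)=h(z)$ and $D^nh(z)=z[D^{n-1}h(z)]'$. All powers are principal determinations; $D^nf(z)^\alpha$ means $D^n$ applied to the function $f(z)^\alpha$. For real $\alpha>0$, $0\le\beta<1$ and integer $n\ge0$, $T_n^\alpha(\beta)$ is the class of $f\in\mathbb{A}$ with $\operatorname{Re}\frac{D^nf(z)^\alpha}{\alpha^nz^\alpha}>\beta$ for $z\in E$. The binomial coefficient with real arguments is $\binom{\sigma}{\gamma}=\frac{\Gamma(\sigma+1)}{\Gamma(\sigma-\gamma+1)\Gamma(\gamma+1)}$.
   Formalization: For j=2,3 the claim is false if α≠1 (f(z)=z gives φ_2^α=(2/(α+1))^σ z^α, so φ_2'(0)≠1 and φ_2∉𝔸; likewise φ_3); there it is proved that φ_j/φ_j'(0)∈T_n^α(β), and φ_j itself for α=1. φ_1 is as stated. *)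

(* Defs.v *)
From Stdlib Require Import Reals.
From Coquelicot Require Import Coquelicot.
Local Open Scope R_scope.

Definition Cexp (z : C) : C :=
  (exp (fst z) * cos (snd z), exp (fst z) * sin (snd z)).

(* Principal argument, in (-PI, PI] for z <> 0. *)
Definition Carg (z : C) : R :=
  if Rle_dec 0 (snd z) then acos (fst z / Cmod z) else - acos (fst z / Cmod z).

Definition Clog (z : C) : C := (ln (Cmod z), Carg z).

Definition Cpow (z : C) (a : R) : C := Cexp (RtoC a * Clog z)%C.

Definition Gamma (x : R) : R :=
  RInt_gen (fun t => Rpower t (x - 1) * exp (- t)) (at_right 0) (Rbar_locally p_infty).

Definition gbinom (s g : R) : R :=
  Gamma (s + 1) / (Gamma (s - g + 1) * Gamma (g + 1)).

Definition unit_disk (z : C) : Prop := Cmod z < 1.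

(* f(z) = z + a_2 z^2 + ... for |z| < 1; values of f outside the disk are irrelevant. *)
Definition class_A (f : C -> C) : Prop :=
  exists a : nat -> C,
    a 0%nat = RtoC 0 /\ a 1%nat = RtoC 1 /\
    forall z : C, unit_disk z -> is_pseries (K := C_AbsRing) (V := C_NormedModule) a z (f z).

(* L is the analytic branch of log (f(z)/z) on the disk that is real at 0.  At most one
   such L exists; for f in class_A it is the branch vanishing at 0.  Log f(z) is then read
   as Log z + L(z), so that f(z)^alpha = z^alpha (f(z)/z)^alpha with z^alpha principal and
   (f(z)/z)^alpha analytic on the whole disk and positive at 0.  Applying the principal Log
   to the values f(z) (or f(z)/z) instead could create spurious discontinuities. *)
Definition log_ratio (f L : C -> C) : Prop :=
  (forall z : C, unit_disk z -> ex_derive (K := C_AbsRing) (V := C_NormedModule) L z) /\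
  snd (L (RtoC 0)) = 0 /\
  (forall z : C, unit_disk z -> f z = z * Cexp (L z))%C.

Definition is_power (alpha : R) (f F : C -> C) : Prop :=
  exists L : C -> C, log_ratio f L /\
    forall z : C, unit_disk z -> z <> RtoC 0 ->
      F z = Cexp (RtoC alpha * (Clog z + L z))%C.

(* The determination of t |-> f(t)^alpha that is analytic for t near z0 and takes the
   principal value at t = z0: Clog z0 + Clog (t / z0) is the branch of log t near z0 with
   value Clog z0 at z0.  It agrees with the principal determination near any z0 off the
   negative real axis, and continues it analytically across the cut otherwise, so that
   derivatives at z0 make sense for every z0 <> 0. *)
Definition power_near (alpha : R) (L : C -> C) (z0 t : C) : C :=
  Cexp (RtoC alpha * (Clog z0 + Clog (t / z0) + L t))%C.

Fixpoint salagean (n : nat) (h : C -> C) (z : C) : C :=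
  match n with
  | O => h z
  | S m => (z * C_derive (salagean m h) z)%C
  end.

(* The point z = 0 is omitted: the quotient is 0/0 there as written, and its removable
   value is 1 > beta for every f in class_A. *)
Definition class_T (n : nat) (alpha beta : R) (f : C -> C) : Prop :=
  class_A f /\
  exists L : C -> C, log_ratio f L /\
    forall z : C, unit_disk z -> z <> RtoC 0 ->
      beta < fst (salagean n (power_near alpha L z) z
                  / (RtoC (alpha ^ n) * Cpow z alpha))%C.

(* I is the integral of g from 0 to z along the segment t = s z, 0 < s < 1, improper at
   both ends. *)
Definition is_segment_integral (g : C -> C) (z I : C) : Prop :=
  is_RInt_gen (V := C_R_NormedModule) (fun s : R => g (RtoC s * z) * z)%C
    (at_right 0) (at_left 1) I.

Definition is_phi1 (alpha c : R) (f phi : C -> C) : Prop :=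
  exists F Phi : C -> C, is_power alpha f F /\ is_power alpha phi Phi /\
    forall z : C, unit_disk z -> z <> RtoC 0 ->
      exists I : C,
        is_segment_integral (fun t => Cpow t (c - 1) * F t)%C z I /\
        Phi z = (RtoC (alpha + c) / Cpow z c * I)%C.

Definition is_phi2 (alpha sigma : R) (f phi : C -> C) : Prop :=
  exists F Phi : C -> C, is_power alpha f F /\ is_power alpha phi Phi /\
    forall z : C, unit_disk z -> z <> RtoC 0 ->
      exists I : C,
        is_segment_integral (fun t => Cpow (Clog (z / t)) (sigma - 1) * F t)%C z I /\
        Phi z = (RtoC (Rpower 2 sigma) / (z * RtoC (Gamma sigma)) * I)%C.

Definition is_phi3 (alpha sigma gamma : R) (f phi : C -> C) : Prop :=
  exists F Phi : C -> C, is_power alpha f F /\ is_power alpha phi Phi /\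
    forall z : C, unit_disk z -> z <> RtoC 0 ->
      exists I : C,
        is_segment_integral
          (fun t => Cpow (RtoC 1 - t / z) (sigma - 1) * Cpow t (gamma - 1) * F t)%C z I /\
        Phi z = (RtoC (gbinom (sigma + gamma) gamma) * (RtoC sigma / Cpow z gamma) * I)%C.

(* phi / phi'(0).  The constants 2^sigma and binom(sigma+gamma, gamma) sigma in phi_2 and
   phi_3 give phi'(0) = 1 only for alpha = 1: for f(z) = z one finds
   phi_2(z)^alpha = (2 / (alpha + 1))^sigma z^alpha.  Membership in class_A, hence in
   class_T, therefore requires this rescaling when alpha <> 1. *)
Definition normalize (phi : C -> C) (z : C) : C :=
  (phi z / C_derive phi (RtoC 0))%C.

(* Main.v *)
Require Import Defs.
From Stdlib Require Import Reals Lra Lia Psatz.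
From Coquelicot Require Import Coquelicot.
Local Open Scope R_scope.

(** Put [p(z) = (f(z)/z)^alpha], a power series [sum p_k z^k] on the unit disk with
    [p_0 = 1].  Since [z d/dz] multiplies [z^(alpha + k)] by [alpha + k], the quotient in
    the definition of the class is the series [sum ((alpha + k)/alpha)^n p_k z^k], so that
    membership in [T_n] says that this series has real part greater than [beta]
    ([salagean_quotient], [class_T_series]).

    On a segment [t = s z] the integrand of each of the three operators becomes a power of
    [z] times [w(s) p(s z)], with a positive weight [w] on [0 < s < 1]: [s^(alpha+c-1)],
    [(- ln s)^(sigma-1) s^alpha] or [(1-s)^(sigma-1) s^(gamma+alpha-1)].  Integrating
    termwise, [(phi(z)/z)^alpha = kappa * sum lam_k p_k z^k] where [lam_k] is the [k]-th
    moment of [w] and [kappa > 0] the constant in front ([int01_CPSeries]).  Multiplication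
    by [((alpha+k)/alpha)^n] commutes with multiplication by [lam_k], so the series
    attached to [phi] is the average of the one attached to [f] over the radius, and a
    positive average preserves a lower bound on the real part ([re_average]).  This gives
    the class condition after division by [kappa * lam_0], which is what the normalization
    [phi/phi'(0)] does ([class_T_of_series]); and [kappa * lam_0 = 1] for [phi_1] always,
    and for [phi_2], [phi_3] when [alpha = 1], by Euler's integrals ([Gamma_int01_scaled],
    [Beta_Gamma]).

    Existence of [phi] requires [sum lam_k p_k z^k] to have no zero.  The weight
    [alpha s^(alpha-1)] has moments [alpha/(alpha+k)], so the same averaging undoes the
    operator one application at a time and shows [Re p > beta >= 0] ([re_euler_decrease]);
    hence the averaged series has positive real part and a principal logarithm.

    The class asks for functions given by power series, while [log_ratio] only gives
    complex differentiable logarithms.  The link is Cauchy's formula for continuously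
    differentiable functions ([holomorphic_CPSeries]): if [e^(aL)], [a] not zero, is a power
    series on the disk, then so is [e^(bL)] for every real [b] ([exp_branch_CPSeries]). *)

(** * Complex derivatives *)

Notation is_Cderive := (is_derive (K := C_AbsRing) (V := C_NormedModule)).
Notation is_Rderive := (is_derive (K := R_AbsRing) (V := C_R_NormedModule)).

Lemma ex_derive_Rcontinuous (f : R -> R) (x : R) : ex_derive f x -> continuous f x.
Proof. apply (ex_derive_continuous (K := R_AbsRing) (V := R_NormedModule)). Qed.

Lemma norm_C_R (z : C) : norm (V := C_R_NormedModule) z = Cmod z.
Proof.
  change (sqrt (Rabs (fst z) ^ 2 + Rabs (snd z) ^ 2) = Cmod z).
  unfold Cmod; now rewrite !pow2_abs.
Qed.

Lemma C_eq (z w : C) : fst z = fst w -> snd z = snd w -> z = w.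
Proof. destruct z, w; simpl; congruence. Qed.

Lemma RtoC_neq_0 (x : R) : x <> 0 -> RtoC x <> RtoC 0.
Proof. intros H E; now apply RtoC_inj in E. Qed.

Lemma fst_le_Cmod (z : C) : Rabs (fst z) <= Cmod z.
Proof. eapply Rle_trans; [apply Rmax_l|apply Rmax_Cmod]. Qed.

Lemma snd_le_Cmod (z : C) : Rabs (snd z) <= Cmod z.
Proof. eapply Rle_trans; [apply Rmax_r|apply Rmax_Cmod]. Qed.

Lemma Cmod_le_sum (z : C) : Cmod z <= Rabs (fst z) + Rabs (snd z).
Proof.
  unfold Cmod; apply Rsqr_incr_0_var.
  - rewrite Rsqr_sqrt by nra.
    pose proof (Rabs_pos (fst z)); pose proof (Rabs_pos (snd z)).
    rewrite <- (pow2_abs (fst z)), <- (pow2_abs (snd z)); unfold Rsqr; nra.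
  - pose proof (Rabs_pos (fst z)); pose proof (Rabs_pos (snd z)); lra.
Qed.

Lemma Cmod_minus_sym (z w : C) : Cmod (z - w)%C = Cmod (w - z)%C.
Proof. rewrite <- Cmod_opp; f_equal; ring. Qed.

Lemma Cmod_triangle_inv (z w : C) : Cmod z - Cmod w <= Cmod (z - w)%C.
Proof.
  pose proof (Cmod_triangle (z - w)%C w) as H.
  replace (z - w + w)%C with z in H by ring; lra.
Qed.

(** [C] carries the uniform structure of a product and that of its modulus, which are
    equivalent but not convertible; estimates in [Cmod] avoid both. *)
Lemma is_Cderive_eps (f : C -> C) (z l : C) :
  is_Cderive f z l <->
  forall eps, 0 < eps -> exists d, 0 < d /\
    forall y, Cmod (y - z)%C < d ->
      Cmod (f y - f z - (y - z) * l)%C <= eps * Cmod (y - z)%C.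
Proof.
  split.
  - intros [_ H] eps Heps.
    destruct (H z (fun P HP => HP) (mkposreal eps Heps)) as [d Hd].
    exists d; split; [apply cond_pos|].
    intros y Hy; exact (Hd y Hy).
  - intros H; split.
    + apply is_linear_scal_l.
    + intros x Hx eps.
      assert (Hxz : x = z).
      { symmetry. exact (is_filter_lim_locally_unique (V := AbsRing_NormedModule C_AbsRing) z x Hx). }
      subst x.
      destruct (H eps (cond_pos eps)) as [d [Hd0 Hd]].
      exists (mkposreal d Hd0); intros y Hy; exact (Hd y Hy).
Qed.

Lemma is_Rderive_eps (f : R -> C) (x : R) (l : C) :
  is_Rderive f x l <->
  forall eps, 0 < eps -> exists d, 0 < d /\
    forall y, Rabs (y - x) < d ->
      Cmod (f y - f x - RtoC (y - x) * l)%C <= eps * Rabs (y - x).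
Proof.
  assert (E : forall y, norm (V := C_R_NormedModule)
            (minus (minus (f y) (f x)) (scal (minus y x) l))
          = Cmod (f y - f x - RtoC (y - x) * l)%C).
  { intros y; rewrite norm_C_R; f_equal; apply C_eq; simpl;
    unfold scal, minus, plus, opp; simpl; unfold mult; simpl; ring. }
  split.
  - intros [_ H] eps Heps.
    destruct (H x (fun P HP => HP) (mkposreal eps Heps)) as [d Hd].
    exists d; split; [apply cond_pos|].
    intros y Hy; rewrite <- E; exact (Hd y Hy).
  - intros H; split.
    + apply is_linear_scal_l.
    + intros x' Hx eps.
      assert (Hxz : x' = x).
      { symmetry. exact (is_filter_lim_locally_unique x x' Hx). }
      subst x'.
      destruct (H eps (cond_pos eps)) as [d [Hd0 Hd]].
      exists (mkposreal d Hd0); intros y Hy.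
      specialize (Hd y Hy); rewrite <- E in Hd; exact Hd.
Qed.

(** Brings in the product and chain rules, which concern a ring as a module over
    itself. *)
Lemma Cderive_bridge (f : C -> C) (z l : C) :
  is_Cderive f z l <->
  is_derive (K := C_AbsRing) (V := AbsRing_NormedModule C_AbsRing) f z l.
Proof.
  split; intros [H1 H2]; (split; [destruct H1; split; auto | exact H2]).
Qed.

Lemma Cderive_const (a z : C) : is_Cderive (fun _ => a) z (RtoC 0).
Proof. apply (is_derive_const (K := C_AbsRing) (V := C_NormedModule)). Qed.

Lemma Cderive_id (z : C) : is_Cderive (fun y => y) z (RtoC 1).
Proof. apply Cderive_bridge. apply (is_derive_id (K := C_AbsRing)). Qed.

Lemma Cderive_eq (f : C -> C) (z l l' : C) :
  is_Cderive f z l -> l = l' -> is_Cderive f z l'.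
Proof. now intros H <-. Qed.

Lemma Cderive_plus (f g : C -> C) (z l m : C) :
  is_Cderive f z l -> is_Cderive g z m ->
  is_Cderive (fun y => f y + g y)%C z (l + m)%C.
Proof. apply (is_derive_plus (K := C_AbsRing) (V := C_NormedModule)). Qed.

Lemma Cderive_mult (f g : C -> C) (z l m : C) :
  is_Cderive f z l -> is_Cderive g z m ->
  is_Cderive (fun y => f y * g y)%C z (l * g z + f z * m)%C.
Proof.
  intros Hf Hg; apply Cderive_bridge; apply Cderive_bridge in Hf, Hg.
  apply (is_derive_mult (K := C_AbsRing) f g z l m Hf Hg Cmult_comm).
Qed.

Lemma Cderive_comp (f g : C -> C) (z l m : C) :
  is_Cderive f (g z) l -> is_Cderive g z m ->
  is_Cderive (fun y => f (g y)) z (m * l)%C.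
Proof.
  intros Hf Hg; apply Cderive_bridge in Hg.
  apply (is_derive_comp (K := C_AbsRing) (V := C_NormedModule) f g z l m Hf Hg).
Qed.

Lemma Cderive_scal (a : C) (f : C -> C) (z l : C) :
  is_Cderive f z l -> is_Cderive (fun y => a * f y)%C z (a * l)%C.
Proof.
  intros H; eapply Cderive_eq.
  - apply Cderive_mult; [apply Cderive_const|exact H].
  - cbv beta; ring.
Qed.

Lemma Cderive_ext_loc (f g : C -> C) (z l : C) (d : R) :
  0 < d -> (forall y, Cmod (y - z)%C < d -> f y = g y) ->
  is_Cderive f z l -> is_Cderive g z l.
Proof.
  intros Hd E H; apply is_Cderive_eps; intros eps Heps.
  apply is_Cderive_eps with (eps := eps) in H; [|exact Heps].
  destruct H as [d' [Hd' H]].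
  exists (Rmin d d'); split; [now apply Rmin_pos|].
  intros y Hy.
  rewrite <- E, <- E.
  - apply H. eapply Rlt_le_trans; [exact Hy|apply Rmin_r].
  - replace (z - z)%C with (RtoC 0) by ring. now rewrite Cmod_0.
  - eapply Rlt_le_trans; [exact Hy|apply Rmin_l].
Qed.

Lemma Cderive_unique (f : C -> C) (z l m : C) :
  is_Cderive f z l -> is_Cderive f z m -> l = m.
Proof.
  intros H1 H2.
  now rewrite <- (is_C_derive_unique _ _ _ H1), <- (is_C_derive_unique _ _ _ H2).
Qed.

(** * Continuity of complex valued maps *)

Notation Ccontinuous := (continuous (U := C_UniformSpace)).
Notation CCcontinuous := (continuous (T := C_UniformSpace) (U := C_UniformSpace)).

Lemma Ccontinuous_pair {U : UniformSpace} (f : U -> C) (x : U) :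
  Ccontinuous f x <->
  continuous (fun u => fst (f u)) x /\ continuous (fun u => snd (f u)) x.
Proof.
  split.
  - intros H; split.
    + apply (continuous_comp f (fun p : R * R => fst p)); [exact H|].
      apply (continuous_fst (U := R_UniformSpace) (V := R_UniformSpace)).
    + apply (continuous_comp f (fun p : R * R => snd p)); [exact H|].
      apply (continuous_snd (U := R_UniformSpace) (V := R_UniformSpace)).
  - intros [H1 H2].
    apply filterlim_locally; intros eps.
    generalize (proj1 (filterlim_locally _ _) H1 eps); intros G1.
    generalize (proj1 (filterlim_locally _ _) H2 eps); intros G2.
    generalize (filter_and _ _ G1 G2); apply filter_imp.
    intros u [A B]; split; assumption.
Qed.

Lemma Ccontinuous_fst {U : UniformSpace} (f : U -> C) (x : U) :
  Ccontinuous f x -> continuous (fun u => fst (f u)) x.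
Proof. intros H; exact (proj1 (proj1 (Ccontinuous_pair f x) H)). Qed.

Lemma Ccontinuous_plus {U : UniformSpace} (f g : U -> C) (x : U) :
  Ccontinuous f x -> Ccontinuous g x -> Ccontinuous (fun u => f u + g u)%C x.
Proof.
  rewrite !Ccontinuous_pair; intros [A B] [A' B']; split; simpl.
  - now apply (continuous_plus (V := R_NormedModule) (fun u => fst (f u))).
  - now apply (continuous_plus (V := R_NormedModule) (fun u => snd (f u))).
Qed.

Lemma Ccontinuous_mult {U : UniformSpace} (f g : U -> C) (x : U) :
  Ccontinuous f x -> Ccontinuous g x -> Ccontinuous (fun u => f u * g u)%C x.
Proof.
  rewrite !Ccontinuous_pair; intros [A B] [A' B']; split; simpl.
  - apply (continuous_minus (V := R_NormedModule)
             (fun u => fst (f u) * fst (g u)) (fun u => snd (f u) * snd (g u)));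
      now apply (continuous_mult (K := R_AbsRing)).
  - apply (continuous_plus (V := R_NormedModule)
             (fun u => fst (f u) * snd (g u)) (fun u => snd (f u) * fst (g u)));
      now apply (continuous_mult (K := R_AbsRing)).
Qed.

Lemma Ccontinuous_eps (f : C -> C) (z : C) :
  CCcontinuous f z <->
  forall eps, 0 < eps -> exists d, 0 < d /\
    forall y, Cmod (y - z)%C < d -> Cmod (f y - f z)%C < eps.
Proof.
  split.
  - intros H eps Heps.
    assert (He : 0 < eps / 2) by lra.
    generalize (proj1 (filterlim_locally _ _) H (mkposreal _ He)).
    intros G; apply locally_C in G; destruct G as [d Hd].
    exists d; split; [apply cond_pos|].
    intros y Hy; specialize (Hd y Hy).
    eapply Rle_lt_trans; [apply Cmod_le_sum|].
    destruct Hd as [A B].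
    change (Rabs (fst (f y) - fst (f z)) < eps / 2) in A.
    change (Rabs (snd (f y) - snd (f z)) < eps / 2) in B.
    simpl; unfold Rminus in A, B; lra.
  - intros H; apply filterlim_locally; intros eps.
    destruct (H eps (cond_pos eps)) as [d [Hd0 Hd]].
    apply locally_C; exists (mkposreal d Hd0); intros y Hy.
    apply C_NormedModule_mixin_compat1, (Hd y Hy).
Qed.

Lemma Cderive_continuous (f : C -> C) (z l : C) :
  is_Cderive f z l -> CCcontinuous f z.
Proof.
  intros H P HP; apply locally_C.
  refine (ex_derive_continuous (K := C_AbsRing) (V := C_NormedModule) f z _ P HP).
  now exists l.
Qed.

Lemma Ccontinuous_comp {U : UniformSpace} (f : U -> C) (g : C -> C) (x : U) :
  Ccontinuous f x -> CCcontinuous g (f x) ->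
  Ccontinuous (fun u => g (f u)) x.
Proof. intros; now apply (continuous_comp f g). Qed.

(** Recovers at [0] the identities obtained after division by [z]. *)
Lemma Ccontinuous_eq_punctured (rho : R) (u v : C -> C) :
  0 < rho ->
  CCcontinuous u (RtoC 0) ->
  CCcontinuous v (RtoC 0) ->
  (forall z, z <> RtoC 0 -> Cmod z < rho -> u z = v z) ->
  forall z, Cmod z < rho -> u z = v z.
Proof.
  intros Hrho Cu Cv E1 z Hz.
  destruct (Ceq_dec z (RtoC 0)) as [->|Hz0]; [|now apply E1].
  apply Ceq_minus, Cmod_eq_0.
  destruct (Rle_lt_or_eq_dec 0 _ (Cmod_ge_0 (u (RtoC 0) - v (RtoC 0))%C)) as [P|P];
    [exfalso|now symmetry].
  set (e := Cmod (u (RtoC 0) - v (RtoC 0))%C) in *.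
  destruct (proj1 (Ccontinuous_eps _ _) Cu (e / 2) ltac:(lra)) as [d1 [Hd1 H1]].
  destruct (proj1 (Ccontinuous_eps _ _) Cv (e / 2) ltac:(lra)) as [d2 [Hd2 H2]].
  set (x := Rmin rho (Rmin d1 d2) / 2).
  assert (Hm : 0 < Rmin rho (Rmin d1 d2)) by (repeat apply Rmin_pos; assumption).
  assert (Hx : 0 < x) by (unfold x; lra).
  pose proof (Rmin_l rho (Rmin d1 d2)); pose proof (Rmin_r rho (Rmin d1 d2)).
  pose proof (Rmin_l d1 d2); pose proof (Rmin_r d1 d2).
  assert (Hxm : Cmod (RtoC x - RtoC 0)%C = x).
  { replace (RtoC x - RtoC 0)%C with (RtoC x) by ring. rewrite Cmod_R, Rabs_pos_eq; lra. }
  specialize (H1 (RtoC x)); specialize (H2 (RtoC x)); rewrite Hxm in H1, H2.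
  specialize (H1 ltac:(unfold x; lra)); specialize (H2 ltac:(unfold x; lra)).
  rewrite <- E1 in H2.
  2:{ intros F; apply RtoC_inj in F; lra. }
  2:{ rewrite Cmod_R, Rabs_pos_eq; unfold x; lra. }
  assert (e <= Cmod (u (RtoC x) - u (RtoC 0))%C + Cmod (u (RtoC x) - v (RtoC 0))%C).
  { unfold e. rewrite (Cmod_minus_sym (u (RtoC x)) (u (RtoC 0))).
    eapply Rle_trans; [|apply Cmod_triangle]; right; f_equal; ring. }
  lra.
Qed.

(** * Differentiation along curves *)

Lemma Rderive_fst (f : R -> C) (x : R) (l : C) :
  is_Rderive f x l -> is_derive (fun t => fst (f t)) x (fst l).
Proof.
  rewrite is_Rderive_eps; intros H; split; [apply is_linear_scal_l|].
  intros x' Hx eps.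
  assert (Hxz : x' = x) by (symmetry; exact (is_filter_lim_locally_unique x x' Hx)).
  subst x'.
  destruct (H eps (cond_pos eps)) as [d [Hd0 Hd]].
  exists (mkposreal d Hd0); intros y Hy.
  specialize (Hd y Hy).
  eapply Rle_trans; [|exact Hd].
  eapply Rle_trans; [|apply fst_le_Cmod].
  right; simpl; unfold norm; simpl; unfold abs, minus, plus, opp, scal; simpl;
    unfold mult; simpl; f_equal; ring.
Qed.

Lemma Rderive_snd (f : R -> C) (x : R) (l : C) :
  is_Rderive f x l -> is_derive (fun t => snd (f t)) x (snd l).
Proof.
  intros H.
  assert (G : is_Rderive (fun t => - Ci * f t)%C x (- Ci * l)%C).
  { rewrite is_Rderive_eps in *; intros eps Heps.
    destruct (H eps Heps) as [d [Hd0 Hd]]; exists d; split; [exact Hd0|].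
    intros y Hy; specialize (Hd y Hy).
    replace (- Ci * f y - - Ci * f x - RtoC (y - x) * (- Ci * l))%C
      with ((- Ci) * (f y - f x - RtoC (y - x) * l))%C by ring.
    rewrite Cmod_mult, Cmod_opp, Cmod_Ci; lra. }
  apply Rderive_fst in G; simpl in G.
  replace (- 0 * fst l - - (1) * snd l) with (snd l) in G by ring.
  eapply is_derive_ext; [|exact G]; intros t; simpl; ring.
Qed.

Lemma Rderive_comp (f : C -> C) (g : R -> C) (x : R) (l m : C) :
  is_Cderive f (g x) l -> is_Rderive g x m -> is_Rderive (fun t => f (g t)) x (m * l)%C.
Proof.
  rewrite is_Cderive_eps, !is_Rderive_eps; intros Hf Hg eps Heps.
  set (K := Cmod m + 1).
  assert (HK : 0 < K) by (unfold K; pose proof (Cmod_ge_0 m); lra).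
  set (M := Cmod l + 1).
  assert (HM : 0 < M) by (unfold M; pose proof (Cmod_ge_0 l); lra).
  assert (He1 : 0 < eps / (2 * K)) by (apply Rdiv_lt_0_compat; lra).
  assert (He2 : 0 < Rmin 1 (eps / (2 * M))).
  { apply Rmin_pos; [lra|apply Rdiv_lt_0_compat; lra]. }
  destruct (Hf _ He1) as [d1 [Hd1 H1]].
  destruct (Hg _ He2) as [d2 [Hd2 H2]].
  exists (Rmin d2 (d1 / K)); split.
  { apply Rmin_pos; [exact Hd2|apply Rdiv_lt_0_compat; lra]. }
  intros y Hy.
  assert (Hy2 := Rlt_le_trans _ _ _ Hy (Rmin_l _ _)).
  assert (Hy1 := Rlt_le_trans _ _ _ Hy (Rmin_r _ _)).
  specialize (H2 y Hy2).
  pose proof (Rabs_pos (y - x)) as Hp.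
  assert (A : Cmod (g y - g x)%C <= K * Rabs (y - x)).
  { replace (g y - g x)%C with
      ((g y - g x - RtoC (y - x) * m) + RtoC (y - x) * m)%C by ring.
    eapply Rle_trans; [apply Cmod_triangle|].
    rewrite Cmod_mult, Cmod_R; unfold K.
    pose proof (Rmin_l 1 (eps / (2 * M))); nra. }
  assert (B : Cmod (g y - g x)%C < d1).
  { eapply Rle_lt_trans; [exact A|].
    apply Rmult_lt_reg_r with (/ K); [now apply Rinv_0_lt_compat|].
    replace (K * Rabs (y - x) * / K) with (Rabs (y - x)) by (field; lra).
    exact Hy1. }
  specialize (H1 _ B).
  replace (f (g y) - f (g x) - RtoC (y - x) * (m * l))%C with
    ((f (g y) - f (g x) - (g y - g x) * l) + (g y - g x - RtoC (y - x) * m) * l)%C by ring.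
  eapply Rle_trans; [apply Cmod_triangle|]; rewrite Cmod_mult.
  assert (E1 : eps / (2 * K) * Cmod (g y - g x)%C <= eps / 2 * Rabs (y - x)).
  { replace (eps / 2 * Rabs (y - x)) with (eps / (2 * K) * (K * Rabs (y - x)))
      by (field; lra).
    apply Rmult_le_compat_l; lra. }
  assert (E2 : Cmod (g y - g x - RtoC (y - x) * m)%C * Cmod l <= eps / 2 * Rabs (y - x)).
  { replace (eps / 2 * Rabs (y - x)) with (eps / (2 * M) * Rabs (y - x) * M)
      by (field; lra).
    apply Rmult_le_compat; try apply Cmod_ge_0.
    - eapply Rle_trans; [exact H2|].
      apply Rmult_le_compat_r; [exact Hp|apply Rmin_r].
    - unfold M; lra. }
  lra.
Qed.

(** * The exponential and the principal logarithm *)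

Lemma Cexp_plus (z w : C) : Cexp (z + w)%C = (Cexp z * Cexp w)%C.
Proof.
  apply C_eq; simpl; rewrite exp_plus, ?cos_plus, ?sin_plus; ring.
Qed.

Lemma Cexp_RtoC (x : R) : Cexp (RtoC x) = RtoC (exp x).
Proof. apply C_eq; simpl; [rewrite cos_0|rewrite sin_0]; ring. Qed.

Lemma Cexp_0 : Cexp (RtoC 0) = RtoC 1.
Proof. now rewrite Cexp_RtoC, exp_0. Qed.

Lemma Cexp_neq_0 (z : C) : Cexp z <> RtoC 0.
Proof.
  intros H.
  assert (E : (Cexp z * Cexp (- z))%C = RtoC 1).
  { rewrite <- Cexp_plus. replace (z + - z)%C with (RtoC 0) by ring. apply Cexp_0. }
  rewrite H, Cmult_0_l in E. now apply C1_nz.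
Qed.

Lemma Cmod_Cexp (z : C) : Cmod (Cexp z) = exp (fst z).
Proof.
  unfold Cmod, Cexp; simpl fst; simpl snd.
  replace ((exp (fst z) * cos (snd z)) ^ 2 + (exp (fst z) * sin (snd z)) ^ 2)
    with (Rsqr (exp (fst z))).
  - apply sqrt_Rsqr. left; apply exp_pos.
  - pose proof (sin2_cos2 (snd z)) as H; unfold Rsqr in *; nra.
Qed.

Lemma real_derive_at_0 (f : R -> R) (l : R) :
  is_derive f 0 l -> forall eps, 0 < eps -> exists d, 0 < d /\
    forall x, Rabs x < d -> Rabs (f x - f 0 - x * l) <= eps * Rabs x.
Proof.
  intros [_ H] eps Heps.
  destruct (H 0 (fun P HP => HP) (mkposreal _ Heps)) as [d Hd].
  exists d; split; [apply cond_pos|]; intros x Hx.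
  assert (Hx' : ball 0 d x).
  { change (Rabs (x + - 0) < d). now rewrite Ropp_0, Rplus_0_r. }
  specialize (Hd x Hx').
  unfold norm in Hd; simpl in Hd;
    unfold abs, minus, plus, opp, scal in Hd; simpl in Hd; unfold mult in Hd; simpl in Hd.
  rewrite Ropp_0, Rplus_0_r in Hd; exact Hd.
Qed.

(** By the addition formula it is enough to expand at [0], where [e^h = 1 + h + o(h)]
    follows from the derivatives of [exp], [cos] and [sin]. *)
Lemma Cderive_Cexp (z : C) : is_Cderive Cexp z (Cexp z).
Proof.
  apply is_Cderive_eps; intros eps Heps.
  set (K := Cmod (Cexp z)).
  assert (HK : 0 < K) by (apply Cmod_gt_0, Cexp_neq_0).
  (* the expansion below has the error [9 e |h|] *)
  set (e := Rmin 1 (eps / (10 * K))).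
  assert (He : 0 < e) by (apply Rmin_pos; [lra|apply Rdiv_lt_0_compat; lra]).
  assert (He1 : e <= 1) by apply Rmin_l.
  assert (He2 : 10 * (K * e) <= eps).
  { replace eps with (10 * (K * (eps / (10 * K)))) by (field; lra).
    apply Rmult_le_compat_l; [lra|]; apply Rmult_le_compat_l; [lra|apply Rmin_r]. }
  clearbody e.
  destruct (real_derive_at_0 exp 1) with (eps := e) as [d1 [Hd1 H1]]; [|exact He|].
  { apply is_derive_Reals. rewrite <- exp_0. apply derivable_pt_lim_exp. }
  destruct (real_derive_at_0 cos 0) with (eps := e) as [d2 [Hd2 H2]]; [|exact He|].
  { apply is_derive_Reals. replace 0 with (- sin 0) at 2 by (rewrite sin_0; ring).
    apply derivable_pt_lim_cos. }
  destruct (real_derive_at_0 sin 1) with (eps := e) as [d3 [Hd3 H3]]; [|exact He|].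
  { apply is_derive_Reals. rewrite <- cos_0. apply derivable_pt_lim_sin. }
  exists (Rmin e (Rmin d1 (Rmin d2 d3))); split.
  { repeat apply Rmin_pos; assumption. }
  intros y Hy.
  set (h := (y - z)%C) in *.
  replace (Cexp y - Cexp z - h * Cexp z)%C with
    (Cexp z * (Cexp h - RtoC 1 - h))%C.
  2:{ replace y with (z + h)%C by (unfold h; ring). rewrite Cexp_plus; ring. }
  clearbody h.
  rewrite Cmod_mult; fold K.
  assert (Hfst := fst_le_Cmod h); assert (Hsnd := snd_le_Cmod h).
  assert (Hm := Rmin_l e (Rmin d1 (Rmin d2 d3))).
  assert (Hm1 := Rmin_l d1 (Rmin d2 d3)).
  assert (Hm2 := Rmin_l d2 d3).
  assert (Hm3 := Rmin_r d2 d3).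
  assert (Hm4 := Rmin_r d1 (Rmin d2 d3)).
  assert (Hm5 := Rmin_r e (Rmin d1 (Rmin d2 d3))).
  specialize (H1 (fst h) ltac:(lra)).
  specialize (H2 (snd h) ltac:(lra)).
  specialize (H3 (snd h) ltac:(lra)).
  rewrite exp_0 in H1; rewrite cos_0 in H2; rewrite sin_0 in H3.
  set (x := fst h) in *; set (v := snd h) in *.
  pose proof (Rabs_pos x) as Px; pose proof (Rabs_pos v) as Pv.
  pose proof (Rle_abs x) as Hx1; pose proof (Rabs_maj2 x) as Hx2.
  assert (Ex : Rabs (exp x - 1) <= 2 * Rabs x).
  { replace (exp x - 1) with ((exp x - 1 - x * 1) + x) by ring.
    eapply Rle_trans; [apply Rabs_triang|]; nra. }
  assert (Ex3 : Rabs (exp x) <= 3).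
  { replace (exp x) with ((exp x - 1) + 1) by ring.
    eapply Rle_trans; [apply Rabs_triang|]; rewrite Rabs_R1; lra. }
  assert (F : Rabs (exp x * cos v - 1 - x) <= 4 * e * Cmod h).
  { replace (exp x * cos v - 1 - x) with
      (exp x * (cos v - 1 - v * 0) + (exp x - 1 - x * 1)) by ring.
    eapply Rle_trans; [apply Rabs_triang|]; rewrite Rabs_mult.
    pose proof (Rabs_pos (exp x)); pose proof (Rabs_pos (cos v - 1 - v * 0)).
    nra. }
  assert (G : Rabs (exp x * sin v - v) <= 5 * e * Cmod h).
  { replace (exp x * sin v - v) with
      (exp x * (sin v - 0 - v * 1) + (exp x - 1) * v) by ring.
    eapply Rle_trans; [apply Rabs_triang|]; rewrite !Rabs_mult.
    pose proof (Rabs_pos (exp x)); pose proof (Rabs_pos (sin v - 0 - v * 1)).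
    pose proof (Rabs_pos (exp x - 1)).
    assert (Rabs (exp x) * Rabs (sin v - 0 - v * 1) <= 3 * (e * Cmod h)) by nra.
    assert (Rabs (exp x - 1) * Rabs v <= 2 * e * Cmod h).
    { apply Rmult_le_compat; lra. }
    lra. }
  assert (T : Cmod (Cexp h - RtoC 1 - h)%C <= 9 * e * Cmod h).
  { eapply Rle_trans; [apply Cmod_le_sum|].
    simpl fst; simpl snd; fold x v.
    replace (exp x * cos v + - (1) + - x) with (exp x * cos v - 1 - x) by ring.
    replace (exp x * sin v + - 0 + - v) with (exp x * sin v - v) by ring.
    lra. }
  pose proof (Cmod_ge_0 h).
  apply Rle_trans with (K * (9 * e * Cmod h)).
  - apply Rmult_le_compat_l; lra.
  - replace (K * (9 * e * Cmod h)) with (9 * (K * e) * Cmod h) by ring.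
    apply Rmult_le_compat_r; nra.
Qed.

Lemma Cmod_unit_bounds (z : C) : z <> RtoC 0 -> -1 <= fst z / Cmod z <= 1.
Proof.
  intros H; apply Cmod_gt_0 in H.
  pose proof (fst_le_Cmod z) as B; apply Rabs_le_between in B.
  split.
  - apply Rmult_le_reg_r with (Cmod z); [exact H|].
    replace (fst z / Cmod z * Cmod z) with (fst z) by (field; lra); lra.
  - apply Rmult_le_reg_r with (Cmod z); [exact H|].
    replace (fst z / Cmod z * Cmod z) with (fst z) by (field; lra); lra.
Qed.

Lemma Cexp_Clog (z : C) : z <> RtoC 0 -> Cexp (Clog z) = z.
Proof.
  intros H; pose proof (Cmod_unit_bounds z H) as B; apply Cmod_gt_0 in H.
  assert (S : Cmod z * sqrt (1 - (fst z / Cmod z)²) = Rabs (snd z)).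
  { rewrite <- (sqrt_Rsqr (Cmod z)) at 1 by lra.
    rewrite <- sqrt_mult_alt by apply Rle_0_sqr.
    rewrite <- sqrt_Rsqr_abs; f_equal.
    replace ((Cmod z)² * (1 - (fst z / Cmod z)²)) with ((Cmod z)² - (fst z)²)
      by (unfold Rsqr; field; lra).
    unfold Cmod; rewrite Rsqr_sqrt by nra; unfold Rsqr; ring. }
  unfold Cexp, Clog, Carg; simpl fst; simpl snd; rewrite exp_ln by exact H.
  destruct (Rle_dec 0 (snd z)) as [P|P]; apply C_eq; simpl.
  - rewrite cos_acos by exact B; field; lra.
  - rewrite sin_acos by exact B. rewrite S; now apply Rabs_pos_eq.
  - rewrite cos_neg, cos_acos by exact B; field; lra.
  - rewrite sin_neg, sin_acos by exact B.
    rewrite Ropp_mult_distr_r_reverse, S, Rabs_left by lra; ring.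
Qed.

Lemma Clog_scal (x : R) (z : C) :
  0 < x -> z <> RtoC 0 -> Clog (RtoC x * z)%C = (RtoC (ln x) + Clog z)%C.
Proof.
  intros Hx Hz; pose proof (proj1 (Cmod_gt_0 z) Hz) as Pz.
  assert (M : Cmod (RtoC x * z)%C = x * Cmod z).
  { rewrite Cmod_mult, Cmod_R, Rabs_pos_eq; lra. }
  apply C_eq; unfold Clog; cbn [fst snd Cplus RtoC].
  - rewrite M. now apply ln_mult.
  - rewrite Rplus_0_l. unfold Carg; rewrite M.
    replace (fst (RtoC x * z)%C) with (x * fst z) by (simpl; ring).
    replace (snd (RtoC x * z)%C) with (x * snd z) by (simpl; ring).
    replace (x * fst z / (x * Cmod z)) with (fst z / Cmod z) by (field; lra).
    destruct (Rle_dec 0 (snd z)), (Rle_dec 0 (x * snd z)); auto; exfalso; nra.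
Qed.

Lemma Clog_RtoC (x : R) : 0 < x -> Clog (RtoC x) = RtoC (ln x).
Proof.
  intros Hx; unfold Clog, Carg; apply C_eq; simpl;
    rewrite Cmod_R, Rabs_pos_eq by lra; [reflexivity|].
  destruct (Rle_dec 0 0) as [_|N]; [|lra].
  replace (x / x) with 1 by (field; lra). apply acos_1.
Qed.

(** On the right half plane the two cases in the definition of [Carg] are a single
    arctangent. *)
Lemma Carg_atan (z : C) : 0 < fst z -> Carg z = atan (snd z / fst z).
Proof.
  intros Hx.
  assert (Hz : z <> RtoC 0) by (intros E; rewrite E in Hx; simpl in Hx; lra).
  assert (P := proj1 (Cmod_gt_0 z) Hz).
  assert (A : acos (fst z / Cmod z) = atan (Rabs (snd z) / fst z)).
  { rewrite acos_atan by (apply Rdiv_lt_0_compat; lra).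
    f_equal.
    assert (S : sqrt (1 - (fst z / Cmod z)²) = Rabs (snd z) / Cmod z).
    { replace (1 - (fst z / Cmod z)²) with ((snd z / Cmod z)²).
      - rewrite sqrt_Rsqr_abs; unfold Rdiv; rewrite Rabs_mult.
        now rewrite (Rabs_pos_eq (/ Cmod z)) by (left; now apply Rinv_0_lt_compat).
      - assert (Q : (Cmod z)² = (fst z)² + (snd z)²)
          by (unfold Cmod; rewrite Rsqr_sqrt by nra; unfold Rsqr; ring).
        unfold Rsqr in *; apply Rmult_eq_reg_r with (Cmod z * Cmod z); [|nra].
        field_simplify; [nra|lra|lra]. }
    rewrite S; field; lra. }
  unfold Carg; rewrite A.
  destruct (Rle_dec 0 (snd z)) as [Q|Q].
  - rewrite Rabs_pos_eq; auto.
  - rewrite Rabs_left by lra. rewrite <- atan_opp. f_equal; field; lra.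
Qed.

Lemma fst_continuous (z : C) : continuous (T := C_UniformSpace) (fun w : C => fst w) z.
Proof. apply (continuous_fst (U := R_UniformSpace) (V := R_UniformSpace)). Qed.

Lemma snd_continuous (z : C) : continuous (T := C_UniformSpace) (fun w : C => snd w) z.
Proof. apply (continuous_snd (U := R_UniformSpace) (V := R_UniformSpace)). Qed.

Lemma sum_squares_continuous (z : C) :
  continuous (T := C_UniformSpace) (fun w : C => fst w ^ 2 + snd w ^ 2) z.
Proof.
  apply (continuous_plus (U := C_UniformSpace) (V := R_NormedModule)
           (fun w : C => fst w ^ 2) (fun w : C => snd w ^ 2)); simpl;
    repeat apply (continuous_mult (U := C_UniformSpace) (K := R_AbsRing));
    auto using fst_continuous, snd_continuous, continuous_const.
Qed.

Lemma Clog_continuous (z : C) :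
  0 < fst z -> CCcontinuous Clog z.
Proof.
  intros Hx.
  assert (Hz : z <> RtoC 0) by (intros E; rewrite E in Hx; simpl in Hx; lra).
  assert (P := proj1 (Cmod_gt_0 z) Hz).
  apply Ccontinuous_pair; split.
  - apply (continuous_comp (U := C_UniformSpace) Cmod ln).
    + apply (continuous_comp (U := C_UniformSpace)
               (fun w : C => fst w ^ 2 + snd w ^ 2) sqrt).
      * apply sum_squares_continuous.
      * apply continuous_sqrt.
    + apply ex_derive_Rcontinuous.
      exists (/ Cmod z). apply is_derive_Reals, derivable_pt_lim_ln, P.
  - apply (continuous_ext_loc (T := C_UniformSpace) (U := R_UniformSpace) (fun u : C => snd (Clog u)) (fun w : C => atan (snd w * / fst w))).
    + destruct (proj1 (filterlim_locally _ _) (fst_continuous z) (mkposreal _ Hx)) as [d Hd].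
      exists d; intros w Hw; specialize (Hd w Hw).
      change (Rabs (fst w - fst z) < fst z) in Hd; apply Rabs_def2 in Hd.
      symmetry; apply Carg_atan; lra.
    + apply (continuous_comp (U := C_UniformSpace) (fun w : C => snd w * / fst w) atan).
      * apply (continuous_mult (U := C_UniformSpace) (K := R_AbsRing));
          [apply snd_continuous|].
        apply (continuous_comp (U := C_UniformSpace) (fun w : C => fst w) Rinv);
          [apply fst_continuous|].
        apply continuous_Rinv; lra.
      * apply ex_derive_Rcontinuous.
        eexists; apply is_derive_Reals, derivable_pt_lim_atan.
Qed.

(** A continuous right inverse of [Cexp] inherits the reciprocal derivative. *)
Lemma Cderive_Clog (z : C) : 0 < fst z -> is_Cderive Clog z (/ z)%C.
Proof.
  intros Hx.
  assert (Hz : z <> RtoC 0) by (intros E; rewrite E in Hx; simpl in Hx; lra).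
  assert (P := proj1 (Cmod_gt_0 z) Hz).
  apply is_Cderive_eps; intros eps Heps.
  set (e := Rmin (Cmod z / 2) (eps * (Cmod z * Cmod z) / 2)).
  assert (He : 0 < e).
  { apply Rmin_pos; [lra|]. assert (0 < Cmod z * Cmod z) by nra. nra. }
  destruct (proj1 (is_Cderive_eps _ _ _) (Cderive_Cexp (Clog z)) e He) as [d1 [Hd1 H1]].
  destruct (proj1 (Ccontinuous_eps _ _) (Clog_continuous z Hx) d1 Hd1) as [d2 [Hd2 H2]].
  exists (Rmin d2 (Cmod z)); split; [now apply Rmin_pos|].
  intros w Hw.
  assert (Hw2 := H2 w (Rlt_le_trans _ _ _ Hw (Rmin_l _ _))).
  assert (Hw3 := Rlt_le_trans _ _ _ Hw (Rmin_r _ _)).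
  assert (Hwz : w <> RtoC 0).
  { intros E; rewrite E in Hw3.
    replace (RtoC 0 - z)%C with (- z)%C in Hw3 by ring. rewrite Cmod_opp in Hw3; lra. }
  specialize (H1 _ Hw2). rewrite !Cexp_Clog in H1 by assumption.
  set (h := (Clog w - Clog z)%C) in *.
  set (rho := (w - z - h * z)%C) in *.
  assert (Hh : Cmod h * Cmod z <= 2 * Cmod (w - z)%C).
  { assert (E : (h * z)%C = ((w - z) - rho)%C) by (unfold rho; ring).
    rewrite <- Cmod_mult, E.
    assert (T := Cmod_triangle (w - z)%C (- rho)%C).
    rewrite Cmod_opp in T; fold (Cminus (w - z) rho) in T.
    assert (Hh : Cmod h * Cmod z <= Cmod (w - z)%C + e * Cmod h)
      by (rewrite <- Cmod_mult, E; lra).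
    pose proof (Rmin_l (Cmod z / 2) (eps * (Cmod z * Cmod z) / 2)) as R1; fold e in R1.
    pose proof (Cmod_ge_0 h).
    rewrite <- Cmod_mult, E in Hh.
    assert (e * Cmod h <= Cmod (w - z)%C).
    { assert (Cmod h * Cmod z <= Cmod (w - z)%C + e * Cmod h)
        by (rewrite <- Cmod_mult, E; lra). nra. }
    lra. }
  replace (h - (w - z) * / z)%C with (- (rho / z))%C by (unfold rho; field; exact Hz).
  rewrite Cmod_opp, Cmod_div by exact Hz.
  apply Rmult_le_reg_r with (Cmod z); [exact P|].
  replace (Cmod rho / Cmod z * Cmod z) with (Cmod rho) by (field; lra).
  eapply Rle_trans; [exact H1|].
  apply Rmult_le_reg_r with (Cmod z); [exact P|].
  pose proof (Rmin_r (Cmod z / 2) (eps * (Cmod z * Cmod z) / 2)) as R2; fold e in R2.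
  pose proof (Cmod_ge_0 (w - z)%C).
  apply Rle_trans with (e * (2 * Cmod (w - z)%C)); [nra|].
  apply Rle_trans with (eps * (Cmod z * Cmod z) / 2 * (2 * Cmod (w - z)%C)); [nra|lra].
Qed.

(** * Complex power series *)

Notation is_Cseries := (is_series (K := C_AbsRing) (V := C_NormedModule)).
Notation is_Cpseries := (is_pseries (K := C_AbsRing) (V := C_NormedModule)).
Notation Csum_n := (sum_n (G := C_NormedModule)).

Lemma pow_n_Cpow (z : C) (n : nat) : pow_n (K := C_Ring) z n = (z ^ n)%C.
Proof. induction n as [|n IH]; [reflexivity|]. simpl; rewrite IH; reflexivity. Qed.

Lemma is_Cpseries_series (a : nat -> C) (z l : C) :
  is_Cpseries a z l <-> is_Cseries (fun k => z ^ k * a k)%C l.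
Proof.
  split; apply is_series_ext; intros n; rewrite <- pow_n_Cpow; reflexivity.
Qed.

Lemma is_Cseries_eps (u : nat -> C) (l : C) :
  is_Cseries u l <->
  forall eps, 0 < eps -> exists N, forall n, (N <= n)%nat ->
    Cmod (Csum_n u n - l)%C < eps.
Proof.
  unfold is_series; split.
  - intros H eps Heps.
    apply (filterlim_locally_ball_norm (K := C_AbsRing) (U := C_NormedModule)) with
      (eps := mkposreal eps Heps) in H.
    destruct H as [N HN]; exists N; intros n Hn; exact (HN n Hn).
  - intros H.
    apply (filterlim_locally_ball_norm (K := C_AbsRing) (U := C_NormedModule)).
    intros eps; destruct (H eps (cond_pos eps)) as [N HN].
    exists N; intros n Hn; exact (HN n Hn).
Qed.

Lemma is_Cseries_unique (u : nat -> C) (l m : C) :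
  is_Cseries u l -> is_Cseries u m -> l = m.
Proof.
  apply (filterlim_locally_unique (K := C_AbsRing) (V := C_NormedModule)).
Qed.

Lemma is_Cseries_eq (u : nat -> C) (l l' : C) :
  is_Cseries u l -> l = l' -> is_Cseries u l'.
Proof. now intros H <-. Qed.

Lemma is_Cseries_plus (u v : nat -> C) (l m : C) :
  is_Cseries u l -> is_Cseries v m -> is_Cseries (fun k => u k + v k)%C (l + m)%C.
Proof. apply (is_series_plus (K := C_AbsRing) (V := C_NormedModule)). Qed.

Lemma is_Cseries_scal (c : C) (u : nat -> C) (l : C) :
  is_Cseries u l -> is_Cseries (fun k => c * u k)%C (c * l)%C.
Proof. apply (is_series_scal (K := C_AbsRing) (V := C_NormedModule)). Qed.

Lemma is_Cseries_minus (u v : nat -> C) (l m : C) :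
  is_Cseries u l -> is_Cseries v m -> is_Cseries (fun k => u k - v k)%C (l - m)%C.
Proof. apply (is_series_minus (K := C_AbsRing) (V := C_NormedModule)). Qed.

Lemma is_Cseries_shift (u : nat -> C) (l : C) :
  is_Cseries (fun k => u (S k)) l -> is_Cseries u (u 0%nat + l)%C.
Proof.
  intros H; apply (is_series_decr_1 (K := C_AbsRing) (V := C_NormedModule)).
  eapply is_Cseries_eq; [exact H|].
  change (l = (u 0%nat + l) - u 0%nat)%C; ring.
Qed.

Lemma is_Cseries_ext (u v : nat -> C) (l : C) :
  (forall k, u k = v k) -> is_Cseries u l -> is_Cseries v l.
Proof. intros E; apply is_series_ext; exact E. Qed.

Lemma is_Cseries_norm_le (u : nat -> C) (b : nat -> R) (l : C) (S : R) :
  (forall k, Cmod (u k) <= b k) -> is_Cseries u l -> is_series b S -> Cmod l <= S.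
Proof.
  intros H Hu Hb.
  assert (Hn : filterlim (fun n => Cmod (Csum_n u n)) eventually (Rbar_locally (Cmod l))).
  { apply filterlim_comp with (2 := filterlim_norm (V := C_NormedModule) l).
    exact Hu. }
  apply (filterlim_le (F := eventually)
           (fun n => Cmod (Csum_n u n)) (fun n => sum_n b n) (Cmod l) S).
  - exists 0%nat; intros n _.
    eapply Rle_trans; [apply (norm_sum_n_m (K := C_AbsRing) (V := C_NormedModule))|].
    apply sum_n_m_le; intros k; apply H.
  - exact Hn.
  - exact Hb.
Qed.

Lemma ex_Cseries_le (u : nat -> C) (b : nat -> R) :
  (forall k, Cmod (u k) <= b k) -> ex_series b -> exists l, is_Cseries u l.
Proof.
  apply (ex_series_le (K := C_AbsRing) (V := C_CompleteNormedModule)).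
Qed.

(** Abel's criterion for a radius of convergence at least [rho]; as a bound on the
    coefficients it is visibly stable under multiplication by factors [O(k)]. *)
Definition radius_ge (rho : R) (a : nat -> C) : Prop :=
  forall r, 0 < r < rho -> exists M, forall k, Cmod (a k) * r ^ k <= M.

(** The terms are differences of partial sums, which are bounded. *)
Lemma radius_ge_of_conv (rho : R) (a : nat -> C) :
  (forall z, Cmod z < rho -> exists l, is_Cpseries a z l) -> radius_ge rho a.
Proof.
  intros H r Hr.
  destruct (H (RtoC r)) as [l Hl]; [rewrite Cmod_R, Rabs_pos_eq; lra|].
  apply is_Cpseries_series in Hl.
  destruct (filterlim_bounded (K := C_AbsRing) (V := C_NormedModule) _
              (ex_intro _ l Hl)) as [M HM].
  assert (HM0 : 0 <= M) by (eapply Rle_trans; [apply Cmod_ge_0|apply (HM 0%nat)]).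
  exists (2 * M); intros k.
  replace (Cmod (a k) * r ^ k) with (Cmod (RtoC r ^ k * a k)%C).
  2:{ rewrite Cmod_mult, Cmod_pow, Cmod_R, (Rabs_pos_eq r) by lra; ring. }
  destruct k as [|k].
  - specialize (HM 0%nat); rewrite sum_O in HM.
    change (Cmod (RtoC r ^ 0 * a 0%nat)%C <= M) in HM; lra.
  - assert (A := HM k); assert (B := HM (S k)); rewrite sum_Sn in B.
    set (s := Csum_n (fun k => RtoC r ^ k * a k)%C k) in *.
    change (Cmod s <= M) in A.
    change (Cmod (s + RtoC r ^ S k * a (S k))%C <= M) in B.
    replace (RtoC r ^ S k * a (S k))%C with ((s + RtoC r ^ S k * a (S k)) - s)%C by ring.
    eapply Rle_trans; [apply Cmod_triangle|]; rewrite Cmod_opp; lra.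
Qed.

Lemma ratio_to_midpoint (r rho : R) :
  0 <= r < rho -> exists q, 0 <= q < 1 /\ r = (r + rho) / 2 * q.
Proof.
  intros Hr; exists (r / ((r + rho) / 2)); split; [|field; lra].
  split.
  - apply Rmult_le_pos; [lra|left; apply Rinv_0_lt_compat; lra].
  - apply Rmult_lt_reg_r with ((r + rho) / 2); [lra|].
    replace (r / ((r + rho) / 2) * ((r + rho) / 2)) with r by (field; lra); lra.
Qed.

Lemma radius_ge_abs (rho : R) (a : nat -> C) (r : R) :
  radius_ge rho a -> 0 <= r < rho -> ex_series (fun k => Cmod (a k) * r ^ k).
Proof.
  intros H Hr.
  destruct (H ((r + rho) / 2)) as [M HM]; [lra|].
  destruct (ratio_to_midpoint r rho) as [q [Hq Er]]; [lra|].
  apply (ex_series_le (K := R_AbsRing) (V := R_CompleteNormedModule)) with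
    (fun k => M * q ^ k).
  - intros k; change (Rabs (Cmod (a k) * r ^ k) <= M * q ^ k).
    rewrite Rabs_pos_eq.
    2:{ apply Rmult_le_pos; [apply Cmod_ge_0|apply pow_le; lra]. }
    replace (r ^ k) with (((r + rho) / 2) ^ k * q ^ k).
    2:{ now rewrite <- Rpow_mult_distr, <- Er. }
    rewrite <- Rmult_assoc; apply Rmult_le_compat_r; [apply pow_le; lra|apply HM].
  - apply (ex_series_scal (K := R_AbsRing) (V := R_NormedModule) M).
    apply ex_series_geom; rewrite Rabs_pos_eq; lra.
Qed.

Lemma radius_ge_ex (rho : R) (a : nat -> C) (z : C) :
  radius_ge rho a -> Cmod z < rho -> exists l, is_Cpseries a z l.
Proof.
  intros H Hz.
  destruct (ex_Cseries_le (fun k => z ^ k * a k)%C (fun k => Cmod (a k) * Cmod z ^ k))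
    as [l Hl].
  - intros k; rewrite Cmod_mult, Cmod_pow; right; ring.
  - apply radius_ge_abs with rho; [exact H|]; pose proof (Cmod_ge_0 z); lra.
  - exists l; now apply is_Cpseries_series.
Qed.

(** The sum as a total function, with an arbitrary value where the series diverges. *)
Definition CPSeries (a : nat -> C) (z : C) : C :=
  iota (T := C_CompleteNormedModule)
    (fun l => is_Cseries (fun k => z ^ k * a k)%C l).

Lemma CPSeries_unique (a : nat -> C) (z l : C) : is_Cpseries a z l -> CPSeries a z = l.
Proof.
  rewrite is_Cpseries_series; intros H.
  apply (iota_filterlim_locally (K := C_AbsRing) (V := C_CompleteNormedModule) _ l H).
Qed.

Lemma CPSeries_correct (rho : R) (a : nat -> C) (z : C) :
  radius_ge rho a -> Cmod z < rho ->
  is_Cseries (fun k => z ^ k * a k)%C (CPSeries a z).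
Proof.
  intros H Hz; destruct (radius_ge_ex rho a z H Hz) as [l Hl].
  rewrite (CPSeries_unique _ _ _ Hl); now apply is_Cpseries_series.
Qed.

Lemma CPSeries_0 (a : nat -> C) : CPSeries a (RtoC 0) = a 0%nat.
Proof.
  apply CPSeries_unique.
  apply (is_pseries_0 (K := C_AbsRing) (V := C_NormedModule)).
Qed.

Lemma CPSeries_ext (rho : R) (a b : nat -> C) (z : C) :
  radius_ge rho a -> Cmod z < rho -> (forall k, b k = a k) ->
  CPSeries b z = CPSeries a z.
Proof.
  intros H Hz E; apply CPSeries_unique, is_Cpseries_series.
  eapply is_Cseries_ext; [|apply (CPSeries_correct rho a z H Hz)].
  intros k; cbv beta; now rewrite E.
Qed.

Lemma CPSeries_scal (rho : R) (c : C) (a : nat -> C) (z : C) :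
  radius_ge rho a -> Cmod z < rho ->
  CPSeries (fun k => c * a k)%C z = (c * CPSeries a z)%C.
Proof.
  intros H Hz; apply CPSeries_unique, is_Cpseries_series.
  eapply is_Cseries_ext; [|apply (is_Cseries_scal c), (CPSeries_correct rho _ _ H Hz)].
  intros k; cbv beta; ring.
Qed.

(** Each of the [k + 1] terms [q^j], [j <= k], of the geometric series is at least
    [q^k]. *)
Lemma linear_times_geometric (q : R) (k : nat) :
  0 <= q < 1 -> INR (S k) * q ^ k <= / (1 - q).
Proof.
  intros Hq.
  assert (H : INR (S k) * q ^ k * (1 - q) <= 1 - q ^ S k).
  { induction k as [|k IH]; [simpl; lra|].
    rewrite S_INR.
    assert (P : 0 <= q ^ S k) by (apply pow_le; lra).
    assert (P' : q ^ S k = q * q ^ k) by reflexivity.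
    assert (P2 : q ^ S (S k) = q * q ^ S k) by reflexivity.
    assert (Q : INR (S k) * q ^ S k * (1 - q) <= q * (1 - q ^ S k)).
    { rewrite P' at 1.
      replace (INR (S k) * (q * q ^ k) * (1 - q)) with (q * (INR (S k) * q ^ k * (1 - q)))
        by ring.
      apply Rmult_le_compat_l; lra. }
    assert (P1 : q ^ S k <= 1) by (rewrite <- (pow1 (S k)); apply pow_incr; lra).
    rewrite P2; set (A := q ^ S k) in *; nra. }
  assert (P : 0 <= q ^ S k) by (apply pow_le; lra).
  apply Rmult_le_reg_r with (1 - q); [lra|]; rewrite Rinv_l by lra; lra.
Qed.

Lemma radius_ge_linear (rho K : R) (a b : nat -> C) :
  0 <= K -> (forall k, Cmod (b k) <= K * INR (S k) * Cmod (a k)) ->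
  radius_ge rho a -> radius_ge rho b.
Proof.
  intros HK Hb H r Hr.
  destruct (H ((r + rho) / 2)) as [M HM]; [lra|].
  destruct (ratio_to_midpoint r rho) as [q [Hq Er]]; [lra|].
  exists (K * (/ (1 - q) * M)); intros k.
  assert (Pq : 0 <= q ^ k) by (apply pow_le; lra).
  assert (Pr : 0 <= r ^ k) by (apply pow_le; lra).
  assert (Ps : 0 <= ((r + rho) / 2) ^ k) by (apply pow_le; lra).
  pose proof (pos_INR (S k)) as Pk; pose proof (Cmod_ge_0 (a k)) as Pa.
  apply Rle_trans with (K * INR (S k) * Cmod (a k) * r ^ k).
  { apply Rmult_le_compat_r; [exact Pr|apply Hb]. }
  replace (r ^ k) with (((r + rho) / 2) ^ k * q ^ k).
  2:{ now rewrite <- Rpow_mult_distr, <- Er. }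
  replace (K * INR (S k) * Cmod (a k) * (((r + rho) / 2) ^ k * q ^ k))
    with (K * ((INR (S k) * q ^ k) * (Cmod (a k) * ((r + rho) / 2) ^ k))) by ring.
  apply Rmult_le_compat_l; [exact HK|].
  apply Rmult_le_compat; [nra|nra|now apply linear_times_geometric|apply HM].
Qed.

Lemma radius_ge_le (rho : R) (K : R) (a b : nat -> C) :
  0 <= K -> (forall k, Cmod (b k) <= K * Cmod (a k)) ->
  radius_ge rho a -> radius_ge rho b.
Proof.
  intros HK Hb; apply radius_ge_linear with (K := K); [exact HK|].
  intros k; eapply Rle_trans; [apply Hb|].
  pose proof (Cmod_ge_0 (a k)); rewrite S_INR; pose proof (pos_INR k).
  assert (0 <= K * Cmod (a k)) by nra; nra.
Qed.

Definition PSshift (a : nat -> C) (k : nat) : C := a (S k).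

Lemma radius_ge_shift (rho : R) (a : nat -> C) :
  radius_ge rho a -> radius_ge rho (PSshift a).
Proof.
  intros H r Hr; destruct (H r Hr) as [M HM]; exists (M / r); intros k.
  specialize (HM (S k)); simpl in HM; unfold PSshift.
  apply Rmult_le_reg_r with r; [lra|].
  replace (M / r * r) with M by (field; lra); nra.
Qed.

Definition PSderive (a : nat -> C) (k : nat) : C := (RtoC (INR (S k)) * a (S k))%C.

Lemma radius_ge_derive (rho : R) (a : nat -> C) :
  radius_ge rho a -> radius_ge rho (PSderive a).
Proof.
  intros H; apply radius_ge_linear with (K := 1) (a := PSshift a); [lra| |].
  - intros k; unfold PSderive, PSshift; rewrite Cmod_mult, Cmod_R.
    rewrite Rabs_pos_eq by apply pos_INR; lra.
  - now apply radius_ge_shift.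
Qed.

Lemma CPSeries_shift (rho : R) (a : nat -> C) (z : C) :
  radius_ge rho a -> Cmod z < rho ->
  CPSeries a z = (a 0%nat + z * CPSeries (PSshift a) z)%C.
Proof.
  intros H Hz; apply CPSeries_unique, is_Cpseries_series.
  eapply is_Cseries_eq.
  - apply (is_Cseries_shift (fun k => z ^ k * a k)%C).
    eapply is_Cseries_ext; [|apply (is_Cseries_scal z);
      apply (CPSeries_correct rho (PSshift a) z (radius_ge_shift _ _ H) Hz)].
    intros k; unfold PSshift; simpl; ring.
  - simpl; ring.
Qed.

(** The operator [z d/dz] multiplies the [k]-th coefficient by [k]. *)
Lemma CPSeries_euler_terms (rho : R) (a : nat -> C) (z : C) :
  radius_ge rho a -> Cmod z < rho ->
  is_Cseries (fun k => z ^ k * (RtoC (INR k) * a k))%C (z * CPSeries (PSderive a) z)%C.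
Proof.
  intros H Hz.
  eapply is_Cseries_eq.
  - apply (is_Cseries_shift (fun k => z ^ k * (RtoC (INR k) * a k))%C).
    eapply is_Cseries_ext; [|apply (is_Cseries_scal z);
      apply (CPSeries_correct rho (PSderive a) z (radius_ge_derive _ _ H) Hz)].
    intros k; unfold PSderive; cbn [Complex.Cpow]; ring.
  - simpl; ring.
Qed.

(** Taylor's formula of order two for [k]-th powers, with a remainder that is summable
    against the coefficients of a power series. *)
Lemma Cpow_taylor (z y : C) (r : R) (k : nat) :
  0 < r -> Cmod z <= r -> Cmod y <= r ->
  Cmod (y ^ k - z ^ k - (y - z) * (RtoC (INR k) * z ^ (pred k)))%C
    <= INR k * INR k * r ^ k * / (r * r) * (Cmod (y - z)%C * Cmod (y - z)%C).
Proof.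
  intros Hr Hz Hy.
  assert (Hi : 0 < / (r * r)) by (apply Rinv_0_lt_compat; nra).
  pose proof (Cmod_ge_0 (y - z)%C) as P.
  induction k as [|k IH].
  { simpl.
    replace (1 - 1 - (y - z) * (RtoC 0 * 1))%C with (RtoC 0) by ring.
    rewrite Cmod_0; lra. }
  set (E := (y ^ k - z ^ k - (y - z) * (RtoC (INR k) * z ^ (pred k)))%C) in *.
  replace (y ^ S k - z ^ S k - (y - z) * (RtoC (INR (S k)) * z ^ (pred (S k))))%C
    with (y * E + RtoC (INR k) * z ^ (pred k) * ((y - z) * (y - z)))%C.
  2:{ unfold E; rewrite S_INR, RtoC_plus; destruct k as [|k];
      cbn [pred Complex.Cpow INR]; ring. }
  eapply Rle_trans; [apply Cmod_triangle|].
  rewrite !Cmod_mult, Cmod_R, Cmod_pow.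
  rewrite (Rabs_pos_eq (INR k)) by apply pos_INR.
  set (D := Cmod (y - z)%C * Cmod (y - z)%C) in *.
  assert (HD : 0 <= D) by (unfold D; nra).
  assert (A : Cmod y * Cmod E <= r * (INR k * INR k * r ^ k * / (r * r) * D)).
  { apply Rmult_le_compat; try apply Cmod_ge_0; assumption. }
  assert (B : INR k * Cmod z ^ pred k * D <= INR k * (r ^ S k * / (r * r)) * D).
  { apply Rmult_le_compat_r; [exact HD|].
    destruct k as [|k]; [simpl; lra|].
    apply Rmult_le_compat_l; [apply pos_INR|].
    replace (r ^ S (S k) * / (r * r)) with (r ^ k) by (simpl; field; lra).
    simpl pred; apply pow_incr; split; [apply Cmod_ge_0|exact Hz]. }
  rewrite S_INR.
  replace (r * (INR k * INR k * r ^ k * / (r * r) * D))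
    with (INR k * INR k * (r ^ S k * / (r * r)) * D) in A by (simpl; ring).
  assert (Hw : 0 <= r ^ S k * / (r * r) * D).
  { apply Rmult_le_pos; [|exact HD]. apply Rmult_le_pos; [apply pow_le; lra|lra]. }
  pose proof (pos_INR k) as Pk.
  set (W := r ^ S k * / (r * r) * D) in *.
  replace ((INR k + 1) * (INR k + 1) * r ^ S k * / (r * r) * D)
    with ((INR k + 1) * (INR k + 1) * W) by (unfold W; ring).
  replace (INR k * INR k * (r ^ S k * / (r * r)) * D)
    with (INR k * INR k * W) in A by (unfold W; ring).
  replace (INR k * (r ^ S k * / (r * r)) * D)
    with (INR k * W) in B by (unfold W; ring).
  nra.
Qed.

(** Summing [Cpow_taylor] over the terms bounds the remainder by a multiple of
    [|y - z|^2]. *)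
Lemma Cderive_CPSeries (rho : R) (a : nat -> C) (z : C) :
  radius_ge rho a -> Cmod z < rho ->
  is_Cderive (CPSeries a) z (CPSeries (PSderive a) z).
Proof.
  intros H Hz; pose proof (Cmod_ge_0 z) as Pz.
  set (r := (Cmod z + rho) / 2).
  assert (Hr : 0 < r < rho) by (unfold r; lra).
  set (b := fun k => (RtoC (INR k * INR k) * a k)%C).
  assert (Hb : radius_ge rho b).
  { apply radius_ge_linear with (K := 1) (a := fun k => (RtoC (INR k) * a k)%C);
      [lra| |].
    - intros k; unfold b.
      rewrite RtoC_mult, !Cmod_mult, !Cmod_R, Rabs_pos_eq by apply pos_INR.
      rewrite S_INR; pose proof (pos_INR k); pose proof (Cmod_ge_0 (a k)).
      assert (0 <= INR k * Cmod (a k)) by nra; nra.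
    - apply radius_ge_linear with (K := 1) (a := a); [lra| |exact H].
      intros k; rewrite Cmod_mult, Cmod_R, Rabs_pos_eq by apply pos_INR.
      rewrite S_INR; pose proof (pos_INR k); pose proof (Cmod_ge_0 (a k)); nra. }
  destruct (radius_ge_abs rho b r Hb ltac:(lra)) as [T HT].
  set (Q := / (r * r) * Rabs T).
  assert (Hi : 0 < / (r * r)) by (apply Rinv_0_lt_compat; nra).
  assert (HQ : 0 <= Q) by (apply Rmult_le_pos; [lra|apply Rabs_pos]).
  apply is_Cderive_eps; intros eps Heps.
  exists (Rmin (r - Cmod z) (eps / (Q + 1))); split.
  { apply Rmin_pos; [unfold r; lra|apply Rdiv_lt_0_compat; lra]. }
  intros y Hy.
  assert (Hy1 := Rlt_le_trans _ _ _ Hy (Rmin_l _ _)).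
  assert (Hy2 := Rlt_le_trans _ _ _ Hy (Rmin_r _ _)).
  assert (Hyr : Cmod y <= r) by (pose proof (Cmod_triangle_inv y z); lra).
  assert (Hzr : Cmod z <= r) by (unfold r; lra).
  assert (Main : Cmod (CPSeries a y - CPSeries a z - (y - z) * CPSeries (PSderive a) z)%C
                 <= / (r * r) * (Cmod (y - z)%C * Cmod (y - z)%C) * T).
  { apply (is_Cseries_norm_le
      (fun k => a k * (y ^ k - z ^ k - (y - z) * (RtoC (INR k) * z ^ (pred k))))%C
      (fun k => / (r * r) * (Cmod (y - z)%C * Cmod (y - z)%C) * (Cmod (b k) * r ^ k))).
    - intros k; rewrite Cmod_mult.
      eapply Rle_trans.
      { apply Rmult_le_compat_l; [apply Cmod_ge_0|].
        apply Cpow_taylor with (r := r); [lra|exact Hzr|exact Hyr]. }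
      unfold b; rewrite Cmod_mult, Cmod_R, Rabs_pos_eq
        by (apply Rmult_le_pos; apply pos_INR).
      right; ring.
    - eapply is_Cseries_ext; [|apply is_Cseries_minus; [apply is_Cseries_minus|]].
      2:{ apply (CPSeries_correct rho a y H); lra. }
      2:{ apply (CPSeries_correct rho a z H); lra. }
      2:{ apply (is_Cseries_scal (y - z)%C).
          instantiate (1 := fun k => (RtoC (INR k) * z ^ (pred k) * a k)%C).
          eapply is_Cseries_eq.
          - apply (is_Cseries_shift (fun k => (RtoC (INR k) * z ^ (pred k) * a k)%C)).
            eapply is_Cseries_ext;
              [|apply (CPSeries_correct rho (PSderive a) z (radius_ge_derive _ _ H) Hz)].
            intros k; unfold PSderive; simpl pred; ring.
          - simpl; ring. }
      intros k; cbv beta; ring.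
    - apply (is_series_scal (K := R_AbsRing) (V := R_NormedModule)
               (/ (r * r) * (Cmod (y - z)%C * Cmod (y - z)%C)) _ T HT). }
  pose proof (Cmod_ge_0 (y - z)%C) as P.
  eapply Rle_trans; [exact Main|].
  eapply Rle_trans; [apply Rmult_le_compat_l; [nra|apply (Rle_abs T)]|].
  replace (/ (r * r) * (Cmod (y - z)%C * Cmod (y - z)%C) * Rabs T)
    with (Cmod (y - z)%C * Q * Cmod (y - z)%C) by (unfold Q; ring).
  apply Rmult_le_compat_r; [exact P|].
  apply Rle_trans with (eps / (Q + 1) * Q).
  - apply Rmult_le_compat_r; lra.
  - apply Rmult_le_reg_r with (Q + 1); [lra|].
    replace (eps / (Q + 1) * Q * (Q + 1)) with (eps * Q) by (field; lra); nra.
Qed.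

(** Peeling off the constant term of both series and cancelling [z], continuity at [0]
    identifies the coefficients one after the other. *)
Lemma CPSeries_coeff_unique (rho : R) (a b : nat -> C) :
  0 < rho -> radius_ge rho a -> radius_ge rho b ->
  (forall z, Cmod z < rho -> CPSeries a z = CPSeries b z) ->
  forall k, a k = b k.
Proof.
  intros Hrho Ha Hb E k; revert a b Ha Hb E.
  assert (Z0 : Cmod (RtoC 0) < rho) by now rewrite Cmod_0.
  induction k as [|k IH]; intros a b Ha Hb E.
  { rewrite <- (CPSeries_0 a), <- (CPSeries_0 b); now apply E. }
  assert (E0 : a 0%nat = b 0%nat).
  { rewrite <- (CPSeries_0 a), <- (CPSeries_0 b); now apply E. }
  apply (IH (PSshift a) (PSshift b)); try now apply radius_ge_shift.
  assert (E1 : forall z, z <> RtoC 0 -> Cmod z < rho ->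
            CPSeries (PSshift a) z = CPSeries (PSshift b) z).
  { intros z Hz0 Hz; specialize (E z Hz).
    rewrite (CPSeries_shift rho a), (CPSeries_shift rho b), E0 in E by assumption.
    assert (E' : (z * CPSeries (PSshift a) z = z * CPSeries (PSshift b) z)%C).
    { replace (z * CPSeries (PSshift a) z)%C
        with (b 0%nat + z * CPSeries (PSshift a) z - b 0%nat)%C by ring.
      rewrite E; ring. }
    replace (CPSeries (PSshift a) z) with (/ z * (z * CPSeries (PSshift a) z))%C
      by (field; exact Hz0).
    rewrite E'; field; exact Hz0. }
  set (u := CPSeries (PSshift a)) in *; set (v := CPSeries (PSshift b)) in *.
  assert (Cu : CCcontinuous u (RtoC 0)).
  { eapply Cderive_continuous, (Cderive_CPSeries rho); [now apply radius_ge_shift|exact Z0]. }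
  assert (Cv : CCcontinuous v (RtoC 0)).
  { eapply Cderive_continuous, (Cderive_CPSeries rho); [now apply radius_ge_shift|exact Z0]. }
  now apply (Ccontinuous_eq_punctured rho).
Qed.

(** * Holomorphic functions on the disk are sums of power series *)

Notation is_CRInt := (is_RInt (V := C_R_NormedModule)).

Lemma is_CRInt_pair (g : R -> C) (a b : R) (l : C) :
  is_RInt (fun t => fst (g t)) a b (fst l) ->
  is_RInt (fun t => snd (g t)) a b (snd l) -> is_CRInt g a b l.
Proof.
  intros H1 H2; destruct l as [l1 l2].
  exact (is_RInt_fct_extend_pair (U := R_NormedModule) (V := R_NormedModule) g a b l1 l2 H1 H2).
Qed.

Lemma is_CRInt_fst (g : R -> C) (a b : R) (l : C) :
  is_CRInt g a b l -> is_RInt (fun t => fst (g t)) a b (fst l).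
Proof. apply (is_RInt_fct_extend_fst (U := R_NormedModule) (V := R_NormedModule)). Qed.

Lemma is_CRInt_snd (g : R -> C) (a b : R) (l : C) :
  is_CRInt g a b l -> is_RInt (fun t => snd (g t)) a b (snd l).
Proof. apply (is_RInt_fct_extend_snd (U := R_NormedModule) (V := R_NormedModule)). Qed.

Lemma is_CRInt_scal (c : C) (g : R -> C) (a b : R) (l : C) :
  is_CRInt g a b l -> is_CRInt (fun t => c * g t)%C a b (c * l)%C.
Proof.
  intros H; pose proof (is_CRInt_fst _ _ _ _ H) as H1.
  pose proof (is_CRInt_snd _ _ _ _ H) as H2.
  apply is_CRInt_pair; simpl.
  - apply (is_RInt_minus (V := R_NormedModule) (fun t => fst c * fst (g t))
             (fun t => snd c * snd (g t)));
      now apply (is_RInt_scal (V := R_NormedModule)).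
  - apply (is_RInt_plus (V := R_NormedModule) (fun t => fst c * snd (g t))
             (fun t => snd c * fst (g t)));
      now apply (is_RInt_scal (V := R_NormedModule)).
Qed.

Lemma ex_CRInt_continuous (g : R -> C) (a b : R) :
  (forall t, Ccontinuous g t) -> exists l, is_CRInt g a b l.
Proof.
  intros H; apply (ex_RInt_continuous (V := C_R_CompleteNormedModule) g a b).
  intros t _; apply H.
Qed.

Definition circle (r th : R) : C := (RtoC r * Cexp (Ci * RtoC th))%C.

Lemma Cmod_circle (r th : R) : 0 <= r -> Cmod (circle r th) = r.
Proof.
  intros Hr; unfold circle; rewrite Cmod_mult, Cmod_R, Cmod_Cexp, Rabs_pos_eq by exact Hr.
  replace (fst (Ci * RtoC th)%C) with 0 by (simpl; ring); rewrite exp_0; ring.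
Qed.

Lemma Rderive_affine (a b : C) (t : R) : is_Rderive (fun t => a + b * RtoC t)%C t b.
Proof.
  apply is_Rderive_eps; intros eps Heps; exists 1; split; [lra|].
  intros y _; rewrite RtoC_minus.
  replace (a + b * RtoC y - (a + b * RtoC t) - (RtoC y - RtoC t) * b)%C with (RtoC 0) by ring.
  rewrite Cmod_0; apply Rmult_le_pos; [lra|apply Rabs_pos].
Qed.

Lemma Rderive_eq (f : R -> C) (t : R) (l l' : C) :
  is_Rderive f t l -> l = l' -> is_Rderive f t l'.
Proof. now intros H <-. Qed.

Lemma Rderive_ext (f g : R -> C) (t : R) (l : C) :
  (forall s, f s = g s) -> is_Rderive f t l -> is_Rderive g t l.
Proof. intros E; apply is_derive_ext; exact E. Qed.

Lemma Rderive_scal (c : C) (f : R -> C) (t : R) (l : C) :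
  is_Rderive f t l -> is_Rderive (fun s => c * f s)%C t (c * l)%C.
Proof.
  intros H; eapply Rderive_eq.
  - apply (Rderive_comp (fun w => c * w)%C f t (c * RtoC 1)%C l); [|exact H].
    apply Cderive_scal, Cderive_id.
  - ring.
Qed.

Lemma Rderive_Cexp_linear (c : C) (t : R) :
  is_Rderive (fun s => Cexp (c * RtoC s))%C t (c * Cexp (c * RtoC t))%C.
Proof.
  apply (Rderive_comp Cexp (fun s => c * RtoC s)%C); [apply Cderive_Cexp|].
  eapply Rderive_ext; [|apply (Rderive_affine (RtoC 0) c)]; intros s; cbv beta; ring.
Qed.

Lemma Rderive_circle (r th : R) : is_Rderive (circle r) th (Ci * circle r th)%C.
Proof.
  eapply Rderive_eq; [apply Rderive_scal, Rderive_Cexp_linear|].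
  unfold circle; ring.
Qed.

Lemma Rderive_Ccontinuous (f : R -> C) (t : R) (l : C) :
  is_Rderive f t l -> Ccontinuous f t.
Proof.
  intros H; apply (ex_derive_continuous (K := R_AbsRing) (V := C_R_NormedModule)).
  now exists l.
Qed.

Lemma circle_continuous (r th : R) : Ccontinuous (circle r) th.
Proof. eapply Rderive_Ccontinuous, Rderive_circle. Qed.

Lemma circle_period (r : R) : circle r (2 * PI) = circle r 0.
Proof.
  unfold circle; f_equal.
  assert (E : forall t, Cexp (Ci * RtoC t)%C = (cos t, sin t)).
  { intros t; apply C_eq; simpl;
    replace (0 * t - 1 * 0) with 0 by ring; replace (0 * 0 + 1 * t) with t by ring;
    rewrite exp_0; ring. }
  rewrite !E, cos_2PI, sin_2PI, cos_0, sin_0; reflexivity.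
Qed.

Lemma Cinv_continuous (z : C) :
  z <> RtoC 0 -> CCcontinuous Cinv z.
Proof.
  intros Hz.
  assert (P : fst z ^ 2 + snd z ^ 2 <> 0).
  { intros E; apply Hz, C_eq; simpl; nra. }
  assert (cn : continuous (T := C_UniformSpace) (U := R_UniformSpace)
                 (fun w : C => / (fst w ^ 2 + snd w ^ 2)) z).
  { apply (continuous_comp (U := C_UniformSpace)
             (fun w : C => fst w ^ 2 + snd w ^ 2) Rinv).
    - apply sum_squares_continuous.
    - now apply continuous_Rinv. }
  apply Ccontinuous_pair; split.
  - apply (continuous_mult (U := C_UniformSpace) (K := R_AbsRing)
             (fun w : C => fst w) (fun w : C => / (fst w ^ 2 + snd w ^ 2))); [apply fst_continuous|exact cn].
  - apply (continuous_mult (U := C_UniformSpace) (K := R_AbsRing)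
             (fun w : C => - snd w) (fun w : C => / (fst w ^ 2 + snd w ^ 2)));
      [|exact cn].
    apply (continuous_opp (U := C_UniformSpace) (V := R_NormedModule)), snd_continuous.
Qed.

Lemma circle_minus_neq_0 (z : C) (r th : R) : Cmod z < r -> (circle r th - z)%C <> RtoC 0.
Proof.
  intros Hz E; apply Ceq_minus in E; rewrite <- E, Cmod_circle in Hz; [lra|].
  pose proof (Cmod_ge_0 z); pose proof (Cmod_ge_0 (circle r th)); rewrite E in *; lra.
Qed.

Lemma kernel_continuous (z : C) (r th : R) :
  Cmod z < r -> Ccontinuous (fun th => circle r th / (circle r th - z))%C th.
Proof.
  intros Hz; unfold Cdiv; apply Ccontinuous_mult; [apply circle_continuous|].
  apply (Ccontinuous_comp (fun th => circle r th - z)%C Cinv).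
  - apply Ccontinuous_plus; [apply circle_continuous|apply continuous_const].
  - now apply Cinv_continuous, circle_minus_neq_0.
Qed.

Lemma zero_derive_const (u : R -> R) :
  (forall t, 0 < t < 1 -> is_derive u t 0) -> (forall t, 0 <= t <= 1 -> ex_derive u t) ->
  u 1 = u 0.
Proof.
  intros Hd Hc; destruct (MVT_gen u 0 1 (fun _ => 0)) as [c [_ E]]; [| |lra];
    rewrite Rmin_left, Rmax_right by lra; intros t Ht; [now apply Hd|].
  now apply continuity_pt_filterlim, ex_derive_Rcontinuous, Hc.
Qed.

(** Cauchy's formula by deformation: the mean over the circle of
    [h (z + t (zeta - z)) * zeta / (zeta - z)] does not depend on [t], and the values at
    [t = 1] and [t = 0] are its two sides.  Only real parts are treated, because
    multiplying [h] by a constant recovers the imaginary parts. *)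
Section Cauchy.

Variables h h' : C -> C.
Hypothesis h_derive : forall z, Cmod z < 1 -> is_Cderive h z (h' z).
Hypothesis h'_cont : forall z, Cmod z < 1 ->
  CCcontinuous h' z.

Variables (z : C) (r : R).
Hypothesis z_lt_r : Cmod z < r.
Hypothesis r_lt_1 : r < 1.

Let zeta := circle r.
Let kernel th := (zeta th / (zeta th - z))%C.
Let path t th := (z + (zeta th - z) * RtoC t)%C.

Lemma r_pos : 0 < r.
Proof. pose proof (Cmod_ge_0 z); lra. Qed.

(** The segments from [z] to the circle stay in the disk a little beyond both ends, so
    that the averages below are differentiable up to the ends of the segments. *)
Lemma path_in_disk (t th : R) :
  - ((1 - r) / 2) < t < 1 + (1 - r) / 2 -> Cmod (path t th) < 1.
Proof.
  intros Ht; pose proof r_pos as Hr.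
  replace (path t th) with (RtoC (1 - t) * z + RtoC t * zeta th)%C
    by (unfold path; rewrite RtoC_minus; ring).
  eapply Rle_lt_trans; [apply Cmod_triangle|].
  rewrite !Cmod_mult, !Cmod_R; unfold zeta; rewrite Cmod_circle by lra.
  pose proof (Cmod_ge_0 z); pose proof (Rabs_pos (1 - t)).
  apply Rle_lt_trans with ((Rabs (1 - t) + Rabs t) * r); [nra|].
  unfold Rabs; destruct (Rcase_abs (1 - t)), (Rcase_abs t); nra.
Qed.

Let mean t := RInt (fun th => fst (h (path t th) * kernel th)%C) 0 (2 * PI).
Let dmean t := RInt (fun th => fst (zeta th * h' (path t th))%C) 0 (2 * PI).

Lemma path_derive_t (t th : R) : is_Rderive (fun t => path t th) t (zeta th - z)%C.
Proof. apply Rderive_affine. Qed.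

Lemma path_derive_th (t th : R) :
  is_Rderive (path t) th (RtoC t * (Ci * zeta th))%C.
Proof.
  eapply Rderive_eq.
  - apply (Rderive_comp (fun w => z + (w - z) * RtoC t)%C zeta th (RtoC t)).
    + eapply Cderive_eq.
      * apply Cderive_plus; [apply Cderive_const|apply Cderive_mult; [|apply Cderive_const]].
        apply Cderive_plus; [apply Cderive_id|apply Cderive_const].
      * cbv beta; ring.
    + apply Rderive_circle.
  - fold (zeta th); ring.
Qed.

Lemma integrand_derive (t th : R) :
  - ((1 - r) / 2) < t < 1 + (1 - r) / 2 ->
  is_derive (fun t => fst (h (path t th) * kernel th)%C) t
    (fst (zeta th * h' (path t th))%C).
Proof.
  intros Ht.
  apply (Rderive_fst (fun t => h (path t th) * kernel th)%C).
  eapply Rderive_eq.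
  - apply (Rderive_comp (fun w => h w * kernel th)%C (fun t => path t th)).
    + apply Cderive_mult; [apply h_derive, path_in_disk, Ht|apply Cderive_const].
    + apply path_derive_t.
  - unfold kernel; field; now apply circle_minus_neq_0.
Qed.

Lemma integrand_continuous (t : R) :
  - ((1 - r) / 2) < t < 1 + (1 - r) / 2 ->
  forall th, Ccontinuous (fun th => h (path t th) * kernel th)%C th.
Proof.
  intros Ht th; apply Ccontinuous_mult; [|now apply kernel_continuous].
  apply Ccontinuous_comp.
  - eapply Rderive_Ccontinuous, path_derive_th.
  - eapply Cderive_continuous, h_derive, path_in_disk, Ht.
Qed.

Lemma mean_derive (t : R) :
  - ((1 - r) / 2) < t < 1 + (1 - r) / 2 -> is_derive mean t (dmean t).
Proof.
  intros Ht.
  assert (Hloc : locally t (fun t => - ((1 - r) / 2) < t < 1 + (1 - r) / 2)).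
  { apply (open_and (T := R_UniformSpace) (fun t => - ((1 - r) / 2) < t)
             (fun t => t < 1 + (1 - r) / 2)); [apply open_gt|apply open_lt|exact Ht]. }
  replace (dmean t) with
    (RInt (fun th => Derive (fun t => fst (h (path t th) * kernel th)%C) t) 0 (2 * PI)).
  2:{ apply RInt_ext; intros th _; now apply is_derive_unique, integrand_derive. }
  apply (is_derive_RInt_param (fun t th => fst (h (path t th) * kernel th)%C)).
  - revert Hloc; apply filter_imp; intros u Hu th _.
    eexists; now apply integrand_derive.
  - intros th _.
    apply continuity_2d_pt_ext_loc with
      (fun u v => fst (zeta v * h' (path u v))%C).
    + destruct Hloc as [d Hd]; exists d; intros u v Hu _.
      symmetry; apply is_derive_unique, integrand_derive, Hd; exact Hu.
    + apply continuity_2d_pt_filterlim.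
      set (U := prod_UniformSpace R_UniformSpace R_UniformSpace).
      assert (c1 : continuous (T := U) (U := R_UniformSpace) (fun p => fst p) (t, th))
        by apply (continuous_fst (U := R_UniformSpace) (V := R_UniformSpace)).
      assert (c2 : continuous (T := U) (U := R_UniformSpace) (fun p => snd p) (t, th))
        by apply (continuous_snd (U := R_UniformSpace) (V := R_UniformSpace)).
      assert (cz : Ccontinuous (fun p : U => zeta (snd p)) (t, th)).
      { apply (continuous_comp (U := U) (V := R_UniformSpace) (fun p => snd p) zeta);
          [exact c2|apply circle_continuous]. }
      assert (cp : Ccontinuous (fun p : U => path (fst p) (snd p)) (t, th)).
      { unfold path; apply Ccontinuous_plus; [apply continuous_const|].
        apply Ccontinuous_mult.
        - apply Ccontinuous_plus; [exact cz|apply continuous_const].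
        - apply Ccontinuous_pair; split; simpl; [exact c1|apply continuous_const]. }
      assert (ch : Ccontinuous (fun p : U => h' (path (fst p) (snd p))) (t, th)).
      { apply (Ccontinuous_comp (U := U) (fun p => path (fst p) (snd p)) h' (t, th) cp).
        apply h'_cont, path_in_disk, Ht. }
      exact (Ccontinuous_fst (U := U) _ _ (Ccontinuous_mult (U := U) _ _ _ cz ch)).
  - revert Hloc; apply filter_imp; intros u Hu.
    apply (ex_RInt_continuous (V := R_CompleteNormedModule)); intros th _.
    apply (Ccontinuous_fst (fun th => h (path u th) * kernel th)%C).
    now apply integrand_continuous.
Qed.

(** The derivative of the mean is, up to the factor [t], the integral over a period of
    the [th]-derivative of [snd (h (path t th))], hence it vanishes. *)
Lemma dmean_0 (t : R) : 0 < t < 1 -> dmean t = 0.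
Proof.
  intros Ht; apply is_RInt_unique.
  assert (Hd : - ((1 - r) / 2) < t < 1 + (1 - r) / 2) by lra.
  set (F := fun th => / t * snd (h (path t th))).
  replace 0 with (minus (F (2 * PI)) (F 0)) at 2.
  2:{ unfold F, path, zeta; rewrite circle_period.
      change (/ t * snd (h (z + (circle r 0 - z) * RtoC t)%C)
              - / t * snd (h (z + (circle r 0 - z) * RtoC t)%C) = 0); ring. }
  apply (is_RInt_derive (V := R_CompleteNormedModule)); intros th _.
  - assert (G : is_derive (fun th => snd (h (path t th))) th
                  (snd (RtoC t * (Ci * zeta th) * h' (path t th))%C)).
    { apply (Rderive_snd (fun th => h (path t th))).
      apply Rderive_comp; [apply h_derive, path_in_disk, Hd|apply path_derive_th]. }
    apply (is_derive_scal _ _ (/ t)) in G.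
    replace (fst (zeta th * h' (path t th))%C) with
      (/ t * snd (RtoC t * (Ci * zeta th) * h' (path t th))%C); [exact G|].
    simpl; field; lra.
  - apply (Ccontinuous_fst (fun th => zeta th * h' (path t th))%C).
    apply Ccontinuous_mult; [apply circle_continuous|].
    apply Ccontinuous_comp.
    + eapply Rderive_Ccontinuous, path_derive_th.
    + apply h'_cont, path_in_disk, Hd.
Qed.

Lemma cauchy_re :
  RInt (fun th => fst (h (zeta th) * kernel th)%C) 0 (2 * PI)
  = RInt (fun th => fst (h z * kernel th)%C) 0 (2 * PI).
Proof.
  assert (E : mean 1 = mean 0).
  { apply zero_derive_const; intros t Ht.
    - rewrite <- (dmean_0 t Ht); apply mean_derive; lra.
    - exists (dmean t); apply mean_derive; lra. }
  transitivity (mean 1).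
  - apply RInt_ext; intros th _; unfold path.
    replace (z + (zeta th - z) * RtoC 1)%C with (zeta th) by ring; reflexivity.
  - rewrite E; apply RInt_ext; intros th _; unfold path.
    replace (z + (zeta th - z) * RtoC 0)%C with z by ring; reflexivity.
Qed.

End Cauchy.

(** The real parts for [h] and for [- Ci * h] together give the complex identity. *)
Lemma cauchy_kernel (h h' : C -> C) (z : C) (r : R) (I J : C) :
  (forall z, Cmod z < 1 -> is_Cderive h z (h' z)) ->
  (forall z, Cmod z < 1 -> CCcontinuous h' z) ->
  Cmod z < r -> r < 1 ->
  is_CRInt (fun th => h (circle r th) * (circle r th / (circle r th - z)))%C 0 (2 * PI) I ->
  is_CRInt (fun th => circle r th / (circle r th - z))%C 0 (2 * PI) J ->
  I = (h z * J)%C.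
Proof.
  intros Hh Hh' Hz Hr HI HJ.
  assert (Re_part : forall c : C, fst (c * I)%C = fst (c * (h z * J))%C).
  { intros c.
    rewrite <- (is_RInt_unique _ _ _ _ (is_CRInt_fst _ _ _ _ (is_CRInt_scal c _ _ _ _ HI))).
    rewrite <- (is_RInt_unique _ _ _ _
      (is_CRInt_fst _ _ _ _ (is_CRInt_scal c _ _ _ _ (is_CRInt_scal (h z) _ _ _ _ HJ)))).
    etransitivity; [|etransitivity;
      [apply (cauchy_re (fun w => c * h w)%C (fun w => c * h' w)%C) with (z := z) (r := r)|]].
    - apply RInt_ext; intros th _; f_equal; ring.
    - intros w Hw; apply Cderive_scal, Hh, Hw.
    - intros w Hw; apply Ccontinuous_mult; [apply continuous_const|apply Hh', Hw].
    - exact Hz.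
    - exact Hr.
    - apply RInt_ext; intros th _; f_equal; ring. }
  apply C_eq.
  - specialize (Re_part (RtoC 1)); now rewrite !Cmult_1_l in Re_part.
  - specialize (Re_part (- Ci)%C); simpl in Re_part |- *; lra.
Qed.

Lemma Csum_n_S (u : nat -> C) (n : nat) : Csum_n u (S n) = (Csum_n u n + u (S n))%C.
Proof. exact (sum_Sn (G := C_NormedModule) u n). Qed.

Lemma circle_neq_0 (r th : R) : 0 < r -> circle r th <> RtoC 0.
Proof. intros Hr E; pose proof (Cmod_circle r th); rewrite E, Cmod_0 in H; lra. Qed.

Lemma is_CRInt_plus (f g : R -> C) (a b : R) (l m : C) :
  is_CRInt f a b l -> is_CRInt g a b m -> is_CRInt (fun t => f t + g t)%C a b (l + m)%C.
Proof. apply (is_RInt_plus (V := C_R_NormedModule)). Qed.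

Lemma is_CRInt_ext (f g : R -> C) (a b : R) (l : C) :
  (forall t, f t = g t) -> is_CRInt f a b l -> is_CRInt g a b l.
Proof. intros E; apply is_RInt_ext; intros t _; apply E. Qed.

Lemma is_CRInt_eq (g : R -> C) (a b : R) (l l' : C) :
  is_CRInt g a b l -> l = l' -> is_CRInt g a b l'.
Proof. now intros H <-. Qed.

Lemma is_CRInt_norm_le (g : R -> C) (a b M : R) (l : C) :
  a <= b -> (forall t, a <= t <= b -> Cmod (g t) <= M) -> is_CRInt g a b l ->
  Cmod l <= (b - a) * M.
Proof.
  intros Hab HM H; rewrite <- norm_C_R.
  apply (norm_RInt_le (V := C_R_NormedModule) g (fun _ => M) a b); auto.
  - intros t Ht; rewrite norm_C_R; now apply HM.
  - apply (is_RInt_const (V := R_NormedModule)).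
Qed.

Lemma Cpow_continuous (n : nat) (U : UniformSpace) (f : U -> C) (x : U) :
  Ccontinuous f x -> Ccontinuous (fun u => f u ^ n)%C x.
Proof.
  intros H; induction n as [|n IH]; [apply continuous_const|].
  now apply Ccontinuous_mult.
Qed.

Lemma Ccontinuous_bounded (g : R -> C) (a b : R) :
  (forall t, Ccontinuous g t) -> exists M, 0 <= M /\ forall t, a <= t <= b -> Cmod (g t) <= M.
Proof.
  intros H.
  destruct (bounded_continuity (K := R_AbsRing) (V := C_R_NormedModule) g a b) as [M HM].
  { intros t _; apply H. }
  exists (Rabs M); split; [apply Rabs_pos|]; intros t Ht; rewrite <- norm_C_R.
  specialize (HM t Ht); pose proof (Rle_abs M); lra.
Qed.

Lemma inv_circle_continuous (r th : R) :
  0 < r -> Ccontinuous (fun th => / circle r th)%C th.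
Proof.
  intros Hr; apply (Ccontinuous_comp (circle r) Cinv); [apply circle_continuous|].
  now apply Cinv_continuous, circle_neq_0.
Qed.

(** The Cauchy kernel [zeta / (zeta - z)] is the sum of the geometric series in
    [z / zeta], uniformly on the circle. *)
Lemma kernel_expansion (g : R -> C) (z : C) (r : R) (I : C) (c : nat -> C) :
  Cmod z < r -> (forall t, Ccontinuous g t) ->
  is_CRInt (fun th => g th * (circle r th / (circle r th - z)))%C 0 (2 * PI) I ->
  (forall k, is_CRInt (fun th => g th * (/ circle r th) ^ k)%C 0 (2 * PI) (c k)) ->
  is_Cpseries c z I.
Proof.
  intros Hz Hg HI Hc.
  assert (Hr : 0 < r) by (pose proof (Cmod_ge_0 z); lra).
  pose proof PI_RGT_0 as HPI.
  set (K := fun th => (circle r th / (circle r th - z))%C) in *.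
  assert (Hne : forall th, (circle r th - z)%C <> RtoC 0) by (intros th; now apply circle_minus_neq_0).
  destruct (Ccontinuous_bounded (fun th => g th * K th)%C 0 (2 * PI)) as [M [HM0 HM]].
  { intros t; apply Ccontinuous_mult; [apply Hg|now apply kernel_continuous]. }
  set (q := Cmod z / r).
  assert (Hq : 0 <= q < 1).
  { unfold q; split.
    - apply Rmult_le_pos; [apply Cmod_ge_0|left; now apply Rinv_0_lt_compat].
    - apply Rmult_lt_reg_r with r; [exact Hr|].
      replace (Cmod z / r * r) with (Cmod z) by (field; lra); lra. }
  (* the remainder after the term of index [n] *)
  assert (Rem : forall n, is_CRInt
     (fun th => z ^ S n * (g th * K th * (/ circle r th) ^ S n))%C 0 (2 * PI)
     (I - Csum_n (fun k => z ^ k * c k)%C n)%C).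
  { induction n as [|n IH].
    - rewrite sum_O; apply is_CRInt_eq with (I + RtoC (-1) * c 0%nat)%C; [|simpl; ring].
      eapply is_CRInt_ext;
        [|exact (is_CRInt_plus _ _ _ _ _ _ HI (is_CRInt_scal (RtoC (-1)) _ _ _ _ (Hc 0%nat)))].
      intros th; cbv beta; unfold K; cbn [Complex.Cpow].
      field; split; [now apply circle_neq_0|apply Hne].
    - rewrite Csum_n_S.
      apply is_CRInt_eq with
        ((I - Csum_n (fun k => z ^ k * c k)%C n) + (- z ^ S n) * c (S n))%C; [|ring].
      eapply is_CRInt_ext;
        [|exact (is_CRInt_plus _ _ _ _ _ _ IH (is_CRInt_scal (- z ^ S n)%C _ _ _ _ (Hc (S n))))].
      intros th; cbv beta; unfold K.
      set (w := ((/ circle r th) ^ n)%C); change ((/ circle r th) ^ S n)%C with (/ circle r th * w)%C.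
      change ((/ circle r th) ^ S (S n))%C with (/ circle r th * (/ circle r th * w))%C.
      cbn [Complex.Cpow]; field; split; [now apply circle_neq_0|apply Hne]. }
  apply is_Cpseries_series, is_Cseries_eps; intros eps Heps.
  assert (Hlim : exists N, forall n, (N <= n)%nat -> q ^ n < eps / (2 * PI * M + 1)).
  { destruct (pow_lt_1_zero q ltac:(rewrite Rabs_pos_eq; lra) (eps / (2 * PI * M + 1)))
      as [N HN]; [apply Rdiv_lt_0_compat; nra|].
    exists N; intros n Hn; specialize (HN n Hn).
    rewrite Rabs_pos_eq in HN; [exact HN|apply pow_le; lra]. }
  destruct Hlim as [N HN]; exists N; intros n Hn.
  rewrite Cmod_minus_sym.
  assert (B : Cmod (I - Csum_n (fun k => z ^ k * c k)%C n)%C <= (2 * PI - 0) * (M * q ^ S n)).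
  { apply (is_CRInt_norm_le _ 0 (2 * PI) _ _) with (3 := Rem n); [lra|].
    intros th Hth; rewrite Cmod_mult, (Cmod_mult (g th * K th)%C), !Cmod_pow, Cmod_inv
      by now apply circle_neq_0.
    rewrite Cmod_circle by lra.
    replace (Cmod z ^ S n * (Cmod (g th * K th)%C * (/ r) ^ S n))
      with (Cmod (g th * K th)%C * q ^ S n)
      by (unfold q, Rdiv; rewrite Rpow_mult_distr; ring).
    apply Rmult_le_compat_r; [apply pow_le; lra|apply HM, Hth]. }
  eapply Rle_lt_trans; [exact B|].
  specialize (HN (S n) ltac:(lia)).
  assert (HP : 0 <= q ^ S n) by (apply pow_le; lra).
  apply Rle_lt_trans with ((2 * PI * M + 1) * q ^ S n); [nra|].
  apply Rmult_lt_reg_l with (/ (2 * PI * M + 1)); [apply Rinv_0_lt_compat; nra|].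
  replace (/ (2 * PI * M + 1) * ((2 * PI * M + 1) * q ^ S n)) with (q ^ S n) by (field; nra).
  unfold Rdiv in HN; lra.
Qed.

(** Only the constant term of the expansion has a nonzero mean over the circle. *)
Lemma kernel_integral (z : C) (r : R) :
  Cmod z < r -> is_CRInt (fun th => circle r th / (circle r th - z))%C 0 (2 * PI)
                  (RtoC (2 * PI)).
Proof.
  intros Hz.
  assert (Hr : 0 < r) by (pose proof (Cmod_ge_0 z); lra).
  destruct (ex_CRInt_continuous (fun th => circle r th / (circle r th - z))%C 0 (2 * PI))
    as [J HJ]; [intros t; now apply kernel_continuous|].
  apply is_CRInt_eq with J; [exact HJ|].
  set (c := fun k => match k with O => RtoC (2 * PI) | S _ => RtoC 0 end).
  assert (HJc : is_Cpseries c z J).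
  { apply (kernel_expansion (fun _ => RtoC 1) z r); [exact Hz| | |].
    - intros t; apply continuous_const.
    - eapply is_CRInt_ext; [|exact HJ]; intros t; cbv beta; ring.
    - intros [|k]; simpl c.
      + apply is_CRInt_eq with (scal (V := C_R_NormedModule) (2 * PI - 0) (RtoC 1)).
        * eapply is_CRInt_ext; [|apply (is_RInt_const (V := C_R_NormedModule))].
          intros t; simpl; ring.
        * apply C_eq; simpl; unfold scal; simpl; unfold mult; simpl; ring.
      + set (m := INR (S k)).
        assert (Hm : RtoC m <> RtoC 0).
        { intros E; apply RtoC_inj in E; revert E; apply not_0_INR; discriminate. }
        assert (Hrc : RtoC r <> RtoC 0) by (apply RtoC_neq_0; lra).
        set (F := fun th => (((/ RtoC r) ^ S k * (Ci / RtoC m)) *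
                              Cexp (- (Ci * RtoC m) * RtoC th))%C).
        assert (Hpow : forall th, ((/ circle r th) ^ S k)%C =
                  ((/ RtoC r) ^ S k * Cexp (- (Ci * RtoC m) * RtoC th))%C).
        { intros th.
          assert (Einv : (/ circle r th)%C = (/ RtoC r * Cexp (- Ci * RtoC th))%C).
          { assert (Ee : (Cexp (Ci * RtoC th) * Cexp (- Ci * RtoC th))%C = RtoC 1).
            { rewrite <- Cexp_plus.
              replace (Ci * RtoC th + - Ci * RtoC th)%C with (RtoC 0) by ring.
              apply Cexp_0. }
            replace (/ RtoC r * Cexp (- Ci * RtoC th))%C with
              (/ circle r th * ((circle r th / RtoC r) * Cexp (- Ci * RtoC th)))%C.
            2:{ pose proof (circle_neq_0 r th Hr); field; split; assumption. }
            replace (circle r th / RtoC r * Cexp (- Ci * RtoC th))%C with (RtoC 1); [ring|].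
            rewrite <- Ee; unfold circle; field; exact Hrc. }
          rewrite Einv, Cpow_mult_l; f_equal.
          unfold m; generalize (S k); intros j; clear.
          induction j as [|j IH].
          - simpl; rewrite <- Cexp_0; f_equal; ring.
          - rewrite Cpow_S, IH, <- Cexp_plus; f_equal.
            rewrite S_INR, RtoC_plus; ring. }
        apply is_CRInt_eq with (minus (F (2 * PI)) (F 0)).
        * eapply is_CRInt_ext; [|apply (is_RInt_derive (V := C_R_CompleteNormedModule) F
            (fun th => (/ RtoC r) ^ S k * Cexp (- (Ci * RtoC m) * RtoC th))%C)].
          -- intros th; cbv beta; rewrite Hpow; ring.
          -- intros th _; eapply Rderive_eq; [apply Rderive_scal, Rderive_Cexp_linear|].
             replace (- (Ci * RtoC m))%C with ((- (1)) * Ci * RtoC m)%C by ring.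
             transitivity ((- (Ci * Ci)) * ((/ RtoC r) ^ S k *
               Cexp ((- (1)) * Ci * RtoC m * RtoC th)))%C; [field; exact Hm|].
             replace (Ci * Ci)%C with (- (1))%C by (apply C_eq; simpl; ring); ring.
          -- intros th _; apply Ccontinuous_mult; [apply continuous_const|].
             eapply Rderive_Ccontinuous, Rderive_Cexp_linear.
        * change ((F (2 * PI)%R - F 0%R)%C = RtoC 0).
          assert (EF : forall th, F th = (Ci / RtoC m * (/ circle r th) ^ S k)%C).
          { intros th; rewrite Hpow; unfold F; ring. }
          rewrite !EF, circle_period; ring. }
  apply (is_Cseries_unique (fun k => z ^ k * c k)%C); [now apply is_Cpseries_series|].
  apply is_Cseries_eps; intros eps Heps; exists 0%nat; intros n _.
  replace (Csum_n (fun k => z ^ k * c k)%C n) with (RtoC (2 * PI)).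
  - replace (RtoC (2 * PI) - RtoC (2 * PI))%C with (RtoC 0) by ring; now rewrite Cmod_0.
  - induction n as [|n IH]; [rewrite sum_O; simpl; ring|].
    rewrite Csum_n_S, <- IH; simpl c; ring.
Qed.

Lemma radius_ge_mono (rho rho' : R) (a : nat -> C) :
  rho' <= rho -> radius_ge rho a -> radius_ge rho' a.
Proof. intros H Ha r Hr; apply Ha; lra. Qed.

(** Cauchy's formula and the expansion of its kernel give a power series on each disk of
    radius [r < 1]; uniqueness of the coefficients makes it independent of [r]. *)
Theorem holomorphic_CPSeries (h h' : C -> C) :
  (forall z, Cmod z < 1 -> is_Cderive h z (h' z)) ->
  (forall z, Cmod z < 1 -> CCcontinuous h' z) ->
  exists a, radius_ge 1 a /\ forall z, Cmod z < 1 -> CPSeries a z = h z.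
Proof.
  intros Hh Hh'; pose proof PI_RGT_0 as HPI.
  assert (Hpi : RtoC (2 * PI) <> RtoC 0) by (apply RtoC_neq_0; lra).
  assert (Disk : forall r, 0 < r < 1 -> exists a, radius_ge r a /\
            forall z, Cmod z < r -> CPSeries a z = h z).
  { intros r Hr.
    assert (Hg : forall t, Ccontinuous (fun th => h (circle r th)) t).
    { intros t; apply Ccontinuous_comp; [apply circle_continuous|].
      eapply Cderive_continuous, Hh; rewrite Cmod_circle; lra. }
    set (c := fun k => RInt (V := C_R_CompleteNormedModule)
                (fun th => h (circle r th) * (/ circle r th) ^ k)%C 0 (2 * PI)).
    assert (Hc : forall k,
              is_CRInt (fun th => h (circle r th) * (/ circle r th) ^ k)%C 0 (2 * PI) (c k)).
    { intros k; apply (RInt_correct (V := C_R_CompleteNormedModule)).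
      apply ex_CRInt_continuous; intros t; apply Ccontinuous_mult; [apply Hg|].
      apply Cpow_continuous; apply inv_circle_continuous; lra. }
    assert (Hser : forall z, Cmod z < r -> is_Cpseries c z (h z * RtoC (2 * PI))%C).
    { intros z Hz.
      destruct (ex_CRInt_continuous
        (fun th => h (circle r th) * (circle r th / (circle r th - z)))%C 0 (2 * PI))
        as [I HI].
      { intros t; apply Ccontinuous_mult; [apply Hg|now apply kernel_continuous]. }
      rewrite <- (cauchy_kernel h h' z r I (RtoC (2 * PI))); auto; try lra.
      - exact (kernel_expansion _ z r I c Hz Hg HI Hc).
      - now apply kernel_integral. }
    assert (Hcr : radius_ge r c) by (apply radius_ge_of_conv; intros z Hz; eauto).
    exists (fun k => / RtoC (2 * PI) * c k)%C; split.
    - apply radius_ge_le with (K := Cmod (/ RtoC (2 * PI))) (a := c);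
        [apply Cmod_ge_0| |exact Hcr].
      intros k; rewrite Cmod_mult; lra.
    - intros z Hz; rewrite (CPSeries_scal r) by assumption.
      rewrite (CPSeries_unique _ _ _ (Hser z Hz)); field; exact Hpi. }
  destruct (Disk (1 / 2) ltac:(lra)) as [a [Ha Ea]].
  assert (Same : forall r, 1 / 2 < r < 1 -> radius_ge r a /\
            forall z, Cmod z < r -> CPSeries a z = h z).
  { intros r Hr; destruct (Disk r ltac:(lra)) as [b [Hb Eb]].
    assert (E : forall k, a k = b k).
    { apply (CPSeries_coeff_unique (1 / 2)); [lra|exact Ha| |].
      - apply radius_ge_mono with r; [lra|exact Hb].
      - intros z Hz; rewrite Ea, Eb by lra; reflexivity. }
    split.
    - intros s Hs; destruct (Hb s Hs) as [M HM]; exists M; intros k; now rewrite E.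
    - intros z Hz; rewrite (CPSeries_ext r b) by assumption; now apply Eb. }
  exists a; split.
  - intros s Hs; apply (proj1 (Same (Rmax (3 / 4) ((s + 1) / 2))
      ltac:(split; [pose proof (Rmax_l (3 / 4) ((s + 1) / 2)); lra|apply Rmax_lub_lt; lra]))).
    pose proof (Rmax_r (3 / 4) ((s + 1) / 2)); lra.
  - intros z Hz; apply (proj2 (Same (Rmax (3 / 4) ((Cmod z + 1) / 2))
      ltac:(split; [pose proof (Rmax_l (3 / 4) ((Cmod z + 1) / 2)); lra|apply Rmax_lub_lt; lra]))).
    pose proof (Rmax_r (3 / 4) ((Cmod z + 1) / 2)); lra.
Qed.

(** [L' = (e^(aL))' e^(-aL) / a] is continuous, so that [e^(bL)] falls under the
    preceding theorem. *)
Lemma exp_branch_CPSeries (L : C -> C) (a b : R) (A : nat -> C) :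
  a <> 0 ->
  (forall z, Cmod z < 1 -> ex_derive (K := C_AbsRing) (V := C_NormedModule) L z) ->
  radius_ge 1 A ->
  (forall z, Cmod z < 1 -> Cexp (RtoC a * L z)%C = CPSeries A z) ->
  exists B, radius_ge 1 B /\
    forall z, Cmod z < 1 -> CPSeries B z = Cexp (RtoC b * L z)%C.
Proof.
  intros Ha HL HA E.
  assert (Hac : RtoC a <> RtoC 0) by (now apply RtoC_neq_0).
  set (dL := fun z => (/ RtoC a * (CPSeries (PSderive A) z * Cexp (- RtoC a * L z)))%C).
  assert (HdL : forall z, Cmod z < 1 -> is_Cderive L z (dL z)).
  { intros z Hz; destruct (HL z Hz : exists l : C, is_Cderive L z l) as [l Hl].
    apply Cderive_eq with l; [exact Hl|].
    assert (D : is_Cderive (CPSeries A) z (RtoC a * l * Cexp (RtoC a * L z))%C).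
    { apply Cderive_ext_loc with (f := fun y => Cexp (RtoC a * L y)%C) (d := 1 - Cmod z);
        [lra| |].
      - intros y Hy; apply E; pose proof (Cmod_triangle_inv y z); lra.
      - apply (Cderive_comp Cexp (fun y => RtoC a * L y)%C); [apply Cderive_Cexp|].
        now apply Cderive_scal. }
    unfold dL; rewrite <- (Cderive_unique _ _ _ _ D (Cderive_CPSeries 1 A z HA Hz)).
    assert (Ee : (Cexp (RtoC a * L z) * Cexp (- RtoC a * L z))%C = RtoC 1).
    { rewrite <- Cexp_plus, <- Cexp_0; f_equal; ring. }
    symmetry; transitivity (l * (Cexp (RtoC a * L z) * Cexp (- RtoC a * L z)))%C;
      [field; exact Hac|rewrite Ee; ring]. }
  assert (CL : forall z, Cmod z < 1 ->
            CCcontinuous L z).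
  { intros z Hz; eapply Cderive_continuous, HdL, Hz. }
  assert (CE : forall c z, Cmod z < 1 ->
            CCcontinuous
              (fun z => Cexp (c * L z))%C z).
  { intros c z Hz; apply (Ccontinuous_comp (fun z => c * L z)%C Cexp).
    - apply Ccontinuous_mult; [apply continuous_const|now apply CL].
    - eapply Cderive_continuous, Cderive_Cexp. }
  apply (holomorphic_CPSeries (fun z => Cexp (RtoC b * L z)%C)
           (fun z => RtoC b * dL z * Cexp (RtoC b * L z))%C).
  - intros z Hz; apply (Cderive_comp Cexp (fun y => RtoC b * L y)%C); [apply Cderive_Cexp|].
    now apply Cderive_scal, HdL.
  - intros z Hz.
    apply (Ccontinuous_mult (fun z => RtoC b * dL z)%C (fun z => Cexp (RtoC b * L z)%C));
      [|now apply CE].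
    apply (Ccontinuous_mult (fun _ => RtoC b) dL); [apply continuous_const|].
    apply (Ccontinuous_mult (fun _ => / RtoC a)%C); [apply continuous_const|].
    apply (Ccontinuous_mult (CPSeries (PSderive A))); [|now apply CE].
    eapply Cderive_continuous, (Cderive_CPSeries 1); [now apply radius_ge_derive|exact Hz].
Qed.

(** * Improper integrals over the open unit interval *)

Notation int01 f l := (is_RInt_gen f (at_right 0) (at_left 1) l).
Notation Rint01 f l := (is_RInt_gen (V := R_NormedModule) f (at_right 0) (at_left 1) l).

Lemma continuous_Rscal (c : R) (f : R -> R) (x : R) :
  continuous f x -> continuous (fun s => c * f s) x.
Proof. apply (continuous_scal_r (K := R_AbsRing) (V := R_NormedModule)). Qed.

Lemma at_right_intro (a d : R) (P : R -> Prop) :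
  0 < d -> (forall x, a < x < a + d -> P x) -> at_right a P.
Proof.
  intros Hd H; exists (mkposreal d Hd); intros y Hy Hay; apply H.
  change (Rabs (y - a) < d) in Hy; apply Rabs_def2 in Hy; lra.
Qed.

Lemma at_left_intro (a d : R) (P : R -> Prop) :
  0 < d -> (forall x, a - d < x < a -> P x) -> at_left a P.
Proof.
  intros Hd H; exists (mkposreal d Hd); intros y Hy Hay; apply H.
  change (Rabs (y - a) < d) in Hy; apply Rabs_def2 in Hy; lra.
Qed.

Lemma int01_eventually (P : R * R -> Prop) :
  (forall a b, 0 < a < 1 / 2 -> 1 / 2 < b < 1 -> P (a, b)) ->
  filter_prod (at_right 0) (at_left 1) P.
Proof.
  intros H; apply Filter_prod with (fun a => 0 < a < 1 / 2) (fun b => 1 / 2 < b < 1).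
  - apply at_right_intro with (1 / 2); [lra|]; intros; lra.
  - apply at_left_intro with (1 / 2); [lra|]; intros; lra.
  - exact H.
Qed.

Lemma int01_ext {V : NormedModule R_AbsRing} (f g : R -> V) (l : V) :
  (forall s, 0 < s < 1 -> f s = g s) -> int01 f l -> int01 g l.
Proof.
  intros E; apply (is_RInt_gen_ext (Fa := at_right 0) (Fb := at_left 1)); apply int01_eventually; simpl.
  intros a b Ha Hb x; rewrite Rmin_left, Rmax_right by lra; intros Hx; apply E; lra.
Qed.

Lemma Rint01_ext (f g : R -> R) (l : R) :
  (forall s, 0 < s < 1 -> f s = g s) -> Rint01 f l -> Rint01 g l.
Proof. apply (int01_ext (V := R_NormedModule)). Qed.

Lemma int01_unique {V : CompleteNormedModule R_AbsRing} (f : R -> V) (l m : V) :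
  int01 f l -> int01 f m -> l = m.
Proof.
  intros H1 H2; rewrite <- (is_RInt_gen_unique f l H1).
  now apply is_RInt_gen_unique.
Qed.

Lemma int01_norm_le {V : CompleteNormedModule R_AbsRing} (f : R -> V) (g : R -> R)
    (l : V) (m : R) :
  (forall s, 0 < s < 1 -> norm (f s) <= g s) -> int01 f l -> Rint01 g m -> norm l <= m.
Proof.
  intros H Hf Hg; refine (RInt_gen_norm (Fa := at_right 0) (Fb := at_left 1) f g l m _ _ Hf Hg);
    apply int01_eventually; simpl; intros a b Ha Hb; [lra|].
  intros x Hx; apply H; lra.
Qed.

Lemma int01_plus (f g : R -> R) (l m : R) :
  Rint01 f l -> Rint01 g m -> Rint01 (fun s => f s + g s) (l + m).
Proof. exact (is_RInt_gen_plus (V := R_NormedModule) f g l m). Qed.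

Lemma int01_scal (c : R) (f : R -> R) (l : R) :
  Rint01 f l -> Rint01 (fun s => c * f s) (c * l).
Proof. exact (is_RInt_gen_scal (V := R_NormedModule) f c l). Qed.

Lemma int01_ge_0 (f : R -> R) (l : R) :
  (forall s, 0 < s < 1 -> 0 <= f s) -> Rint01 f l -> 0 <= l.
Proof.
  intros H Hf; eapply Rle_trans; [apply Rabs_pos|].
  apply (int01_norm_le (V := R_CompleteNormedModule) f f l l); auto.
  intros s Hs; right; apply Rabs_pos_eq, H, Hs.
Qed.

Lemma int01_le (f g : R -> R) (l m : R) :
  (forall s, 0 < s < 1 -> f s <= g s) -> Rint01 f l -> Rint01 g m -> l <= m.
Proof.
  intros H Hf Hg.
  assert (0 <= m + -1 * l); [|lra].
  apply (int01_ge_0 (fun s => g s + -1 * f s)).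
  - intros s Hs; specialize (H s Hs); lra.
  - apply int01_plus; [exact Hg|now apply int01_scal].
Qed.

Lemma ex_RInt_01 {V : CompleteNormedModule R_AbsRing} (f : R -> V) (u v : R) :
  (forall s, 0 < s < 1 -> continuous f s) -> 0 < u < 1 -> 0 < v < 1 -> ex_RInt f u v.
Proof.
  intros Cf Hu Hv; apply ex_RInt_continuous; intros s Hs; apply Cf; split.
  - eapply Rlt_le_trans; [|apply Hs]; now apply Rmin_glb_lt.
  - eapply Rle_lt_trans; [apply Hs|]; now apply Rmax_lub_lt.
Qed.

(** Stated without an order on the end points, which differ in either direction in
    Cauchy's criterion. *)
Lemma RInt_norm_le_abs {V : CompleteNormedModule R_AbsRing} (f : R -> V) (g : R -> R)
    (a b : R) :
  0 < a < 1 -> 0 < b < 1 ->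
  (forall s, 0 < s < 1 -> continuous f s) -> (forall s, 0 < s < 1 -> continuous g s) ->
  (forall s, 0 < s < 1 -> norm (f s) <= g s) ->
  norm (RInt f a b) <= Rabs (RInt g a b).
Proof.
  intros Ha Hb Cf Cg H.
  assert (Ef : forall u v, 0 < u < 1 -> 0 < v < 1 -> is_RInt f u v (RInt f u v)).
  { intros u v Hu Hv; now apply RInt_correct, ex_RInt_01. }
  assert (Eg : forall u v, 0 < u < 1 -> 0 < v < 1 -> is_RInt g u v (RInt g u v)).
  { intros u v Hu Hv; apply (RInt_correct (V := R_CompleteNormedModule)).
    now apply (ex_RInt_01 (V := R_CompleteNormedModule)). }
  assert (Main : forall u v, 0 < u < 1 -> 0 < v < 1 -> u <= v ->
            norm (RInt f u v) <= RInt g u v).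
  { intros u v Hu Hv Huv; apply (norm_RInt_le f g u v); auto.
    intros s Hs; apply H; lra. }
  destruct (Rle_dec a b) as [Hab|Hab].
  - eapply Rle_trans; [now apply Main|apply Rle_abs].
  - rewrite <- (opp_RInt_swap f b a) by (eexists; now apply Ef).
    eapply Rle_trans; [right; apply (norm_opp (RInt f b a))|].
    rewrite <- (opp_RInt_swap (V := R_CompleteNormedModule) g b a)
      by (eexists; now apply Eg).
    change (norm (RInt f b a) <= Rabs (- RInt g b a)); rewrite Rabs_Ropp.
    eapply Rle_trans; [apply Main; lra|apply Rle_abs].
Qed.

Lemma minus_plus_middle {G : AbelianGroup} (x y z : G) :
  minus (plus x (plus y z)) y = plus x z.
Proof.
  unfold minus; rewrite (plus_comm y z), <- !plus_assoc.
  transitivity (plus x (plus z zero)).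
  - apply f_equal, f_equal, (plus_opp_r y).
  - apply f_equal, plus_zero_r.
Qed.

(** Comparison test, by Cauchy's criterion. *)
Lemma int01_ex {V : CompleteNormedModule R_AbsRing} (f : R -> V) (g : R -> R) (m : R) :
  (forall s, 0 < s < 1 -> continuous f s) -> (forall s, 0 < s < 1 -> continuous g s) ->
  (forall s, 0 < s < 1 -> norm (f s) <= g s) -> Rint01 g m ->
  exists l : V, int01 f l.
Proof.
  intros Cf Cg H Hg.
  assert (Ef := fun u v => ex_RInt_01 f u v Cf).
  assert (Eg := fun u v => ex_RInt_01 (V := R_CompleteNormedModule) g u v Cg).
  apply (filterlimi_locally_cauchy (fun ab : R * R => is_RInt f (fst ab) (snd ab))).
  { apply int01_eventually; simpl; intros a b Ha Hb; split.
    - apply Ef; lra.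
    - intros y1 y2 H1 H2; rewrite <- (is_RInt_unique _ _ _ _ H1).
      now apply is_RInt_unique. }
  intros eps.
  assert (He : 0 < eps / 4) by (pose proof (cond_pos eps); lra).
  generalize (proj1 (filterlimi_locally _ _) Hg (mkposreal _ He)).
  intros [Q S HQ HS HQS].
  exists (fun ab => (Q (fst ab) /\ 0 < fst ab < 1 / 2) /\ (S (snd ab) /\ 1 / 2 < snd ab < 1)).
  split.
  { apply Filter_prod with (fun a => Q a /\ 0 < a < 1 / 2) (fun b => S b /\ 1 / 2 < b < 1).
    - apply filter_and; [exact HQ|].
      apply at_right_intro with (1 / 2); [lra|]; intros; lra.
    - apply filter_and; [exact HS|].
      apply at_left_intro with (1 / 2); [lra|]; intros; lra.
    - intros a b; auto. }
  assert (Bg : forall a b, Q a -> 0 < a < 1 / 2 -> S b -> 1 / 2 < b < 1 ->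
            Rabs (RInt g a b - m) < eps / 4).
  { intros a b Qa Ha Sb Hb; destruct (HQS a b Qa Sb) as [y [Hy By]]; simpl in Hy.
    rewrite (is_RInt_unique (V := R_CompleteNormedModule) _ _ _ _ Hy); exact By. }
  intros [a b] [a' b'] [[Qa Ha] [Sb Hb]] [[Qa' Ha'] [Sb' Hb']] u v Hu Hv; simpl in *.
  apply (norm_compat1 (V := V)).
  apply is_RInt_unique in Hu; apply is_RInt_unique in Hv; subst u v.
  assert (E : minus (RInt f a' b') (RInt f a b) = plus (RInt f a' a) (RInt f b b')).
  { rewrite <- (RInt_Chasles f a' a b') by (apply Ef; lra).
    rewrite <- (RInt_Chasles f a b b') by (apply Ef; lra).
    apply (minus_plus_middle (G := V)). }
  apply Rle_lt_trans with (norm (plus (RInt f a' a) (RInt f b b'))).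
  { right; apply f_equal; exact E. }
  eapply Rle_lt_trans; [apply (norm_triangle (V := V))|].
  assert (N1 := RInt_norm_le_abs f g a' a ltac:(lra) ltac:(lra) Cf Cg H).
  assert (N2 := RInt_norm_le_abs f g b b' ltac:(lra) ltac:(lra) Cf Cg H).
  assert (C1 : RInt g a' a = RInt g a' b - RInt g a b).
  { assert (X := RInt_Chasles (V := R_CompleteNormedModule) g a' a b
                  (Eg a' a ltac:(lra) ltac:(lra)) (Eg a b ltac:(lra) ltac:(lra))).
    change (RInt g a' a + RInt g a b = RInt g a' b) in X; lra. }
  assert (C2 : RInt g b b' = RInt g a b' - RInt g a b).
  { assert (X := RInt_Chasles (V := R_CompleteNormedModule) g a b b'
                  (Eg a b ltac:(lra) ltac:(lra)) (Eg b b' ltac:(lra) ltac:(lra))).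
    change (RInt g a b + RInt g b b' = RInt g a b') in X; lra. }
  rewrite C1 in N1; rewrite C2 in N2.
  pose proof (Bg a b Qa Ha Sb Hb) as B1; pose proof (Bg a' b Qa' Ha' Sb Hb) as B2.
  pose proof (Bg a b' Qa Ha Sb' Hb') as B3.
  apply Rabs_def2 in B1; apply Rabs_def2 in B2; apply Rabs_def2 in B3.
  assert (T1 : Rabs (RInt g a' b - RInt g a b) < eps / 2) by (apply Rabs_def1; lra).
  assert (T2 : Rabs (RInt g a b' - RInt g a b) < eps / 2) by (apply Rabs_def1; lra).
  lra.
Qed.

(** The partial integrals over larger intervals dominate the one over [1/4, 3/4]. *)
Lemma int01_gt_0 (f : R -> R) (l : R) :
  (forall s, 0 < s < 1 -> continuous f s) -> (forall s, 0 < s < 1 -> 0 < f s) ->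
  Rint01 f l -> 0 < l.
Proof.
  intros Cf Pf Hf.
  assert (Ef := fun u v => ex_RInt_01 (V := R_CompleteNormedModule) f u v Cf).
  assert (Pos : forall u v, 0 < u < 1 -> 0 < v < 1 -> u < v -> 0 < RInt f u v).
  { intros u v Hu Hv Huv; apply RInt_gt_0; [exact Huv| |].
    - intros x Hx; apply Pf; lra.
    - intros x Hx; apply Cf; lra. }
  assert (Hc := Pos (1 / 4) (3 / 4) ltac:(lra) ltac:(lra) ltac:(lra)).
  set (c := RInt f (1 / 4) (3 / 4)) in *.
  generalize (proj1 (filterlimi_locally _ _) Hf (mkposreal c Hc)).
  intros [Q S HQ HS HQS].
  destruct (filter_ex (F := at_right 0) (fun a => Q a /\ 0 < a < 1 / 4)) as [a [Qa Ha]].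
  { apply filter_and; [exact HQ|]; apply at_right_intro with (1 / 4); [lra|]; intros; lra. }
  destruct (filter_ex (F := at_left 1) (fun b => S b /\ 3 / 4 < b < 1)) as [b [Sb Hb]].
  { apply filter_and; [exact HS|]; apply at_left_intro with (1 / 4); [lra|]; intros; lra. }
  destruct (HQS a b Qa Sb) as [y [Hy By]]; simpl in Hy.
  change (Rabs (y - l) < c) in By; apply Rabs_def2 in By.
  rewrite <- (is_RInt_unique (V := R_CompleteNormedModule) _ _ _ _ Hy) in By.
  rewrite <- (RInt_Chasles (V := R_CompleteNormedModule) f a (1 / 4) b) in By
    by (apply Ef; lra).
  rewrite <- (RInt_Chasles (V := R_CompleteNormedModule) f (1 / 4) (3 / 4) b) in By
    by (apply Ef; lra).
  change (plus (RInt f a (1 / 4)) (plus (RInt f (1 / 4) (3 / 4)) (RInt f (3 / 4) b)))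
    with (RInt f a (1 / 4) + (c + RInt f (3 / 4) b)) in By.
  pose proof (Pos a (1 / 4) ltac:(lra) ltac:(lra) ltac:(lra)).
  pose proof (Pos (3 / 4) b ltac:(lra) ltac:(lra) ltac:(lra)).
  lra.
Qed.

Lemma int01_derive (F f : R -> R) (A B : R) :
  (forall s, 0 < s < 1 -> is_derive F s (f s)) ->
  (forall s, 0 < s < 1 -> continuous f s) ->
  filterlim F (at_right 0) (locally A) -> filterlim F (at_left 1) (locally B) ->
  Rint01 f (B - A).
Proof.
  intros D Cf HA HB; apply filterlimi_locally; intros eps.
  assert (He : 0 < eps / 2) by (pose proof (cond_pos eps); lra).
  generalize (proj1 (filterlim_locally _ _) HA (mkposreal _ He)); intros GA.
  generalize (proj1 (filterlim_locally _ _) HB (mkposreal _ He)); intros GB.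
  apply Filter_prod with
    (fun a => ball A (eps / 2) (F a) /\ 0 < a < 1 / 2)
    (fun b => ball B (eps / 2) (F b) /\ 1 / 2 < b < 1).
  - apply filter_and; [exact GA|]; apply at_right_intro with (1 / 2); [lra|]; intros; lra.
  - apply filter_and; [exact GB|]; apply at_left_intro with (1 / 2); [lra|]; intros; lra.
  - intros a b [Ba Ha] [Bb Hb]; simpl; exists (minus (F b) (F a)); split.
    + apply (is_RInt_derive (V := R_CompleteNormedModule) F f);
        rewrite Rmin_left, Rmax_right by lra; intros x Hx; [apply D|apply Cf]; lra.
    + change (Rabs (F a - A) < eps / 2) in Ba; change (Rabs (F b - B) < eps / 2) in Bb.
      change (Rabs ((F b - F a) - (B - A)) < eps).
      apply Rabs_def2 in Ba; apply Rabs_def2 in Bb; apply Rabs_def1; lra.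
Qed.

Lemma is_RInt_gen_comp {Fa Fb Ga Gb : (R -> Prop) -> Prop}
    {FFa : Filter Fa} {FFb : Filter Fb} (f phi dphi : R -> R) (l : R) :
  filterlim phi Fa Ga -> filterlim phi Fb Gb ->
  filter_prod Fa Fb (fun ab => forall x, Rmin (fst ab) (snd ab) <= x <= Rmax (fst ab) (snd ab) ->
    continuous f (phi x) /\ is_derive phi x (dphi x) /\ continuous dphi x) ->
  is_RInt_gen (V := R_NormedModule) f Ga Gb l ->
  is_RInt_gen (V := R_NormedModule) (fun x => dphi x * f (phi x)) Fa Fb l.
Proof.
  intros Ha Hb [Q S HQ HS HQS] Hf P HP.
  destruct (Hf P HP) as [Q' S' HQ' HS' HQS'].
  apply Filter_prod with (fun a => Q a /\ Q' (phi a)) (fun b => S b /\ S' (phi b)).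
  - apply filter_and; [exact HQ|exact (Ha _ HQ')].
  - apply filter_and; [exact HS|exact (Hb _ HS')].
  - intros a b [Qa Qa'] [Sb Sb']; specialize (HQS a b Qa Sb); simpl in HQS |- *.
    destruct (HQS' _ _ Qa' Sb') as [y [Hy Py]]; simpl in Hy.
    exists y; split; [|exact Py].
    rewrite <- (is_RInt_unique (V := R_CompleteNormedModule) _ _ _ _ Hy).
    apply (is_RInt_comp (V := R_CompleteNormedModule)).
    + intros x Hx; now apply HQS.
    + intros x Hx; split; now apply HQS.
Qed.

(** * The Gamma function and the Beta integral *)

Lemma Rpower_pos (x p : R) : 0 < Rpower x p.
Proof. apply exp_pos. Qed.

Lemma Rpower_base_1 (p : R) : Rpower 1 p = 1.
Proof. unfold Rpower; now rewrite ln_1, Rmult_0_r, exp_0. Qed.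

Lemma Rpower_S (x p : R) : 0 < x -> Rpower x p = x * Rpower x (p - 1).
Proof.
  intros Hx; rewrite <- (Rpower_1 x) at 2 by exact Hx; rewrite <- Rpower_plus; f_equal; ring.
Qed.

Lemma Rpower_derive (p x : R) :
  0 < x -> is_derive (fun s => Rpower s p) x (p * Rpower x (p - 1)).
Proof. intros Hx; now apply is_derive_Reals, derivable_pt_lim_power. Qed.

Lemma Rpower_continuous (p x : R) : 0 < x -> continuous (fun s => Rpower s p) x.
Proof.
  intros Hx; apply ex_derive_Rcontinuous.
  eexists; now apply Rpower_derive.
Qed.

Lemma ln_le_minus_1 (x : R) : 0 < x -> ln x <= x - 1.
Proof.
  intros Hx; pose proof (exp_ineq1_le (ln x)) as H; rewrite exp_ln in H by exact Hx; lra.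
Qed.

Lemma neg_ln_bounds (s : R) : 0 < s < 1 -> 1 - s <= - ln s /\ s * - ln s <= 1 - s.
Proof.
  intros Hs; split; [pose proof (ln_le_minus_1 s); lra|].
  pose proof (ln_le_minus_1 (/ s) (Rinv_0_lt_compat s (proj1 Hs))) as H.
  rewrite ln_Rinv in H by lra.
  apply Rmult_le_compat_l with (r := s) in H; [|lra].
  rewrite Rmult_minus_distr_l, Rinv_r in H; lra.
Qed.

Lemma neg_ln_pos (s : R) : 0 < s < 1 -> 0 < - ln s.
Proof. intros Hs; pose proof (neg_ln_bounds s Hs); lra. Qed.

Lemma neg_ln_derive (s : R) : 0 < s -> is_derive (fun s => - ln s) s (- / s).
Proof.
  intros Hs; apply (is_derive_opp (K := R_AbsRing) (V := R_NormedModule) ln).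
  now apply is_derive_Reals, derivable_pt_lim_ln.
Qed.

Lemma neg_ln_power_derive (p s : R) :
  0 < s < 1 ->
  is_derive (fun s => Rpower (- ln s) p) s (- / s * (p * Rpower (- ln s) (p - 1))).
Proof.
  intros Hs.
  apply (is_derive_comp (K := R_AbsRing) (V := R_NormedModule) (fun v => Rpower v p)
           (fun s => - ln s)).
  - now apply Rpower_derive, neg_ln_pos.
  - now apply neg_ln_derive.
Qed.

Lemma neg_ln_power_continuous (p s : R) :
  0 < s < 1 -> continuous (fun s => Rpower (- ln s) p) s.
Proof.
  intros Hs; apply ex_derive_Rcontinuous.
  eexists; now apply neg_ln_power_derive.
Qed.

Lemma one_minus_power_derive (p s : R) :
  0 < s < 1 ->
  is_derive (fun s => Rpower (1 - s) p) s (- (p * Rpower (1 - s) (p - 1))).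
Proof.
  intros Hs.
  replace (- (p * Rpower (1 - s) (p - 1))) with (scal (-1) (p * Rpower (1 - s) (p - 1)))
    by (unfold scal; simpl; unfold mult; simpl; ring).
  apply (is_derive_comp (K := R_AbsRing) (V := R_NormedModule) (fun v => Rpower v p)
           (fun s => 1 - s)).
  - apply Rpower_derive; lra.
  - auto_derive; [exact I|ring].
Qed.

Lemma one_minus_power_continuous (p s : R) :
  0 < s < 1 -> continuous (fun s => Rpower (1 - s) p) s.
Proof.
  intros Hs; apply ex_derive_Rcontinuous.
  eexists; now apply one_minus_power_derive.
Qed.

Lemma at_right_elim (a : R) (P : R -> Prop) :
  at_right a P -> exists d, 0 < d /\ forall x, a < x < a + d -> P x.
Proof.
  intros [d Hd]; exists d; split; [apply cond_pos|]; intros x Hx; apply Hd; [|lra].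
  change (Rabs (x - a) < d); apply Rabs_def1; lra.
Qed.

Lemma at_left_elim (a : R) (P : R -> Prop) :
  at_left a P -> exists d, 0 < d /\ forall x, a - d < x < a -> P x.
Proof.
  intros [d Hd]; exists d; split; [apply cond_pos|]; intros x Hx; apply Hd; [|lra].
  change (Rabs (x - a) < d); apply Rabs_def1; lra.
Qed.

Lemma Rpower_inv_exponent (x p : R) : 0 < x -> p <> 0 -> Rpower (Rpower x (/ p)) p = x.
Proof.
  intros Hx Hp; rewrite Rpower_mult, Rinv_l by exact Hp; now apply Rpower_1.
Qed.

Lemma Rpower_at_right_0 (p : R) :
  0 < p -> filterlim (fun s => Rpower s p) (at_right 0) (at_right 0).
Proof.
  intros Hp P HP; apply at_right_elim in HP; destruct HP as [d [Hd HP]].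
  apply at_right_intro with (Rpower d (/ p)); [apply Rpower_pos|]; intros x Hx.
  apply HP; split; [apply Rpower_pos|]; rewrite Rplus_0_l.
  rewrite <- (Rpower_inv_exponent d p) by lra; apply Rlt_Rpower_l; lra.
Qed.

Lemma Rpower_at_left_1 (p : R) :
  0 < p -> filterlim (fun s => Rpower s p) (at_left 1) (at_left 1).
Proof.
  intros Hp P HP; apply at_left_elim in HP; destruct HP as [d [Hd HP]].
  set (e := Rmin d (1 / 2)).
  assert (He : 0 < e < 1).
  { unfold e; split; [apply Rmin_pos; lra|]; pose proof (Rmin_r d (1 / 2)); lra. }
  assert (Hed : e <= d) by apply Rmin_l; clearbody e.
  set (x0 := Rpower (1 - e) (/ p)).
  assert (Hx0 : 0 < x0 < 1).
  { split; [apply Rpower_pos|].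
    apply Rlt_le_trans with (Rpower 1 (/ p)); [|rewrite Rpower_base_1; lra].
    apply Rlt_Rpower_l; [now apply Rinv_0_lt_compat|lra]. }
  apply at_left_intro with (1 - x0); [lra|]; intros x Hx; apply HP; split.
  - apply Rle_lt_trans with (1 - e); [lra|].
    rewrite <- (Rpower_inv_exponent (1 - e) p) by lra; apply Rlt_Rpower_l; [lra|].
    fold x0; lra.
  - apply Rlt_le_trans with (Rpower 1 p); [apply Rlt_Rpower_l; lra|].
    rewrite Rpower_base_1; lra.
Qed.

Lemma neg_ln_at_left_1 : filterlim (fun s => - ln s) (at_left 1) (at_right 0).
Proof.
  intros P HP; apply at_right_elim in HP; destruct HP as [d [Hd HP]].
  assert (He : exp (- d) < 1) by (rewrite <- exp_0; apply exp_increasing; lra).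
  pose proof (exp_pos (- d)).
  apply at_left_intro with (1 - exp (- d)); [lra|]; intros x Hx; apply HP; split.
  - apply neg_ln_pos; lra.
  - assert (- d < ln x); [|lra].
    rewrite <- (ln_exp (- d)); apply ln_increasing; lra.
Qed.

Lemma one_minus_at_left_1 : filterlim (fun s => 1 - s) (at_left 1) (at_right 0).
Proof.
  intros P HP; apply at_right_elim in HP; destruct HP as [d [Hd HP]].
  apply at_left_intro with d; [exact Hd|]; intros x Hx; apply HP; lra.
Qed.

Lemma exp_opp_at_right_0 : filterlim (fun t => exp (- t)) (at_right 0) (at_left 1).
Proof.
  intros P HP; apply at_left_elim in HP; destruct HP as [d [Hd HP]].
  apply at_right_intro with d; [exact Hd|]; intros x Hx; apply HP; split.
  - pose proof (exp_ineq1 (- x)); lra.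
  - rewrite <- exp_0; apply exp_increasing; lra.
Qed.

Lemma exp_opp_p_infty : filterlim (fun t => exp (- t)) (Rbar_locally p_infty) (at_right 0).
Proof.
  intros P HP; apply at_right_elim in HP; destruct HP as [d [Hd HP]].
  exists (- ln d); intros x Hx; apply HP; split; [apply exp_pos|].
  rewrite Rplus_0_l, <- (exp_ln d) by exact Hd; apply exp_increasing; lra.
Qed.

Lemma at_right_locally (a : R) : filter_le (at_right a) (locally a).
Proof. apply filter_le_within. Qed.

Lemma at_left_locally (a : R) : filter_le (at_left a) (locally a).
Proof. apply filter_le_within. Qed.

Lemma lim_0_at_right (f : R -> R) (F : (R -> Prop) -> Prop) :
  filterlim f F (at_right 0) -> filterlim f F (locally 0).
Proof. intros H P HP; apply H, at_right_locally, HP. Qed.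

Lemma lim_continuous_right (f : R -> R) (a : R) :
  continuous f a -> filterlim f (at_right a) (locally (f a)).
Proof. intros H P HP; apply at_right_locally, H, HP. Qed.

Lemma lim_continuous_left (f : R -> R) (a : R) :
  continuous f a -> filterlim f (at_left a) (locally (f a)).
Proof. intros H P HP; apply at_left_locally, H, HP. Qed.

Lemma int01_eq (f : R -> R) (l l' : R) : Rint01 f l -> l = l' -> Rint01 f l'.
Proof. now intros H <-. Qed.

Lemma int01_power (b : R) : 0 < b -> Rint01 (fun s => Rpower s (b - 1)) (/ b).
Proof.
  intros Hb.
  apply (int01_eq _ (/ b * 1 - / b * 0)); [|ring].
  apply (int01_derive (fun s => / b * Rpower s b)).
  - intros s Hs.
    replace (Rpower s (b - 1)) with (/ b * (b * Rpower s (b - 1))) by (field; lra).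
    now apply is_derive_scal, Rpower_derive.
  - intros s Hs; now apply Rpower_continuous.
  - apply (filterlim_comp _ _ _ (fun s => Rpower s b) (fun v => / b * v) _ (locally 0)).
    + now apply lim_0_at_right, Rpower_at_right_0.
    + apply (filterlim_scal_r (K := R_AbsRing) (V := R_NormedModule) (/ b) 0).
  - replace (/ b * 1) with (/ b * Rpower 1 b) by now rewrite Rpower_base_1.
    apply (lim_continuous_left (fun s => / b * Rpower s b)).
    apply continuous_Rscal.
    apply Rpower_continuous; lra.
Qed.

Lemma int01_one_minus_power (a : R) : 0 < a -> Rint01 (fun s => Rpower (1 - s) (a - 1)) (/ a).
Proof.
  intros Ha.
  apply (int01_eq _ (- / a * 0 - - / a * 1)); [|ring].
  apply (int01_derive (fun s => - / a * Rpower (1 - s) a)).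
  - intros s Hs.
    replace (Rpower (1 - s) (a - 1)) with (- / a * - (a * Rpower (1 - s) (a - 1)))
      by (field; lra).
    now apply is_derive_scal, one_minus_power_derive.
  - intros s Hs; now apply one_minus_power_continuous.
  - replace (- / a * 1) with (- / a * Rpower (1 - 0) a)
      by now rewrite Rminus_0_r, Rpower_base_1.
    apply (lim_continuous_right (fun s => - / a * Rpower (1 - s) a)).
    apply continuous_Rscal.
    apply (continuous_comp (fun s => 1 - s) (fun v => Rpower v a)).
    + apply (continuous_minus (V := R_NormedModule) (fun _ => 1) (fun s => s));
        [apply continuous_const|apply continuous_id].
    + apply Rpower_continuous; lra.
  - apply (filterlim_comp _ _ _ (fun s => Rpower (1 - s) a) (fun v => - / a * v) _ (locally 0)).
    + apply lim_0_at_right.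
      apply (filterlim_comp _ _ _ (fun s => 1 - s) (fun v => Rpower v a) _ (at_right 0));
        [apply one_minus_at_left_1|now apply Rpower_at_right_0].
    + apply (filterlim_scal_r (K := R_AbsRing) (V := R_NormedModule) (- / a) 0).
Qed.

(** A family of dominating functions with an elementary primitive. *)
Lemma int01_dominating (A B a b : R) :
  0 < a -> 0 < b ->
  Rint01 (fun s => A * Rpower s (b - 1) + B * Rpower (1 - s) (a - 1)) (A * / b + B * / a).
Proof.
  intros Ha Hb; apply int01_plus; apply int01_scal;
    [now apply int01_power|now apply int01_one_minus_power].
Qed.

Lemma dominating_continuous (A B a b s : R) :
  0 < s < 1 -> continuous (fun s => A * Rpower s (b - 1) + B * Rpower (1 - s) (a - 1)) s.
Proof.
  intros Hs; apply (continuous_plus (V := R_NormedModule)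
    (fun s => A * Rpower s (b - 1)) (fun s => B * Rpower (1 - s) (a - 1)));
    apply continuous_Rscal.
  - now apply Rpower_continuous.
  - now apply one_minus_power_continuous.
Qed.

(** A power of [- ln s] is [O(s^(-1/2))] since [p ln v <= v/2 + O(1)]. *)
Lemma neg_ln_power_le (p : R) :
  0 <= p -> exists K, 0 < K /\
    forall s, 0 < s < 1 -> Rpower (- ln s) p <= K * Rpower s (1 / 2 - 1).
Proof.
  intros Hp; set (c := p * (ln (2 * (p + 1)) - 1)).
  exists (exp c); split; [apply exp_pos|]; intros s Hs.
  pose proof (neg_ln_pos s Hs) as Hv; set (v := - ln s) in *.
  unfold Rpower at 1 2; rewrite <- exp_plus.
  replace ((1 / 2 - 1) * ln s) with (v / 2) by (unfold v; field).
  assert (H : p * ln v <= c + v / 2).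
  { replace v with (2 * (p + 1) * (v / (2 * (p + 1)))) at 1 by (field; lra).
    rewrite ln_mult by (try apply Rdiv_lt_0_compat; lra).
    assert (Hd : 0 < v / (2 * (p + 1))) by (apply Rdiv_lt_0_compat; lra).
    pose proof (ln_le_minus_1 _ Hd) as L.
    assert (M : p * (v / (2 * (p + 1))) <= v / 2).
    { replace (v / 2) with ((p + 1) * (v / (2 * (p + 1)))) by (field; lra).
      apply Rmult_le_compat_r; lra. }
    unfold c; nra. }
  destruct H as [H|H]; [left; now apply exp_increasing|right; now rewrite H].
Qed.

Lemma Rpower_le_nonpos (x y p : R) : 0 < x <= y -> p <= 0 -> Rpower y p <= Rpower x p.
Proof.
  intros Hxy Hp.
  replace p with (- (- p)) by ring; rewrite !(Rpower_Ropp _ (- p)).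
  apply Rinv_le_contravar; [apply Rpower_pos|].
  apply Rle_Rpower_l; lra.
Qed.

(** The first term serves for [a >= 1]; for [a < 1] the singularity is at [1], where
    [- ln s >= 1 - s]. *)
Lemma neg_ln_power_dominated (a : R) :
  0 < a -> exists K, 0 < K /\ forall s, 0 < s < 1 ->
    Rpower (- ln s) (a - 1) <= K * Rpower s (1 / 2 - 1) + 1 * Rpower (1 - s) (a - 1).
Proof.
  intros Ha; destruct (Rle_dec 1 a) as [H|H].
  - destruct (neg_ln_power_le (a - 1)) as [K [HK HB]]; [lra|].
    exists K; split; [exact HK|]; intros s Hs; specialize (HB s Hs).
    pose proof (Rpower_pos (1 - s) (a - 1)); lra.
  - exists 1; split; [lra|]; intros s Hs.
    pose proof (Rpower_pos s (1 / 2 - 1)).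
    assert (Rpower (- ln s) (a - 1) <= Rpower (1 - s) (a - 1)); [|lra].
    apply Rpower_le_nonpos; [|lra]; pose proof (neg_ln_bounds s Hs); lra.
Qed.

(** Euler's integral in the variable [s = e^(-t)]. *)
Lemma Gamma_int01 (a : R) : 0 < a -> Rint01 (fun s => Rpower (- ln s) (a - 1)) (Gamma a).
Proof.
  intros Ha; destruct (neg_ln_power_dominated a Ha) as [K [HK HB]].
  destruct (int01_ex (V := R_CompleteNormedModule) (fun s => Rpower (- ln s) (a - 1))
    (fun s => K * Rpower s (1 / 2 - 1) + 1 * Rpower (1 - s) (a - 1))
    (K * / (1 / 2) + 1 * / a)) as [l Hl].
  - intros s Hs; now apply neg_ln_power_continuous.
  - intros s Hs; now apply dominating_continuous.
  - intros s Hs; change (Rabs (Rpower (- ln s) (a - 1)) <=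
      K * Rpower s (1 / 2 - 1) + 1 * Rpower (1 - s) (a - 1)).
    rewrite Rabs_pos_eq by (left; apply Rpower_pos); now apply HB.
  - apply int01_dominating; lra.
  - apply (int01_eq _ l); [exact Hl|].
    symmetry; unfold Gamma.
    apply (is_RInt_gen_unique (V := R_CompleteNormedModule)
             (Fa := at_right 0) (Fb := Rbar_locally p_infty)).
    replace l with (- - l) by ring.
    apply (is_RInt_gen_ext (V := R_NormedModule) (Fa := at_right 0) (Fb := Rbar_locally p_infty)
             (fun t => - (- exp (- t) * Rpower (- ln (exp (- t))) (a - 1)))).
    + apply filter_forall; intros ab x _; rewrite ln_exp, Ropp_involutive.
      match goal with |- ?u = ?v => change (@eq R u v) end; ring.
    + apply (is_RInt_gen_opp (V := R_NormedModule) (Fa := at_right 0) (Fb := Rbar_locally p_infty)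
               (fun t => - exp (- t) * Rpower (- ln (exp (- t))) (a - 1)) (- l)).
      apply (is_RInt_gen_comp (Ga := at_left 1) (Gb := at_right 0)
               (fun s => Rpower (- ln s) (a - 1)) (fun t => exp (- t)) (fun t => - exp (- t))).
      * apply exp_opp_at_right_0.
      * apply exp_opp_p_infty.
      * apply Filter_prod with (fun x => 0 < x < 1) (fun x => 0 < x).
        -- apply at_right_intro with 1; [lra|]; intros; lra.
        -- exists 0; auto.
        -- intros x y Hx Hy u; simpl; intros Hu.
           assert (Hu0 : 0 < u) by (eapply Rlt_le_trans; [|apply Hu]; now apply Rmin_glb_lt).
           split; [|split].
           ++ apply neg_ln_power_continuous; split; [apply exp_pos|].
              rewrite <- exp_0; apply exp_increasing; lra.
           ++ auto_derive; [exact I|ring].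
           ++ apply ex_derive_Rcontinuous.
              auto_derive; exact I.
      * apply (is_RInt_gen_swap (V := R_NormedModule) (Fa := at_left 1) (Fb := at_right 0)), Hl.
Qed.

Lemma Gamma_pos (a : R) : 0 < a -> 0 < Gamma a.
Proof.
  intros Ha; apply (int01_gt_0 (fun s => Rpower (- ln s) (a - 1))).
  - intros s Hs; now apply neg_ln_power_continuous.
  - intros s Hs; apply Rpower_pos.
  - now apply Gamma_int01.
Qed.

(** The substitution of [s^x] for [s] in [Gamma_int01]. *)
Lemma Gamma_int01_scaled (a x : R) :
  0 < a -> 0 < x ->
  Rint01 (fun s => Rpower (- ln s) (a - 1) * Rpower s (x - 1)) (Gamma a * Rpower x (- a)).
Proof.
  intros Ha Hx; rewrite Rmult_comm.
  apply (Rint01_ext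
    (fun s => Rpower x (- a) * (x * Rpower s (x - 1) * Rpower (- ln (Rpower s x)) (a - 1)))).
  - intros s Hs; rewrite ln_Rpower by lra.
    replace (- (x * ln s)) with (x * - ln s) by ring.
    rewrite <- Rpower_mult_distr by (try lra; now apply neg_ln_pos).
    replace (Rpower x (- a) * (x * Rpower s (x - 1) *
              (Rpower x (a - 1) * Rpower (- ln s) (a - 1))))
      with (Rpower x (- a) * (x * Rpower x (a - 1)) *
              (Rpower (- ln s) (a - 1) * Rpower s (x - 1))) by ring.
    rewrite <- Rpower_S, <- Rpower_plus, Rplus_opp_l, Rpower_O by exact Hx; ring.
  - apply int01_scal.
    apply (is_RInt_gen_comp (Ga := at_right 0) (Gb := at_left 1)
             (fun s => Rpower (- ln s) (a - 1)) (fun s => Rpower s x)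
             (fun s => x * Rpower s (x - 1))).
    + now apply Rpower_at_right_0.
    + now apply Rpower_at_left_1.
    + apply int01_eventually; intros u v Hu Hv s; simpl.
      rewrite Rmin_left, Rmax_right by lra; intros Hs; split; [|split].
      * apply neg_ln_power_continuous; split; [apply Rpower_pos|].
        apply Rlt_le_trans with (Rpower 1 x); [apply Rlt_Rpower_l; lra|].
        rewrite Rpower_base_1; lra.
      * apply Rpower_derive; lra.
      * apply continuous_Rscal.
        apply Rpower_continuous; lra.
    + now apply Gamma_int01.
Qed.

Lemma squeeze_0 {F : (R -> Prop) -> Prop} {FF : Filter F} (f g : R -> R) :
  F (fun x => 0 <= f x <= g x) -> filterlim g F (locally 0) -> filterlim f F (locally 0).
Proof.
  intros H Hg; apply filterlim_locally; intros eps.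
  generalize (filter_and _ _ H (proj1 (filterlim_locally _ _) Hg eps)); apply filter_imp.
  intros x [Hx Bx]; change (Rabs (g x - 0) < eps) in Bx; change (Rabs (f x - 0) < eps).
  apply Rabs_def2 in Bx; apply Rabs_def1; lra.
Qed.

(** Integration by parts: [s (- ln s)^a] vanishes at both ends. *)
Lemma Gamma_succ (a : R) : 0 < a -> Gamma (a + 1) = a * Gamma a.
Proof.
  intros Ha.
  assert (H1 : Rint01 (fun s => Rpower (- ln s) a + - a * Rpower (- ln s) (a - 1))
                 (Gamma (a + 1) + - a * Gamma a)).
  { apply int01_plus; [|now apply int01_scal, Gamma_int01].
    apply (Rint01_ext (fun s => Rpower (- ln s) (a + 1 - 1))); [|apply Gamma_int01; lra].
    intros s _; f_equal; ring. }
  assert (H2 : Rint01 (fun s => Rpower (- ln s) a + - a * Rpower (- ln s) (a - 1)) (0 - 0)).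
  { apply (int01_derive (fun s => s * Rpower (- ln s) a)).
    - intros s Hs.
      replace (Rpower (- ln s) a + - a * Rpower (- ln s) (a - 1)) with
        (1 * Rpower (- ln s) a + s * (- / s * (a * Rpower (- ln s) (a - 1))))
        by (field; lra).
      apply (is_derive_mult (K := R_AbsRing) (fun s => s) (fun s => Rpower (- ln s) a) s 1
               (- / s * (a * Rpower (- ln s) (a - 1)))).
      + apply (is_derive_id (K := R_AbsRing)).
      + now apply neg_ln_power_derive.
      + exact Rmult_comm.
    - intros s Hs; apply (continuous_plus (V := R_NormedModule)
        (fun s => Rpower (- ln s) a) (fun s => - a * Rpower (- ln s) (a - 1))); [now apply neg_ln_power_continuous|].
      apply (continuous_Rscal (- a)
               (fun s => Rpower (- ln s) (a - 1))).
      now apply neg_ln_power_continuous.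
    - destruct (neg_ln_power_le a) as [K [HK HB]]; [lra|].
      apply (squeeze_0 (F := at_right 0) _ (fun s => K * Rpower s (1 / 2))).
      + apply at_right_intro with 1; [lra|]; intros s Hs.
        pose proof (Rpower_pos (- ln s) a); specialize (HB s ltac:(lra)); split; [nra|].
        rewrite (Rpower_S s (1 / 2)) by lra; nra.
      + replace 0 with (K * 0) at 2 by ring.
        apply (filterlim_comp _ _ _ (fun s => Rpower s (1 / 2)) (fun v => K * v) _ (locally 0)).
        * apply lim_0_at_right, Rpower_at_right_0; lra.
        * apply (filterlim_scal_r (K := R_AbsRing) (V := R_NormedModule) K 0).
    - apply (squeeze_0 (F := at_left 1) _ (fun s => Rpower (- ln s) a)).
      + apply at_left_intro with 1; [lra|]; intros s Hs.
        pose proof (Rpower_pos (- ln s) a); split; nra.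
      + apply lim_0_at_right.
        apply (filterlim_comp _ _ _ (fun s => - ln s) (fun v => Rpower v a) _ (at_right 0));
          [apply neg_ln_at_left_1|now apply Rpower_at_right_0]. }
  pose proof (int01_unique (V := R_CompleteNormedModule) _ _ _ H1 H2); lra.
Qed.

(** Bernoulli's inequality with real exponents: convex powers lie above their tangent. *)
Lemma bernoulli (v p : R) : 0 < v -> p <= 0 \/ 1 <= p -> 1 + p * (v - 1) <= Rpower v p.
Proof.
  intros Hv Hp.
  assert (E : forall q, 1 + q * ln v <= Rpower v q).
  { intros q; unfold Rpower; pose proof (exp_ineq1_le (q * ln v)); lra. }
  pose proof (ln_le_minus_1 v Hv) as L.
  destruct Hp as [Hp|Hp].
  - specialize (E p); nra.
  - rewrite (Rpower_S v p) by exact Hv.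
    specialize (E (p - 1)).
    pose proof (ln_le_minus_1 (/ v) (Rinv_0_lt_compat v Hv)) as L'.
    rewrite ln_Rinv in L' by exact Hv.
    assert (Hvi : v * / v = 1) by (apply Rinv_r; lra).
    assert (v * (1 + (p - 1) * ln v) <= v * Rpower v (p - 1))
      by (apply Rmult_le_compat_l; lra).
    assert ((p - 1) * (1 - / v) <= (p - 1) * ln v) by (apply Rmult_le_compat_l; lra).
    assert (v * ((p - 1) * (1 - / v)) <= v * ((p - 1) * ln v))
      by (apply Rmult_le_compat_l; lra).
    replace (v * ((p - 1) * (1 - / v))) with ((p - 1) * (v - v * / v)) in * by ring.
    rewrite Hvi in *; nra.
Qed.

(** The tangent of [t^p] at [x] integrates to [x^p Gamma x] against [t^(x-1) e^(-t)],
    because [Gamma (x + 1) = x Gamma x]. *)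
Lemma Gamma_ge_tangent (x p : R) :
  0 < x -> 0 < x + p -> p <= 0 \/ 1 <= p -> Rpower x p * Gamma x <= Gamma (x + p).
Proof.
  intros Hx Hxp Hp.
  apply (int01_le
    (fun s => Rpower x p * (1 - p) * Rpower (- ln s) (x - 1)
              + Rpower x p * p / x * Rpower (- ln s) (x + 1 - 1))
    (fun s => Rpower (- ln s) (x + p - 1))).
  - intros s Hs; pose proof (neg_ln_pos s Hs) as Ht; set (t := - ln s) in *.
    replace (x + 1 - 1) with x by ring; rewrite (Rpower_S t x) by exact Ht.
    replace (x + p - 1) with (p + (x - 1)) by ring; rewrite Rpower_plus.
    replace (Rpower x p * (1 - p) * Rpower t (x - 1)
             + Rpower x p * p / x * (t * Rpower t (x - 1)))
      with (Rpower x p * (1 + p * (t / x - 1)) * Rpower t (x - 1)) by (field; lra).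
    apply Rmult_le_compat_r; [left; apply Rpower_pos|].
    replace (Rpower t p) with (Rpower x p * Rpower (t / x) p).
    + apply Rmult_le_compat_l; [left; apply Rpower_pos|].
      apply bernoulli; [now apply Rdiv_lt_0_compat|exact Hp].
    + rewrite Rpower_mult_distr by (try exact Hx; now apply Rdiv_lt_0_compat).
      f_equal; field; lra.
  - apply (int01_eq _ (Rpower x p * (1 - p) * Gamma x + Rpower x p * p / x * Gamma (x + 1))).
    + apply int01_plus; apply int01_scal; apply Gamma_int01; lra.
    + rewrite Gamma_succ by exact Hx; field; lra.
  - now apply Gamma_int01.
Qed.

Lemma Gamma_ratio_upper (x a : R) :
  0 < x -> 0 < a -> Gamma (x + a) <= Rpower (x + a) a * Gamma x.
Proof.
  intros Hx Ha.
  pose proof (Gamma_ge_tangent (x + a) (- a) ltac:(lra) ltac:(lra) ltac:(lra)) as H.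
  replace (x + a + - a) with x in H by ring.
  apply Rmult_le_compat_l with (r := Rpower (x + a) a) in H; [|left; apply Rpower_pos].
  rewrite <- Rmult_assoc, <- Rpower_plus, Rplus_opp_r, Rpower_O in H by lra; lra.
Qed.

Lemma Gamma_ratio_lower (x a : R) :
  0 < x -> 0 < a -> Rpower x (a + 1) * Gamma x <= (x + a) * Gamma (x + a).
Proof.
  intros Hx Ha; rewrite <- Gamma_succ, Rplus_assoc by lra.
  apply Gamma_ge_tangent; lra.
Qed.

Definition beta_weight (a b s : R) : R := Rpower (1 - s) (a - 1) * Rpower s (b - 1).

Definition Beta (a b : R) : R :=
  RInt_gen (V := R_CompleteNormedModule) (beta_weight a b) (at_right 0) (at_left 1).

Lemma beta_weight_pos (a b s : R) : 0 < beta_weight a b s.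
Proof. apply Rmult_lt_0_compat; apply Rpower_pos. Qed.

Lemma beta_weight_continuous (a b s : R) : 0 < s < 1 -> continuous (beta_weight a b) s.
Proof.
  intros Hs; apply (continuous_mult (K := R_AbsRing)
    (fun s => Rpower (1 - s) (a - 1)) (fun s => Rpower s (b - 1))).
  - now apply one_minus_power_continuous.
  - apply Rpower_continuous; lra.
Qed.

Lemma Rpower_le_1 (x p : R) : 0 < x <= 1 -> 0 <= p -> Rpower x p <= 1.
Proof.
  intros Hx Hp; rewrite <- (Rpower_base_1 p); apply Rle_Rpower_l; lra.
Qed.

Lemma Rpower_half_bound (x p : R) : 1 / 2 <= x <= 1 -> Rpower x p <= 1 + Rpower (1 / 2) p.
Proof.
  intros Hx; pose proof (Rpower_pos (1 / 2) p); destruct (Rle_dec 0 p) as [Hp|Hp].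
  - pose proof (Rpower_le_1 x p ltac:(lra) Hp); lra.
  - pose proof (Rpower_le_nonpos (1 / 2) x p ltac:(lra) ltac:(lra)); lra.
Qed.

(** Each factor of the weight is bounded on the half of the interval where the other one
    may be singular. *)
Lemma Beta_int01 (a b : R) : 0 < a -> 0 < b -> Rint01 (beta_weight a b) (Beta a b).
Proof.
  intros Ha Hb.
  set (A := 1 + Rpower (1 / 2) (a - 1)); set (B := 1 + Rpower (1 / 2) (b - 1)).
  assert (HA : 0 < A) by (unfold A; pose proof (Rpower_pos (1 / 2) (a - 1)); lra).
  assert (HB : 0 < B) by (unfold B; pose proof (Rpower_pos (1 / 2) (b - 1)); lra).
  destruct (int01_ex (V := R_CompleteNormedModule) (beta_weight a b)
    (fun s => A * Rpower s (b - 1) + B * Rpower (1 - s) (a - 1)) (A * / b + B * / a))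
    as [l Hl].
  - apply beta_weight_continuous.
  - intros s Hs; now apply dominating_continuous.
  - intros s Hs; change (Rabs (beta_weight a b s) <=
      A * Rpower s (b - 1) + B * Rpower (1 - s) (a - 1)).
    rewrite Rabs_pos_eq by (left; apply beta_weight_pos); unfold beta_weight.
    pose proof (Rpower_pos s (b - 1)) as P; pose proof (Rpower_pos (1 - s) (a - 1)) as Q.
    destruct (Rle_dec s (1 / 2)) as [H|H].
    + pose proof (Rpower_half_bound (1 - s) (a - 1) ltac:(lra)) as W; fold A in W.
      apply Rle_trans with (A * Rpower s (b - 1)); [apply Rmult_le_compat_r; lra|].
      assert (0 < B * Rpower (1 - s) (a - 1)) by now apply Rmult_lt_0_compat.
      lra.
    + pose proof (Rpower_half_bound s (b - 1) ltac:(lra)) as W; fold B in W.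
      apply Rle_trans with (B * Rpower (1 - s) (a - 1)).
      { rewrite Rmult_comm; apply Rmult_le_compat_r; lra. }
      assert (0 < A * Rpower s (b - 1)) by now apply Rmult_lt_0_compat.
      lra.
  - now apply int01_dominating.
  - unfold Beta; rewrite (is_RInt_gen_unique (V := R_CompleteNormedModule)
      (Fa := at_right 0) (Fb := at_left 1) _ _ Hl); exact Hl.
Qed.

(** Integration by parts: [s^b (1 - s)^a] vanishes at both ends. *)
Lemma Beta_succ (a b : R) : 0 < a -> 0 < b -> (a + b) * Beta a (b + 1) = b * Beta a b.
Proof.
  intros Ha Hb.
  set (f := fun s => b * beta_weight a b s + - (a + b) * beta_weight a (b + 1) s).
  assert (H1 : Rint01 f (b * Beta a b + - (a + b) * Beta a (b + 1))).
  { apply int01_plus; apply int01_scal; apply Beta_int01; lra. }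
  assert (H2 : Rint01 f (0 - 0)).
  { apply (int01_derive (fun s => Rpower s b * Rpower (1 - s) a)).
    - intros s Hs.
      replace (f s) with (b * Rpower s (b - 1) * Rpower (1 - s) a
                          + Rpower s b * - (a * Rpower (1 - s) (a - 1))).
      + apply (is_derive_mult (K := R_AbsRing) (fun s => Rpower s b)
                 (fun s => Rpower (1 - s) a) s (b * Rpower s (b - 1))
                 (- (a * Rpower (1 - s) (a - 1)))).
        * apply Rpower_derive; lra.
        * now apply one_minus_power_derive.
        * exact Rmult_comm.
      + unfold f, beta_weight; rewrite (Rpower_S (1 - s) a), (Rpower_S s (b + 1 - 1)) by lra.
        replace (b + 1 - 1) with b by ring; rewrite (Rpower_S s b) by lra.
        ring.
    - intros s Hs; apply (continuous_plus (V := R_NormedModule)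
        (fun s => b * beta_weight a b s) (fun s => - (a + b) * beta_weight a (b + 1) s)).
      + apply (continuous_Rscal b (beta_weight a b)).
        now apply beta_weight_continuous.
      + apply (continuous_Rscal (- (a + b))
                 (beta_weight a (b + 1))).
        now apply beta_weight_continuous.
    - apply (squeeze_0 (F := at_right 0) _ (fun s => Rpower s b)).
      + apply at_right_intro with 1; [lra|]; intros s Hs.
        pose proof (Rpower_pos s b); pose proof (Rpower_pos (1 - s) a).
        pose proof (Rpower_le_1 (1 - s) a ltac:(lra) ltac:(lra)); split; nra.
      + now apply lim_0_at_right, Rpower_at_right_0.
    - apply (squeeze_0 (F := at_left 1) _ (fun s => Rpower (1 - s) a)).
      + apply at_left_intro with 1; [lra|]; intros s Hs.
        pose proof (Rpower_pos s b); pose proof (Rpower_pos (1 - s) a).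
        pose proof (Rpower_le_1 s b ltac:(lra) ltac:(lra)); split; nra.
      + apply lim_0_at_right.
        apply (filterlim_comp _ _ _ (fun s => 1 - s) (fun v => Rpower v a) _ (at_right 0));
          [apply one_minus_at_left_1|now apply Rpower_at_right_0]. }
  pose proof (int01_unique (V := R_CompleteNormedModule) _ _ _ H1 H2); lra.
Qed.

(** From [s (- ln s) <= 1 - s <= - ln s]. *)
Lemma one_minus_power_bounds (a s : R) :
  0 < a -> 0 < s < 1 ->
  Rpower (- ln s) (a - 1) * Rpower s a <= Rpower (1 - s) (a - 1)
    <= Rpower (- ln s) (a - 1) * Rpower s (-1).
Proof.
  intros Ha Hs; pose proof (neg_ln_bounds s Hs) as B; pose proof (neg_ln_pos s Hs) as Ht.
  set (t := - ln s) in *.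
  assert (Hst : 0 < s * t) by nra.
  pose proof (Rpower_pos t (a - 1)) as Pt.
  assert (E : Rpower (s * t) (a - 1) = Rpower t (a - 1) * Rpower s (a - 1)).
  { rewrite <- Rpower_mult_distr by lra; ring. }
  assert (Sa : Rpower s a <= 1) by (apply Rpower_le_1; lra).
  assert (S1 : 1 <= Rpower s (-1)).
  { rewrite <- (Rpower_base_1 (-1)) at 1; apply Rpower_le_nonpos; lra. }
  destruct (Rle_dec 1 a) as [H|H]; split.
  - apply Rle_trans with (Rpower (s * t) (a - 1)).
    + rewrite E; apply Rmult_le_compat_l; [lra|].
      rewrite (Rpower_S s a) by lra; pose proof (Rpower_pos s (a - 1)); nra.
    + apply Rle_Rpower_l; lra.
  - apply Rle_trans with (Rpower t (a - 1)); [apply Rle_Rpower_l; lra|nra].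
  - apply Rle_trans with (Rpower t (a - 1)); [nra|].
    apply Rpower_le_nonpos; lra.
  - apply Rle_trans with (Rpower (s * t) (a - 1)); [apply Rpower_le_nonpos; lra|].
    rewrite E; apply Rmult_le_compat_l; [lra|].
    replace (a - 1) with (a + -1) by ring; rewrite Rpower_plus.
    pose proof (Rpower_pos s (-1)); nra.
Qed.

Lemma Beta_lower (a x : R) : 0 < a -> 0 < x -> Gamma a * Rpower (x + a) (- a) <= Beta a x.
Proof.
  intros Ha Hx.
  apply (int01_le (fun s => Rpower (- ln s) (a - 1) * Rpower s (x + a - 1)) (beta_weight a x)).
  - intros s Hs; unfold beta_weight.
    replace (x + a - 1) with (a + (x - 1)) by ring.
    rewrite Rpower_plus, <- Rmult_assoc.
    apply Rmult_le_compat_r; [left; apply Rpower_pos|].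
    now apply one_minus_power_bounds.
  - apply Gamma_int01_scaled; lra.
  - now apply Beta_int01.
Qed.

Lemma Beta_upper (a x : R) : 0 < a -> 1 < x -> Beta a x <= Gamma a * Rpower (x - 1) (- a).
Proof.
  intros Ha Hx.
  apply (int01_le (beta_weight a x) (fun s => Rpower (- ln s) (a - 1) * Rpower s (x - 1 - 1))).
  - intros s Hs; unfold beta_weight.
    replace (x - 1 - 1) with (-1 + (x - 1)) by ring.
    rewrite Rpower_plus, <- Rmult_assoc.
    apply Rmult_le_compat_r; [left; apply Rpower_pos|].
    now apply one_minus_power_bounds.
  - apply Beta_int01; lra.
  - apply Gamma_int01_scaled; lra.
Qed.

Lemma Rpower_div (x y p : R) : 0 < x -> 0 < y -> Rpower (x / y) p = Rpower x p * Rpower y (- p).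
Proof.
  intros Hx Hy; unfold Rdiv.
  rewrite <- Rpower_mult_distr by (try exact Hx; now apply Rinv_0_lt_compat).
  f_equal; unfold Rpower; rewrite ln_Rinv by exact Hy; f_equal; ring.
Qed.

(** The quotient of the two sides is invariant under [b -> b + 1], and it tends to [1] by
    the estimates of [Beta a x] and of [Gamma (x + a) / Gamma x] for large [x]. *)
Theorem Beta_Gamma (a b : R) :
  0 < a -> 0 < b -> Beta a b * Gamma (a + b) = Gamma a * Gamma b.
Proof.
  intros Ha Hb; pose proof (Gamma_pos a Ha) as Ga.
  set (Q := fun x => Beta a x * Gamma (a + x) / (Gamma a * Gamma x)).
  assert (Step : forall x, 0 < x -> Q (x + 1) = Q x).
  { intros x Hx; unfold Q.
    replace (a + (x + 1)) with (a + x + 1) by ring.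
    rewrite !Gamma_succ by lra; pose proof (Gamma_pos x Hx).
    replace (Beta a x) with (/ x * ((a + x) * Beta a (x + 1)))
      by (rewrite Beta_succ by lra; field; lra).
    field; lra. }
  assert (Steps : forall n, Q (b + INR n) = Q b).
  { induction n as [|n IH]; [now rewrite Rplus_0_r|].
    rewrite S_INR, <- Rplus_assoc, Step, IH; [reflexivity|].
    pose proof (pos_INR n); lra. }
  assert (Low : forall x, 0 < x -> 1 - (a + 1) * (a + 1) / (x + a) <= Q x).
  { intros x Hx; unfold Q; pose proof (Gamma_pos x Hx) as Gx.
    apply Rle_trans with (Rpower (x / (x + a)) (a + 1)).
    - eapply Rle_trans; [|apply bernoulli; [apply Rdiv_lt_0_compat; lra|lra]].
      apply Rmult_le_reg_r with (x + a); [lra|]; field_simplify; [nra|lra|lra].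
    - rewrite Rpower_div by lra.
      pose proof (Beta_lower a x Ha Hx) as L1; pose proof (Gamma_ratio_lower x a Hx Ha) as L2.
      apply Rmult_le_reg_r with (Gamma a * Gamma x); [nra|].
      replace (Beta a x * Gamma (a + x) / (Gamma a * Gamma x) * (Gamma a * Gamma x))
        with (Beta a x * Gamma (x + a)) by (rewrite (Rplus_comm x a); field; lra).
      apply Rle_trans with (Gamma a * Rpower (x + a) (- a) * Gamma (x + a)).
      2:{ apply Rmult_le_compat_r; [left; apply Gamma_pos; lra|exact L1]. }
      replace (Rpower (x + a) (- a)) with ((x + a) * Rpower (x + a) (- (a + 1))).
      2:{ rewrite (Rpower_S (x + a) (- a)) by lra; do 2 f_equal; ring. }
      pose proof (Rpower_pos (x + a) (- (a + 1))) as P.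
      replace (Rpower x (a + 1) * Rpower (x + a) (- (a + 1)) * (Gamma a * Gamma x))
        with (Gamma a * Rpower (x + a) (- (a + 1)) * (Rpower x (a + 1) * Gamma x)) by ring.
      replace (Gamma a * ((x + a) * Rpower (x + a) (- (a + 1))) * Gamma (x + a))
        with (Gamma a * Rpower (x + a) (- (a + 1)) * ((x + a) * Gamma (x + a))) by ring.
      apply Rmult_le_compat_l; [nra|exact L2]. }
  assert (Up : forall x, 1 < x -> Q x * (1 - (a + 1) * (a + 1) / (x + a)) <= 1).
  { intros x Hx; pose proof (Gamma_pos x ltac:(lra)) as Gx.
    assert (Gxa : 0 < Gamma (x + a)) by (apply Gamma_pos; lra).
    assert (Qle : Q x <= Rpower ((x + a) / (x - 1)) a).
    { unfold Q; rewrite Rpower_div by lra.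
      pose proof (Beta_upper a x Ha Hx) as L1.
      pose proof (Gamma_ratio_upper x a ltac:(lra) Ha) as L2.
      apply Rmult_le_reg_r with (Gamma a * Gamma x); [nra|].
      replace (Beta a x * Gamma (a + x) / (Gamma a * Gamma x) * (Gamma a * Gamma x))
        with (Beta a x * Gamma (x + a)) by (rewrite (Rplus_comm x a); field; lra).
      apply Rle_trans with (Gamma a * Rpower (x - 1) (- a) * Gamma (x + a)).
      { apply Rmult_le_compat_r; [lra|exact L1]. }
      replace (Rpower (x + a) a * Rpower (x - 1) (- a) * (Gamma a * Gamma x))
        with (Gamma a * Rpower (x - 1) (- a) * (Rpower (x + a) a * Gamma x)) by ring.
      pose proof (Rpower_pos (x - 1) (- a)).
      apply Rmult_le_compat_l; [nra|exact L2]. }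
    assert (Bern : 1 - (a + 1) * (a + 1) / (x + a) <= Rpower ((x - 1) / (x + a)) (a + 1)).
    { eapply Rle_trans; [|apply bernoulli; [apply Rdiv_lt_0_compat; lra|lra]].
      right; field; lra. }
    assert (Mono : Rpower ((x - 1) / (x + a)) (a + 1) <= Rpower ((x - 1) / (x + a)) a).
    { rewrite (Rpower_S _ (a + 1)) by (apply Rdiv_lt_0_compat; lra).
      replace (a + 1 - 1) with a by ring.
      assert ((x - 1) / (x + a) <= 1).
      { apply Rmult_le_reg_r with (x + a); [lra|].
        replace ((x - 1) / (x + a) * (x + a)) with (x - 1) by (field; lra); lra. }
      pose proof (Rpower_pos ((x - 1) / (x + a)) a); nra. }
    assert (Inv : Rpower ((x + a) / (x - 1)) a * Rpower ((x - 1) / (x + a)) a = 1).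
    { rewrite Rpower_mult_distr by (apply Rdiv_lt_0_compat; lra).
      replace ((x + a) / (x - 1) * ((x - 1) / (x + a))) with 1 by (field; lra).
      apply Rpower_base_1. }
    assert (HQ : 0 < Q x).
    { unfold Q; apply Rdiv_lt_0_compat; [|nra].
      apply Rmult_lt_0_compat; [|rewrite Rplus_comm; exact Gxa].
      eapply Rlt_le_trans; [|apply Beta_lower; lra].
      apply Rmult_lt_0_compat; [exact Ga|apply Rpower_pos]. }
    pose proof (Rpower_pos ((x - 1) / (x + a)) a).
    apply Rle_trans with (Q x * Rpower ((x - 1) / (x + a)) a).
    - apply Rmult_le_compat_l; lra.
    - rewrite <- Inv at 2; apply Rmult_le_compat_r; lra. }
  set (c := (a + 1) * (a + 1)) in *.
  assert (Small : forall e, 0 < e -> exists n, 1 < b + INR n /\ c / (b + INR n + a) < e).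
  { intros e He; destruct (INR_unbounded (c / e + 1)) as [n Hn].
    assert (Hc : 0 < c / e) by (apply Rdiv_lt_0_compat; unfold c; nra).
    exists n; split; [lra|].
    apply Rmult_lt_reg_r with (b + INR n + a); [lra|].
    replace (c / (b + INR n + a) * (b + INR n + a)) with c by (field; lra).
    replace c with (e * (c / e)) by (field; lra).
    apply Rmult_lt_compat_l; lra. }
  assert (Q1 : Q b = 1).
  { apply Rle_antisym.
    - apply Rnot_lt_le; intros Hlt.
      destruct (Small ((Q b - 1) / Q b)) as [n [Hn Hsm]]; [apply Rdiv_lt_0_compat; lra|].
      specialize (Up _ Hn); rewrite Steps in Up.
      assert (Q b * (c / (b + INR n + a)) < Q b * ((Q b - 1) / Q b))
        by (apply Rmult_lt_compat_l; lra).
      replace (Q b * ((Q b - 1) / Q b)) with (Q b - 1) in * by (field; lra).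
      lra.
    - apply Rnot_lt_le; intros Hlt.
      destruct (Small (1 - Q b)) as [n [Hn Hsm]]; [lra|].
      specialize (Low (b + INR n) ltac:(lra)); rewrite Steps in Low; lra. }
  pose proof (Gamma_pos b Hb) as Gb.
  unfold Q in Q1.
  replace (Gamma a * Gamma b) with
    (Beta a b * Gamma (a + b) / (Gamma a * Gamma b) * (Gamma a * Gamma b)) at 1
    by (rewrite Q1; ring).
  field; lra.
Qed.

(** * Averaging a power series along the radii *)

Notation Cint01 f l := (is_RInt_gen (V := C_R_NormedModule) f (at_right 0) (at_left 1) l).

Lemma is_RInt_gen_map {V W : NormedModule R_AbsRing} {Fa Fb : (R -> Prop) -> Prop}
    {FFa : Filter Fa} {FFb : Filter Fb} (T : V -> W) (f : R -> V) (l : V) :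
  (forall a b y, is_RInt f a b y -> is_RInt (fun s => T (f s)) a b (T y)) ->
  continuous T l -> is_RInt_gen f Fa Fb l -> is_RInt_gen (fun s => T (f s)) Fa Fb (T l).
Proof.
  intros HT CT H P HP.
  pose proof (H _ (CT P HP)) as G; unfold filtermapi in G |- *.
  revert G; apply filter_imp; intros [a b] [y [Hy Py]]; exists (T y); split; [now apply HT|exact Py].
Qed.

Lemma Cint01_scal (c : C) (f : R -> C) (l : C) :
  Cint01 f l -> Cint01 (fun s => c * f s)%C (c * l)%C.
Proof.
  intros H; apply (is_RInt_gen_map (V := C_R_NormedModule) (W := C_R_NormedModule)
    (fun w : C => c * w)%C f l); [|exact (Cderive_continuous _ _ _
      (Cderive_scal c _ _ _ (Cderive_id l)))|exact H].
  intros a b y; apply is_CRInt_scal.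
Qed.

Lemma RtoC_continuous (x : R) : continuous (T := R_UniformSpace) (U := C_UniformSpace) RtoC x.
Proof.
  apply Ccontinuous_pair; split; [apply continuous_id|apply continuous_const].
Qed.

Lemma Cint01_RtoC (f : R -> R) (l : R) :
  Rint01 f l -> Cint01 (fun s => RtoC (f s)) (RtoC l).
Proof.
  intros H; apply (is_RInt_gen_map (V := R_NormedModule) (W := C_R_NormedModule) RtoC f l);
    [|apply RtoC_continuous|exact H].
  intros a b y Hy; apply is_CRInt_pair; simpl; [exact Hy|].
  pose proof (is_RInt_const (V := R_NormedModule) a b 0) as E.
  change (is_RInt (V := R_NormedModule) (fun _ => 0) a b ((b - a) * 0)) in E.
  rewrite Rmult_0_r in E; exact E.
Qed.

Lemma Cint01_fst (f : R -> C) (l : C) : Cint01 f l -> Rint01 (fun s => fst (f s)) (fst l).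
Proof.
  intros H; apply (is_RInt_gen_map (V := C_R_NormedModule) (W := R_NormedModule)
    (fun w : C => fst w) f l); [| |exact H].
  - intros a b y; apply is_CRInt_fst.
  - apply (continuous_fst (U := R_UniformSpace) (V := R_UniformSpace)).
Qed.

Lemma Cint01_plus (f g : R -> C) (l m : C) :
  Cint01 f l -> Cint01 g m -> Cint01 (fun s => f s + g s)%C (l + m)%C.
Proof. exact (is_RInt_gen_plus (V := C_R_NormedModule) f g l m). Qed.

Lemma Cint01_ext (f g : R -> C) (l : C) :
  (forall s, 0 < s < 1 -> f s = g s) -> Cint01 f l -> Cint01 g l.
Proof. apply (int01_ext (V := C_R_NormedModule)). Qed.

Lemma Cint01_eq (f : R -> C) (l l' : C) : Cint01 f l -> l = l' -> Cint01 f l'.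
Proof. now intros H <-. Qed.

Lemma Cint01_unique (f : R -> C) (l m : C) : Cint01 f l -> Cint01 f m -> l = m.
Proof. apply (int01_unique (V := C_R_CompleteNormedModule)). Qed.

Lemma is_Cseries_tail_le (u : nat -> C) (b : nat -> R) (l : C) (S : R) (n : nat) :
  (forall k, Cmod (u k) <= b k) -> is_Cseries u l -> is_series b S ->
  Cmod (l - Csum_n u n)%C <= S - sum_n b n.
Proof.
  intros H Hu Hb.
  apply (is_Cseries_norm_le (fun k => u (Datatypes.S n + k)%nat)
           (fun k => b (Datatypes.S n + k)%nat)).
  - intros k; apply H.
  - apply (is_series_incr_n (K := C_AbsRing) (V := C_NormedModule)); [lia|].
    eapply is_Cseries_eq; [exact Hu|].
    change (l = (l - Csum_n u n) + Csum_n u n)%C; ring.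
  - apply (is_series_incr_n (K := R_AbsRing) (V := R_NormedModule)); [lia|].
    change (is_series (K := R_AbsRing) (V := R_NormedModule) b (S - sum_n b n + sum_n b n)).
    replace (S - sum_n b n + sum_n b n) with S by ring; exact Hb.
Qed.

Lemma Cmod_radius_lt_1 (s : R) (z : C) : 0 <= s <= 1 -> Cmod z < 1 -> Cmod (RtoC s * z)%C < 1.
Proof.
  intros Hs Hz; rewrite Cmod_mult, Cmod_R, Rabs_pos_eq by lra.
  pose proof (Cmod_ge_0 z); nra.
Qed.

Lemma CPSeries_radius_continuous (q : nat -> C) (z : C) (s : R) :
  radius_ge 1 q -> Cmod z < 1 -> 0 <= s <= 1 ->
  Ccontinuous (fun s : R => CPSeries q (RtoC s * z)%C) s.
Proof.
  intros Hq Hz Hs.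
  apply (Ccontinuous_comp (U := R_UniformSpace) (fun s : R => RtoC s * z)%C (CPSeries q)).
  - apply (Ccontinuous_mult (U := R_UniformSpace) RtoC (fun _ => z));
      [apply RtoC_continuous|apply continuous_const].
  - eapply Cderive_continuous, (Cderive_CPSeries 1); [exact Hq|now apply Cmod_radius_lt_1].
Qed.

Section Average.

Variables (w : R -> R) (lam : nat -> R).
Hypothesis w_cont : forall s, 0 < s < 1 -> continuous w s.
Hypothesis w_pos : forall s, 0 < s < 1 -> 0 < w s.
Hypothesis w_moment : forall k, Rint01 (fun s => w s * s ^ k) (lam k).

Lemma moment_0 : Rint01 w (lam 0%nat).
Proof.
  apply (Rint01_ext (fun s => w s * s ^ 0)); [intros; simpl; ring|apply w_moment].
Qed.

Lemma moment_0_pos : 0 < lam 0%nat.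
Proof. exact (int01_gt_0 w (lam 0%nat) w_cont w_pos moment_0). Qed.

Lemma moment_bound (k : nat) : 0 <= lam k <= lam 0%nat.
Proof.
  split.
  - apply (int01_ge_0 (fun s => w s * s ^ k)); [|apply w_moment].
    intros s Hs; apply Rmult_le_pos; [left; now apply w_pos|apply pow_le; lra].
  - apply (int01_le (fun s => w s * s ^ k) w); [|apply w_moment|apply moment_0].
    intros s Hs; pose proof (w_pos s Hs).
    assert (s ^ k <= 1) by (rewrite <- (pow1 k); apply pow_incr; lra); nra.
Qed.

Definition moment_mult (q : nat -> C) (k : nat) : C := (RtoC (lam k) * q k)%C.

Lemma radius_ge_moment (q : nat -> C) :
  radius_ge 1 q -> radius_ge 1 (moment_mult q).
Proof.
  apply radius_ge_le with (K := lam 0%nat); [left; apply moment_0_pos|].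
  intros k; unfold moment_mult; rewrite Cmod_mult, Cmod_R.
  pose proof (moment_bound k); rewrite Rabs_pos_eq by lra.
  apply Rmult_le_compat_r; [apply Cmod_ge_0|lra].
Qed.

(** Termwise integration, justified by the convergence of the series uniformly along the
    radius. *)
Lemma int01_CPSeries (q : nat -> C) (z : C) :
  radius_ge 1 q -> Cmod z < 1 ->
  Cint01 (fun s => RtoC (w s) * CPSeries q (RtoC s * z))%C (CPSeries (moment_mult q) z).
Proof.
  intros Hq Hz.
  set (b := fun k => Cmod (q k) * Cmod z ^ k).
  destruct (radius_ge_abs 1 q (Cmod z) Hq) as [S HS].
  { split; [apply Cmod_ge_0|exact Hz]. }
  fold b in HS.
  assert (Hb : forall s, 0 < s < 1 -> forall k, Cmod ((RtoC s * z) ^ k * q k)%C <= b k).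
  { intros s Hs k; rewrite Cmod_mult, Cmod_pow, Cmod_mult, Cmod_R, Rabs_pos_eq by lra.
    unfold b; rewrite Rmult_comm; apply Rmult_le_compat_l; [apply Cmod_ge_0|].
    pose proof (Cmod_ge_0 z); apply pow_incr; nra. }
  assert (Cw : forall s, 0 < s < 1 ->
            Ccontinuous (fun s => RtoC (w s) * CPSeries q (RtoC s * z))%C s).
  { intros s Hs.
    apply (Ccontinuous_mult (U := R_UniformSpace) (fun s => RtoC (w s))
             (fun s => CPSeries q (RtoC s * z)%C)).
    - apply (continuous_comp (U := R_UniformSpace) (V := R_UniformSpace) w RtoC);
        [now apply w_cont|apply RtoC_continuous].
    - apply CPSeries_radius_continuous; auto; lra. }
  assert (Hsum : forall s, 0 < s < 1 ->
            is_Cseries (fun k => (RtoC s * z) ^ k * q k)%C (CPSeries q (RtoC s * z)%C)).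
  { intros s Hs; apply (CPSeries_correct 1); [exact Hq|].
    apply Cmod_radius_lt_1; [lra|exact Hz]. }
  destruct (int01_ex (V := C_R_CompleteNormedModule)
    (fun s => RtoC (w s) * CPSeries q (RtoC s * z))%C (fun s => S * w s) (S * lam 0%nat))
    as [l Hl].
  - exact Cw.
  - intros s Hs; apply (continuous_Rscal S w).
    now apply w_cont.
  - intros s Hs; eapply Rle_trans; [right; apply norm_C_R|].
    pose proof (w_pos s Hs).
    rewrite Cmod_mult, Cmod_R, Rabs_pos_eq, Rmult_comm by lra.
    apply Rmult_le_compat_r; [lra|].
    apply (is_Cseries_norm_le _ b _ _ (Hb s Hs) (Hsum s Hs) HS).
  - apply int01_scal, moment_0.
  - apply Cint01_eq with l; [exact Hl|symmetry].
    apply CPSeries_unique, is_Cpseries_series, is_Cseries_eps.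
    assert (Rem : forall n, Cint01
       (fun s => RtoC (w s) * (CPSeries q (RtoC s * z)
                 - Csum_n (fun k => (RtoC s * z) ^ k * q k) n))%C
       (l - Csum_n (fun k => z ^ k * moment_mult q k)%C n)%C).
    { assert (Term : forall k, Cint01
         (fun s => (- (z ^ k * q k)) * RtoC (w s * s ^ k))%C
         (- (z ^ k * moment_mult q k))%C).
      { intros k; apply Cint01_eq with ((- (z ^ k * q k)) * RtoC (lam k))%C;
          [|unfold moment_mult; ring].
        apply Cint01_scal, Cint01_RtoC, w_moment. }
      induction n as [|n IH].
      - rewrite sum_O.
        apply (Cint01_ext _ _ _) with (2 := Cint01_plus _ _ _ _ Hl (Term 0%nat)).
        intros s _; rewrite sum_O, RtoC_mult; simpl; ring.
      - apply Cint01_eq with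
          ((l - Csum_n (fun k => z ^ k * moment_mult q k)%C n)
           + - (z ^ Datatypes.S n * moment_mult q (Datatypes.S n)))%C;
          [|rewrite Csum_n_S; ring].
        apply (Cint01_ext _ _ _) with (2 := Cint01_plus _ _ _ _ IH (Term (Datatypes.S n))).
        intros s _; rewrite Csum_n_S, RtoC_mult, RtoC_pow, Cpow_mult_l; ring. }
    intros eps Heps.
    assert (Hlim : exists N, forall n, (N <= n)%nat -> S - sum_n b n < eps / lam 0%nat).
    { pose proof moment_0_pos.
      assert (He : 0 < eps / lam 0%nat) by now apply Rdiv_lt_0_compat.
      generalize (proj1 (filterlim_locally _ _) HS (mkposreal _ He)).
      intros [N HN]; exists N; intros n Hn; specialize (HN n Hn).
      change (Rabs (sum_n b n - S) < eps / lam 0%nat) in HN.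
      apply Rabs_def2 in HN; lra. }
    destruct Hlim as [N HN]; exists N; intros n Hn; rewrite Cmod_minus_sym.
    apply Rle_lt_trans with ((S - sum_n b n) * lam 0%nat).
    + rewrite <- norm_C_R.
      apply (int01_norm_le (V := C_R_CompleteNormedModule)) with
        (2 := Rem n) (3 := int01_scal (S - sum_n b n) _ _ moment_0).
      intros s Hs.
      eapply Rle_trans; [right; apply norm_C_R|].
      pose proof (w_pos s Hs).
      rewrite Cmod_mult, Cmod_R, Rabs_pos_eq, Rmult_comm by lra.
      apply Rmult_le_compat_r; [lra|].
      exact (is_Cseries_tail_le _ b _ _ n (Hb s Hs) (Hsum s Hs) HS).
    + pose proof moment_0_pos; specialize (HN n Hn).
      apply Rmult_lt_compat_r with (r := lam 0%nat) in HN; [|lra].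
      replace (eps / lam 0%nat * lam 0%nat) with eps in HN by (field; lra); exact HN.
Qed.

(** The real part has a minimum on the closed radius, and this minimum exceeds [beta];
    averaging therefore keeps the inequality strict. *)
Lemma re_average (q : nat -> C) (beta : R) :
  radius_ge 1 q -> (forall z, Cmod z < 1 -> beta < fst (CPSeries q z)) ->
  forall z, Cmod z < 1 -> beta * lam 0%nat < fst (CPSeries (moment_mult q) z).
Proof.
  intros Hq Hre z Hz.
  destruct (continuity_ab_min (fun s => fst (CPSeries q (RtoC s * z)%C)) 0 1)
    as [s0 [Hmin Hs0]]; [lra| |].
  { intros s Hs; apply continuity_pt_filterlim.
    apply (Ccontinuous_fst (fun s => CPSeries q (RtoC s * z)%C) s).
    now apply CPSeries_radius_continuous. }
  set (m := fst (CPSeries q (RtoC s0 * z)%C)) in *.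
  assert (Hm : beta < m) by (apply Hre, Cmod_radius_lt_1; assumption).
  apply Rlt_le_trans with (m * lam 0%nat).
  - apply Rmult_lt_compat_r; [apply moment_0_pos|exact Hm].
  - apply (int01_le (fun s => m * w s)
      (fun s => fst (RtoC (w s) * CPSeries q (RtoC s * z))%C)).
    + intros s Hs; simpl; pose proof (w_pos s Hs).
      specialize (Hmin s ltac:(lra)); simpl in Hmin; nra.
    + apply int01_scal, moment_0.
    + apply Cint01_fst; now apply int01_CPSeries.
Qed.

End Average.

(** * The Salagean operator on powers *)

(** If [f^alpha = z^alpha * sum p_k z^k] then
    [D^n f^alpha = alpha^n z^alpha * sum (euler_coeff alpha n p)_k z^k]. *)
Definition euler_coeff (alpha : R) (n : nat) (p : nat -> C) (k : nat) : C :=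
  (RtoC (((alpha + INR k) / alpha) ^ n) * p k)%C.

Lemma euler_coeff_0 (alpha : R) (p : nat -> C) (k : nat) : euler_coeff alpha 0 p k = p k.
Proof. unfold euler_coeff; simpl; ring. Qed.

Lemma euler_coeff_S (alpha : R) (n : nat) (p : nat -> C) (k : nat) :
  euler_coeff alpha (S n) p k = (RtoC ((alpha + INR k) / alpha) * euler_coeff alpha n p k)%C.
Proof. unfold euler_coeff; simpl; rewrite RtoC_mult; ring. Qed.

Lemma radius_ge_euler (alpha : R) (n : nat) (p : nat -> C) :
  0 < alpha -> radius_ge 1 p -> radius_ge 1 (euler_coeff alpha n p).
Proof.
  intros Ha Hp; induction n as [|n IH].
  - apply radius_ge_le with (K := 1) (a := p); [lra| |exact Hp].
    intros k; rewrite euler_coeff_0; lra.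
  - apply radius_ge_linear with (K := 1 + / alpha) (a := euler_coeff alpha n p);
      [|intros k|exact IH].
    + pose proof (Rinv_0_lt_compat _ Ha); lra.
    + pose proof (pos_INR k) as Hk; pose proof (Rinv_0_lt_compat _ Ha) as Hi.
      rewrite euler_coeff_S, Cmod_mult, Cmod_R, Rabs_pos_eq.
      2:{ apply Rmult_le_pos; lra. }
      apply Rmult_le_compat_r; [apply Cmod_ge_0|].
      rewrite S_INR; replace ((alpha + INR k) / alpha) with (1 + / alpha * INR k)
        by (field; lra); nra.
Qed.

Lemma CPSeries_euler_S (alpha : R) (n : nat) (p : nat -> C) (z : C) :
  0 < alpha -> radius_ge 1 p -> Cmod z < 1 ->
  CPSeries (euler_coeff alpha (S n) p) z =
  (CPSeries (euler_coeff alpha n p) z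
   + / RtoC alpha * (z * CPSeries (PSderive (euler_coeff alpha n p)) z))%C.
Proof.
  intros Ha Hp Hz.
  assert (Hac : RtoC alpha <> RtoC 0) by (apply RtoC_neq_0; lra).
  pose proof (radius_ge_euler alpha n p Ha Hp) as He.
  apply CPSeries_unique, is_Cpseries_series.
  eapply is_Cseries_ext; [|apply is_Cseries_plus;
    [apply (CPSeries_correct 1 _ z He Hz)
    |apply is_Cseries_scal, (CPSeries_euler_terms 1 _ z He Hz)]].
  intros k; cbv beta; rewrite euler_coeff_S, RtoC_div, RtoC_plus by lra.
  field; exact Hac.
Qed.

Lemma power_int_moment (alpha : R) (k : nat) :
  0 < alpha ->
  Rint01 (fun s => alpha * Rpower s (alpha - 1) * s ^ k) (alpha / (alpha + INR k)).
Proof.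
  intros Ha; pose proof (pos_INR k).
  apply (Rint01_ext (fun s => alpha * Rpower s (alpha + INR k - 1))).
  - intros s Hs; rewrite <- (Rpower_pow k s) by lra.
    rewrite Rmult_assoc, <- Rpower_plus; do 2 f_equal; ring.
  - apply int01_scal, int01_power; lra.
Qed.

(** Integration along the radii against [alpha s^(alpha - 1)] inverts one application of
    the operator, whence [T_n] is contained in [T_0]. *)
Lemma re_euler_decrease (alpha beta : R) (n : nat) (p : nat -> C) :
  0 < alpha -> radius_ge 1 p ->
  (forall z, Cmod z < 1 -> beta < fst (CPSeries (euler_coeff alpha n p) z)) ->
  forall z, Cmod z < 1 -> beta < fst (CPSeries p z).
Proof.
  intros Ha Hp; induction n as [|n IH]; intros H z Hz.
  - rewrite <- (CPSeries_ext 1 p (euler_coeff alpha 0 p) z Hp Hz (euler_coeff_0 alpha p)).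
    now apply H.
  - apply IH; [|exact Hz]; clear z Hz; intros z Hz.
    pose proof (radius_ge_euler alpha n p Ha Hp) as He.
    set (lam := fun k => alpha / (alpha + INR k)).
    replace beta with (beta * lam 0%nat) by (unfold lam; simpl; field; lra).
    set (w := fun s => alpha * Rpower s (alpha - 1)).
    assert (w_cont : forall s, 0 < s < 1 -> continuous w s).
    { intros s Hs; apply (continuous_Rscal alpha
        (fun s => Rpower s (alpha - 1))), Rpower_continuous; lra. }
    assert (w_pos : forall s, 0 < s < 1 -> 0 < w s).
    { intros s Hs; apply Rmult_lt_0_compat; [exact Ha|apply Rpower_pos]. }
    pose proof (fun k => power_int_moment alpha k Ha) as w_moment.
    pose proof (radius_ge_euler alpha (S n) p Ha Hp) as He'.
    rewrite (CPSeries_ext 1 (moment_mult lam (euler_coeff alpha (S n) p))).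
    + now apply (re_average w).
    + now apply (radius_ge_moment w lam).
    + exact Hz.
    + intros k; unfold moment_mult; rewrite euler_coeff_S, Cmult_assoc, <- RtoC_mult.
      pose proof (pos_INR k); unfold lam.
      replace (alpha / (alpha + INR k) * ((alpha + INR k) / alpha)) with 1 by (field; lra).
      ring.
Qed.

Lemma Cpow_real_scal (x : R) (z : C) (a : R) :
  0 < x -> z <> RtoC 0 -> Defs.Cpow (RtoC x * z)%C a = (RtoC (Rpower x a) * Defs.Cpow z a)%C.
Proof.
  intros Hx Hz; unfold Defs.Cpow; rewrite Clog_scal by assumption.
  replace (RtoC a * (RtoC (ln x) + Clog z))%C with (RtoC (a * ln x) + RtoC a * Clog z)%C
    by (rewrite RtoC_mult; ring).
  now rewrite Cexp_plus, Cexp_RtoC.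
Qed.

Lemma Cpow_real_RtoC (x a : R) : 0 < x -> Defs.Cpow (RtoC x) a = RtoC (Rpower x a).
Proof.
  intros Hx; unfold Defs.Cpow; rewrite Clog_RtoC, <- RtoC_mult by exact Hx; apply Cexp_RtoC.
Qed.

Lemma Cpow_real_plus (z : C) (a b : R) : Defs.Cpow z (a + b) = (Defs.Cpow z a * Defs.Cpow z b)%C.
Proof. unfold Defs.Cpow; rewrite <- Cexp_plus; f_equal; rewrite RtoC_plus; ring. Qed.

Lemma Cpow_real_neq_0 (z : C) (a : R) : Defs.Cpow z a <> RtoC 0.
Proof. apply Cexp_neq_0. Qed.

Lemma Cpow_real_1 (z : C) : z <> RtoC 0 -> Defs.Cpow z 1 = z.
Proof. intros Hz; unfold Defs.Cpow; rewrite Cmult_1_l; now apply Cexp_Clog. Qed.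

Lemma Cpow_real_minus_1 (z : C) (a : R) : z <> RtoC 0 -> (Defs.Cpow z (a - 1) * z)%C = Defs.Cpow z a.
Proof.
  intros Hz; rewrite <- (Cpow_real_1 z) at 2 by exact Hz; rewrite <- Cpow_real_plus; f_equal; ring.
Qed.

(** Near [z0] the quotient [t / z0] stays in the half plane where [Clog] is holomorphic,
    so the branch of [t^alpha] used by [power_near] has the derivative
    [alpha t^alpha / t], and each application of the operator is a product rule. *)
Lemma salagean_power_near (alpha : R) (L : C -> C) (p : nat -> C) (z0 : C) :
  0 < alpha -> radius_ge 1 p -> Cmod z0 < 1 -> z0 <> RtoC 0 ->
  (forall z, Cmod z < 1 -> Cexp (RtoC alpha * L z)%C = CPSeries p z) ->
  forall m t, Cmod (t - z0)%C < Rmin (Cmod z0) (1 - Cmod z0) ->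
    salagean m (power_near alpha L z0) t =
    (RtoC (alpha ^ m) * (Cexp (RtoC alpha * (Clog z0 + Clog (t / z0)))
                         * CPSeries (euler_coeff alpha m p) t))%C.
Proof.
  intros Ha Hp Hz1 Hz0 HL.
  assert (Hac : RtoC alpha <> RtoC 0) by (apply RtoC_neq_0; lra).
  pose proof (proj1 (Cmod_gt_0 z0) Hz0) as P0.
  set (d := Rmin (Cmod z0) (1 - Cmod z0)).
  assert (Dom : forall t, Cmod (t - z0)%C < d ->
            Cmod t < 1 /\ t <> RtoC 0 /\ 0 < fst (t / z0)%C).
  { intros t Ht.
    assert (H1 := Rlt_le_trans _ _ _ Ht (Rmin_l _ _)).
    assert (H2 := Rlt_le_trans _ _ _ Ht (Rmin_r _ _)).
    assert (Hre : 0 < fst (t / z0)%C).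
    { assert (B : Cmod (t / z0 - RtoC 1)%C < 1).
      { replace (t / z0 - RtoC 1)%C with ((t - z0) / z0)%C by (field; exact Hz0).
        rewrite Cmod_div by exact Hz0.
        apply Rmult_lt_reg_r with (Cmod z0); [exact P0|].
        replace (Cmod (t - z0)%C / Cmod z0 * Cmod z0) with (Cmod (t - z0)%C) by (field; lra).
        lra. }
      pose proof (fst_le_Cmod (t / z0 - RtoC 1)%C) as F.
      change (fst (t / z0 - RtoC 1)%C) with (fst (t / z0)%C + - (1)) in F.
      assert (F' : Rabs (fst (t / z0)%C + - (1)) < 1) by lra.
      apply Rabs_def2 in F'; lra. }
    split; [|split; [|exact Hre]].
    - pose proof (Cmod_triangle_inv t z0); lra.
    - intros E; rewrite E in Hre; unfold Cdiv in Hre; rewrite Cmult_0_l in Hre.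
      simpl in Hre; lra. }
  set (E := fun t => Cexp (RtoC alpha * (Clog z0 + Clog (t / z0)))%C).
  assert (DE : forall t, Cmod (t - z0)%C < d -> is_Cderive E t (RtoC alpha / t * E t)%C).
  { intros t Ht; destruct (Dom t Ht) as [Ht1 [Ht0 Hre]].
    eapply Cderive_eq.
    - apply (Cderive_comp Cexp (fun t => RtoC alpha * (Clog z0 + Clog (t / z0)))%C);
        [apply Cderive_Cexp|].
      apply Cderive_scal, Cderive_plus; [apply Cderive_const|].
      apply (Cderive_comp Clog (fun t => t / z0)%C); [now apply Cderive_Clog|].
      apply Cderive_mult; [apply Cderive_id|apply Cderive_const].
    - unfold E; cbv beta; field; split; assumption. }
  induction m as [|m IH]; intros t Ht.
  - destruct (Dom t Ht) as [Ht1 [Ht0 Hre]]; simpl; unfold power_near.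
    replace (RtoC alpha * (Clog z0 + Clog (t / z0) + L t))%C
      with (RtoC alpha * (Clog z0 + Clog (t / z0)) + RtoC alpha * L t)%C by ring.
    rewrite Cexp_plus, HL by exact Ht1.
    rewrite (CPSeries_ext 1 p (euler_coeff alpha 0 p) t Hp Ht1 (euler_coeff_0 alpha p)).
    ring.
  - destruct (Dom t Ht) as [Ht1 [Ht0 Hre]].
    pose proof (radius_ge_euler alpha m p Ha Hp) as He.
    set (Q := CPSeries (euler_coeff alpha m p)) in *.
    set (Q' := CPSeries (PSderive (euler_coeff alpha m p))).
    assert (D : is_Cderive (salagean m (power_near alpha L z0)) t
              (RtoC (alpha ^ m) * (RtoC alpha / t * E t * Q t + E t * Q' t))%C).
    { apply Cderive_ext_loc with (f := fun t => (RtoC (alpha ^ m) * (E t * Q t))%C)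
        (d := d - Cmod (t - z0)%C); [lra| |].
      - intros y Hy; symmetry; apply IH.
        replace (y - z0)%C with ((y - t) + (t - z0))%C by ring.
        pose proof (Cmod_triangle (y - t)%C (t - z0)%C); lra.
      - apply Cderive_scal, Cderive_mult; [now apply DE|].
        now apply (Cderive_CPSeries 1). }
    cbn [salagean]; rewrite (is_C_derive_unique _ _ _ D).
    rewrite CPSeries_euler_S by assumption; fold Q Q'.
    change (alpha ^ S m) with (alpha * alpha ^ m); rewrite RtoC_mult; fold (E t).
    field; split; assumption.
Qed.

Lemma salagean_quotient (alpha : R) (n : nat) (L : C -> C) (p : nat -> C) (z : C) :
  0 < alpha -> radius_ge 1 p -> Cmod z < 1 -> z <> RtoC 0 ->
  (forall z, Cmod z < 1 -> Cexp (RtoC alpha * L z)%C = CPSeries p z) ->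
  (salagean n (power_near alpha L z) z / (RtoC (alpha ^ n) * Defs.Cpow z alpha))%C
  = CPSeries (euler_coeff alpha n p) z.
Proof.
  intros Ha Hp Hz Hz0 HL.
  assert (P0 := proj1 (Cmod_gt_0 z) Hz0).
  rewrite (salagean_power_near alpha L p z Ha Hp Hz Hz0 HL).
  2:{ replace (z - z)%C with (RtoC 0) by ring; rewrite Cmod_0; apply Rmin_pos; lra. }
  replace (z / z)%C with (RtoC 1) by (field; exact Hz0).
  rewrite Clog_RtoC, ln_1 by lra.
  replace (Clog z + RtoC 0)%C with (Clog z) by ring; fold (Defs.Cpow z alpha).
  assert (Hn : RtoC (alpha ^ n) <> RtoC 0).
  { intros E; apply RtoC_inj in E; revert E; apply pow_nonzero; lra. }
  pose proof (Cpow_real_neq_0 z alpha); field; split; assumption.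
Qed.

(** * Logarithms of [f(z)/z] *)

Lemma Cexp_real_1 (z : C) : snd z = 0 -> Cexp z = RtoC 1 -> z = RtoC 0.
Proof.
  intros H E; assert (F := f_equal fst E); unfold Cexp in F; simpl in F.
  rewrite H, cos_0, Rmult_1_r in F.
  apply C_eq; [|exact H]; simpl.
  rewrite <- (ln_exp (fst z)), F; apply ln_1.
Qed.

Lemma zero_Cderive_const (g : C -> C) :
  (forall z, Cmod z < 1 -> is_Cderive g z (RtoC 0)) ->
  forall z, Cmod z < 1 -> g z = g (RtoC 0).
Proof.
  intros H z Hz.
  assert (D : forall t, 0 <= t <= 1 ->
            is_Rderive (fun t => g (RtoC 0 + z * RtoC t)%C) t (RtoC 0)).
  { intros t Ht; eapply Rderive_eq.
    - apply (Rderive_comp g (fun t => RtoC 0 + z * RtoC t)%C); [|apply Rderive_affine].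
      apply H; replace (RtoC 0 + z * RtoC t)%C with (RtoC t * z)%C by ring.
      now apply Cmod_radius_lt_1.
    - ring. }
  replace z with (RtoC 0 + z * RtoC 1)%C at 1 by ring.
  replace (RtoC 0) with (RtoC 0 + z * RtoC 0)%C at 2 by ring.
  apply C_eq.
  - apply (zero_derive_const (fun t => fst (g (RtoC 0 + z * RtoC t)%C))); intros t Ht;
      [|exists 0]; refine (Rderive_fst _ _ _ (D t _)); lra.
  - apply (zero_derive_const (fun t => snd (g (RtoC 0 + z * RtoC t)%C))); intros t Ht;
      [|exists 0]; refine (Rderive_snd _ _ _ (D t _)); lra.
Qed.

(** The exponential of the difference of two branches is [1], so the difference is
    constant, and it vanishes at [0] where both branches are real. *)
Lemma log_ratio_unique (f L1 L2 : C -> C) :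
  log_ratio f L1 -> log_ratio f L2 -> forall z, Cmod z < 1 -> L1 z = L2 z.
Proof.
  intros [D1 [R1 E1]] [D2 [R2 E2]].
  set (g := fun z => (L1 z + RtoC (-1) * L2 z)%C).
  assert (Dg : forall z, Cmod z < 1 -> exists l : C, is_Cderive g z l).
  { intros z Hz.
    destruct (D1 z Hz : exists l : C, is_Cderive L1 z l) as [l1 H1].
    destruct (D2 z Hz : exists l : C, is_Cderive L2 z l) as [l2 H2].
    exists (l1 + RtoC (-1) * l2)%C.
    apply Cderive_plus; [exact H1|now apply Cderive_scal]. }
  assert (Eg0 : forall z, z <> RtoC 0 -> Cmod z < 1 -> Cexp (g z) = RtoC 1).
  { intros z Hz0 Hz; unfold g; rewrite Cexp_plus.
    assert (E : Cexp (L1 z) = Cexp (L2 z)).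
    { pose proof (E1 z Hz) as F1; rewrite (E2 z Hz) in F1.
      replace (Cexp (L1 z)) with (/ z * (z * Cexp (L1 z)))%C by (field; exact Hz0).
      rewrite <- F1; field; exact Hz0. }
    rewrite E, <- Cexp_plus, <- Cexp_0; f_equal; ring. }
  assert (Cg : forall z, Cmod z < 1 ->
            CCcontinuous (fun z => Cexp (g z)) z).
  { intros z Hz; destruct (Dg z Hz) as [l Hl].
    apply (Ccontinuous_comp g Cexp).
    - eapply Cderive_continuous, Hl.
    - eapply Cderive_continuous, Cderive_Cexp. }
  assert (Z0 : Cmod (RtoC 0) < 1) by (rewrite Cmod_0; lra).
  assert (Eg : forall z, Cmod z < 1 -> Cexp (g z) = RtoC 1).
  { apply (Ccontinuous_eq_punctured 1 (fun z => Cexp (g z)) (fun _ => RtoC 1)); [lra| | |].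
    - now apply Cg.
    - apply continuous_const.
    - exact Eg0. }
  assert (Dg0 : forall z, Cmod z < 1 -> is_Cderive g z (RtoC 0)).
  { intros z Hz; destruct (Dg z Hz) as [l Hl]; apply Cderive_eq with l; [exact Hl|].
    assert (H1 : is_Cderive (fun z => Cexp (g z)) z (l * Cexp (g z))%C).
    { apply (Cderive_comp Cexp g); [apply Cderive_Cexp|exact Hl]. }
    assert (H2 : is_Cderive (fun z => Cexp (g z)) z (RtoC 0)).
    { apply Cderive_ext_loc with (f := fun _ => RtoC 1) (d := 1 - Cmod z); [lra| |].
      - intros y Hy; symmetry; apply Eg; pose proof (Cmod_triangle_inv y z); lra.
      - apply Cderive_const. }
    pose proof (Cderive_unique _ _ _ _ H1 H2) as E.
    rewrite Eg, Cmult_1_r in E by exact Hz; exact E. }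
  assert (G0 : g (RtoC 0) = RtoC 0).
  { apply Cexp_real_1; [|now apply Eg].
    unfold g; simpl; rewrite R1, R2; ring. }
  intros z Hz; pose proof (zero_Cderive_const g Dg0 z Hz) as E; rewrite G0 in E.
  unfold g in E; replace (L1 z) with (L1 z + RtoC (-1) * L2 z + L2 z)%C by ring.
  rewrite E; ring.
Qed.

(** * The class read off power series *)

Lemma class_A_log_ratio (f L : C -> C) :
  class_A f -> log_ratio f L ->
  L (RtoC 0) = RtoC 0 /\
  exists b, radius_ge 1 b /\ forall z, Cmod z < 1 -> Cexp (L z) = CPSeries b z.
Proof.
  intros [a [a0 [a1 Hf]]] [DL [RL EL]].
  assert (Ha : radius_ge 1 a).
  { apply radius_ge_of_conv; intros z Hz; exists (f z); now apply Hf. }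
  pose proof (radius_ge_shift 1 a Ha) as Hb.
  assert (Z0 : Cmod (RtoC 0) < 1) by (rewrite Cmod_0; lra).
  assert (E : forall z, Cmod z < 1 -> Cexp (L z) = CPSeries (PSshift a) z).
  { assert (E0 : forall z, z <> RtoC 0 -> Cmod z < 1 -> Cexp (L z) = CPSeries (PSshift a) z).
    { intros z Hz0 Hz; pose proof (EL z Hz) as F.
      rewrite <- (CPSeries_unique _ _ _ (Hf z Hz)), (CPSeries_shift 1 a z Ha Hz), a0 in F.
      replace (Cexp (L z)) with (/ z * (z * Cexp (L z)))%C by (field; exact Hz0).
      rewrite <- F; field; exact Hz0. }
    apply (Ccontinuous_eq_punctured 1 (fun z => Cexp (L z)) (CPSeries (PSshift a))); [lra| | |].
    - destruct (DL (RtoC 0) Z0 : exists l : C, is_Cderive L (RtoC 0) l) as [l Hl].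
      apply (Ccontinuous_comp L Cexp).
      + eapply Cderive_continuous, Hl.
      + eapply Cderive_continuous, Cderive_Cexp.
    - eapply Cderive_continuous, (Cderive_CPSeries 1); assumption.
    - exact E0. }
  split; [|exists (PSshift a); split; assumption].
  apply Cexp_real_1; [exact RL|].
  rewrite E, CPSeries_0 by exact Z0; exact a1.
Qed.

(** The series does not depend on the branch [L], by [log_ratio_unique].  At [z = 0],
    where the quotient defining the class is undefined, its series has the value
    [1 > beta]. *)
Lemma class_T_series (n : nat) (alpha beta : R) (f : C -> C) :
  0 < alpha -> beta < 1 -> class_T n alpha beta f ->
  exists p, radius_ge 1 p /\ p 0%nat = RtoC 1 /\
    (forall L, log_ratio f L ->
       forall z, Cmod z < 1 -> Cexp (RtoC alpha * L z)%C = CPSeries p z) /\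
    (forall z, Cmod z < 1 -> beta < fst (CPSeries (euler_coeff alpha n p) z)).
Proof.
  intros Ha Hb [HA [L [HL HT]]].
  destruct (class_A_log_ratio f L HA HL) as [L0 [b [Hbr Eb]]].
  destruct (exp_branch_CPSeries L 1 alpha b) as [p [Hp Ep]].
  - lra.
  - apply HL.
  - exact Hbr.
  - intros z Hz; rewrite Cmult_1_l; now apply Eb.
  - assert (Z0 : Cmod (RtoC 0) < 1) by (rewrite Cmod_0; lra).
    assert (P0 : p 0%nat = RtoC 1).
    { rewrite <- (CPSeries_0 p), Ep, L0, Cmult_0_r by exact Z0; apply Cexp_0. }
    exists p; split; [exact Hp|split; [exact P0|split]].
    + intros L' HL' z Hz; rewrite Ep by exact Hz.
      now rewrite (log_ratio_unique f L L' HL HL' z Hz).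
    + intros z Hz; destruct (Ceq_dec z (RtoC 0)) as [->|Hz0].
      * rewrite CPSeries_0; unfold euler_coeff; rewrite P0; simpl INR.
        replace ((alpha + 0) / alpha) with 1 by (field; lra); rewrite pow1; simpl; lra.
      * rewrite <- (salagean_quotient alpha n L p z); auto.
        intros y Hy; symmetry; now apply Ep.
Qed.

Lemma class_T_ext (n : nat) (alpha beta : R) (f g : C -> C) :
  (forall z, f z = g z) -> class_T n alpha beta f -> class_T n alpha beta g.
Proof.
  intros E [[a [a0 [a1 Hf]]] [L [[DL [RL EL]] HT]]]; split.
  - exists a; split; [exact a0|split; [exact a1|]].
    intros z Hz; rewrite <- E; now apply Hf.
  - exists L; split; [split; [exact DL|split; [exact RL|]]|exact HT].
    intros z Hz; rewrite <- E; now apply EL.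
Qed.

(** Conversely, the class is recognised on the series [B] of [(phi(z)/z)^alpha]; dividing
    [phi] by [phi'(0)] divides [B] by [B 0]. *)
Lemma class_T_of_series (n : nat) (alpha beta : R) (phi L : C -> C) (B : nat -> C) :
  0 < alpha -> log_ratio phi L -> radius_ge 1 B ->
  (forall z, Cmod z < 1 -> Cexp (RtoC alpha * L z)%C = CPSeries B z) ->
  (forall z, Cmod z < 1 -> beta * fst (B 0%nat) < fst (CPSeries (euler_coeff alpha n B) z)) ->
  class_T n alpha beta (normalize phi) /\
  (B 0%nat = RtoC 1 -> class_T n alpha beta phi).
Proof.
  intros Ha HLog HB EB HRe; pose proof HLog as [DL [RL EL]].
  assert (Hac : RtoC alpha <> RtoC 0) by (apply RtoC_neq_0; lra).
  assert (Z0 : Cmod (RtoC 0) < 1) by (rewrite Cmod_0; lra).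
  destruct (exp_branch_CPSeries L alpha 1 B ltac:(lra) DL HB EB) as [b [Hb Eb]].
  assert (Eb' : forall z, Cmod z < 1 -> CPSeries b z = Cexp (L z)).
  { intros z Hz; rewrite Eb, Cmult_1_l by exact Hz; reflexivity. }
  set (kappa := Cexp (L (RtoC 0))).
  assert (Hk : kappa <> RtoC 0) by apply Cexp_neq_0.
  assert (b0 : b 0%nat = kappa) by (rewrite <- (CPSeries_0 b); now apply Eb').
  assert (HL0 : L (RtoC 0) = RtoC (fst (L (RtoC 0)))) by (apply C_eq; [reflexivity|exact RL]).
  set (B0 := exp (alpha * fst (L (RtoC 0)))).
  assert (HB0 : B 0%nat = RtoC B0).
  { rewrite <- (CPSeries_0 B), <- EB, HL0, <- RtoC_mult by exact Z0; apply Cexp_RtoC. }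
  assert (PB0 : 0 < B0) by apply exp_pos.
  assert (HB0c : RtoC B0 <> RtoC 0) by (apply RtoC_neq_0; lra).
  assert (Dphi : C_derive phi (RtoC 0) = kappa).
  { apply is_C_derive_unique.
    apply Cderive_ext_loc with (f := fun z => (z * CPSeries b z)%C) (d := 1); [lra| |].
    - intros z Hz; replace (z - RtoC 0)%C with z in Hz by ring.
      rewrite EL, Eb' by exact Hz; reflexivity.
    - eapply Cderive_eq.
      + apply Cderive_mult; [apply Cderive_id|now apply (Cderive_CPSeries 1)].
      + rewrite CPSeries_0, b0; ring. }
  assert (Enorm : forall z, normalize phi z = (phi z / kappa)%C).
  { intros z; unfold normalize; now rewrite Dphi. }
  assert (Hnorm : class_T n alpha beta (normalize phi)).
  { split.
    - exists (fun k => match k with O => RtoC 0 | S j => / kappa * b j end)%C.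
      split; [reflexivity|split; [rewrite b0; field; exact Hk|]].
      intros z Hz; apply is_Cpseries_series.
      eapply is_Cseries_eq.
      + apply is_Cseries_shift.
        eapply is_Cseries_ext; [|apply (is_Cseries_scal (z / kappa)%C),
          (CPSeries_correct 1 b z Hb Hz)].
        intros k; cbn [Complex.Cpow]; field; exact Hk.
      + rewrite Enorm, EL, Eb' by exact Hz; simpl; field; exact Hk.
    - set (L' := fun z => (L z + (- L (RtoC 0)))%C).
      assert (HL' : log_ratio (normalize phi) L').
      { split; [|split].
        - intros z Hz; destruct (DL z Hz : exists l : C, is_Cderive L z l) as [l Hl].
          exists (l + RtoC 0)%C; apply Cderive_plus; [exact Hl|apply Cderive_const].
        - unfold L'; replace (L (RtoC 0) + - L (RtoC 0))%C with (RtoC 0) by ring; reflexivity.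
        - intros z Hz; rewrite Enorm, EL by exact Hz.
          unfold L'; rewrite Cexp_plus.
          replace (Cexp (- L (RtoC 0))%C) with (/ kappa)%C; [unfold Cdiv; ring|].
          assert (Ee : (kappa * Cexp (- L (RtoC 0)))%C = RtoC 1).
          { unfold kappa; rewrite <- Cexp_plus, <- Cexp_0; f_equal; ring. }
          replace (/ kappa)%C with (/ kappa * (kappa * Cexp (- L (RtoC 0))))%C
            by (rewrite Ee; ring).
          field; exact Hk. }
      exists L'; split; [exact HL'|]; intros z Hz Hz0.
      set (B' := fun k => (RtoC (/ B0) * B k)%C).
      assert (HB' : radius_ge 1 B').
      { apply radius_ge_le with (K := Cmod (RtoC (/ B0))) (a := B);
          [apply Cmod_ge_0| |exact HB].
        intros k; unfold B'; rewrite Cmod_mult; lra. }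
      rewrite (salagean_quotient alpha n L' B' z Ha HB' Hz Hz0).
      + rewrite (CPSeries_ext 1 (fun k => RtoC (/ B0) * euler_coeff alpha n B k)%C).
        * rewrite (CPSeries_scal 1) by (try exact Hz; now apply radius_ge_euler).
          specialize (HRe z Hz); rewrite HB0 in HRe.
          change (fst (RtoC B0)) with B0 in HRe.
          set (X := CPSeries (euler_coeff alpha n B) z) in *.
          replace (fst (RtoC (/ B0) * X)%C) with (/ B0 * fst X) by (simpl; ring).
          apply Rmult_lt_reg_l with B0; [exact PB0|].
          replace (B0 * (/ B0 * fst X)) with (fst X) by (field; lra); lra.
        * apply radius_ge_le with (K := Cmod (RtoC (/ B0)))
            (a := euler_coeff alpha n B); [apply Cmod_ge_0| |now apply radius_ge_euler].
          intros k; rewrite Cmod_mult; lra.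
        * exact Hz.
        * intros k; unfold B', euler_coeff; ring.
      + intros y Hy; unfold B'; rewrite (CPSeries_scal 1 _ B y HB Hy), <- EB by exact Hy.
        unfold L'; replace (RtoC alpha * (L y + - L (RtoC 0)))%C
          with (RtoC alpha * L y + RtoC (- (alpha * fst (L (RtoC 0)))))%C.
        * rewrite Cexp_plus, Cexp_RtoC, exp_Ropp; fold B0; ring.
        * rewrite HL0 at 2; rewrite RtoC_opp, RtoC_mult; ring. }
  split; [exact Hnorm|]; intros H1.
  apply class_T_ext with (normalize phi); [|exact Hnorm].
  intros z; rewrite Enorm.
  assert (HB01 : B0 = 1) by (rewrite HB0 in H1; now apply RtoC_inj).
  assert (Hf : fst (L (RtoC 0)) = 0).
  { apply Rmult_eq_reg_l with alpha; [rewrite Rmult_0_r|lra].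
    rewrite <- (ln_exp (alpha * _)); fold B0; rewrite HB01; apply ln_1. }
  unfold kappa; rewrite HL0, Hf, Cexp_0; field; apply C1_nz.
Qed.

(** * Integral transforms with a positive weight *)

(** The common shape of the three operators: [g F z] is the integrand over the segment from
    [0] to [z], where [F] is the power of [f], and [pref z] the factor before the
    integral. *)
Definition is_transform (pref : C -> C) (g : (C -> C) -> C -> C -> C) (alpha : R)
    (f phi : C -> C) : Prop :=
  exists F Phi : C -> C, is_power alpha f F /\ is_power alpha phi Phi /\
    forall z : C, unit_disk z -> z <> RtoC 0 ->
      exists I : C, is_segment_integral (g F z) z I /\ Phi z = (pref z * I)%C.

Section Transform.

Variables (alpha beta : R) (n : nat) (f : C -> C).
Hypothesis alpha_pos : 0 < alpha.
Hypothesis beta_ge0 : 0 <= beta.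
Hypothesis beta_lt1 : beta < 1.
Hypothesis f_in_T : class_T n alpha beta f.

Variables (w : R -> R) (lam : nat -> R) (kappa : R).
Hypothesis w_cont : forall s, 0 < s < 1 -> continuous w s.
Hypothesis w_pos : forall s, 0 < s < 1 -> 0 < w s.
Hypothesis w_moment : forall k, Rint01 (fun s => w s * s ^ k) (lam k).
Hypothesis kappa_pos : 0 < kappa.

Variables (pref : C -> C) (g : (C -> C) -> C -> C -> C).

(** On the segment the integrand is [w] times the factor [P] of [F], up to a constant
    that [pref z] turns into [kappa z^alpha]. *)
Hypothesis integrand : forall (F : C -> C) (P : R -> C) (z : C), z <> RtoC 0 ->
  (forall s, 0 < s < 1 ->
     F (RtoC s * z)%C = (RtoC (Rpower s alpha) * Defs.Cpow z alpha * P s)%C) ->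
  exists c : C, (pref z * c)%C = (RtoC kappa * Defs.Cpow z alpha)%C /\
    forall s, 0 < s < 1 -> (g F z (RtoC s * z) * z)%C = (c * (RtoC (w s) * P s))%C.

Lemma is_power_radius (L F : C -> C) (z : C) (s : R) :
  (forall z, unit_disk z -> z <> RtoC 0 ->
     F z = Cexp (RtoC alpha * (Clog z + L z))%C) ->
  0 < s < 1 -> Cmod z < 1 -> z <> RtoC 0 ->
  F (RtoC s * z)%C =
    (RtoC (Rpower s alpha) * Defs.Cpow z alpha * Cexp (RtoC alpha * L (RtoC s * z)))%C.
Proof.
  intros HF Hs Hz Hz0.
  rewrite HF.
  - rewrite <- Cpow_real_scal by (try exact Hz0; lra).
    unfold Defs.Cpow; rewrite <- Cexp_plus; f_equal; ring.
  - apply Cmod_radius_lt_1; [lra|exact Hz].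
  - apply Cmult_neq_0; [|exact Hz0]; intros E; apply RtoC_inj in E; lra.
Qed.

Lemma transform_value (p : nat -> C) (L F : C -> C) (z : C) :
  radius_ge 1 p ->
  (forall z, Cmod z < 1 -> Cexp (RtoC alpha * L z)%C = CPSeries p z) ->
  (forall z, unit_disk z -> z <> RtoC 0 ->
     F z = Cexp (RtoC alpha * (Clog z + L z))%C) ->
  unit_disk z -> z <> RtoC 0 ->
  exists I, is_segment_integral (g F z) z I /\
    (pref z * I)%C
    = (Defs.Cpow z alpha * (RtoC kappa * CPSeries (moment_mult lam p) z))%C.
Proof.
  intros Hp Ep HF Hz Hz0; unfold unit_disk in Hz.
  destruct (integrand F (fun s => CPSeries p (RtoC s * z)%C) z Hz0) as [c [Hc Hint]].
  { intros s Hs; rewrite <- Ep by (apply Cmod_radius_lt_1; [lra|exact Hz]).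
    now apply is_power_radius. }
  exists (c * CPSeries (moment_mult lam p) z)%C; split.
  - refine (Cint01_ext (fun s => c * (RtoC (w s) * CPSeries p (RtoC s * z)))%C
      (fun s => g F z (RtoC s * z) * z)%C _ _ (Cint01_scal c _ _ _)).
    + intros s Hs; symmetry; now apply Hint.
    + exact (int01_CPSeries w lam w_cont w_pos w_moment p z Hp Hz).
  - rewrite Cmult_assoc, Hc; ring.
Qed.

(** The series attached to [phi] is [kappa] times the average of the one attached to [f].
    For existence, the principal logarithm of that average provides a [phi]. *)
Theorem transform_class_T :
  (exists phi, is_transform pref g alpha f phi) /\
  (forall phi, is_transform pref g alpha f phi ->
     class_T n alpha beta (normalize phi) /\
     (kappa * lam 0%nat = 1 -> class_T n alpha beta phi)).
Proof.
  destruct (class_T_series n alpha beta f alpha_pos beta_lt1 f_in_T)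
    as [p [Hp [P0 [Ep HRe]]]].
  pose proof (moment_0_pos w lam w_cont w_pos w_moment) as Hlam.
  set (m := moment_mult lam p).
  assert (Hm : radius_ge 1 m) by now apply (radius_ge_moment w lam).
  set (B := fun k => (RtoC kappa * m k)%C).
  assert (HB : radius_ge 1 B).
  { apply radius_ge_le with (K := Cmod (RtoC kappa)) (a := m);
      [apply Cmod_ge_0| |exact Hm].
    intros k; unfold B; rewrite Cmod_mult; lra. }
  assert (EB : forall z, Cmod z < 1 -> CPSeries B z = (RtoC kappa * CPSeries m z)%C).
  { intros z Hz; now apply (CPSeries_scal 1). }
  assert (B0 : B 0%nat = RtoC (kappa * lam 0%nat)).
  { unfold B, m, moment_mult; rewrite P0, RtoC_mult; ring. }
  assert (Z0 : Cmod (RtoC 0) < 1) by (rewrite Cmod_0; lra).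
  assert (Hac : RtoC alpha <> RtoC 0) by (apply RtoC_neq_0; lra).
  split.
  - assert (Pos : forall z, Cmod z < 1 -> 0 < fst (CPSeries B z)).
    { intros z Hz; rewrite EB by exact Hz.
      assert (beta * lam 0%nat < fst (CPSeries m z)).
      { apply (re_average w); auto.
        now apply (re_euler_decrease alpha beta n). }
      replace (fst (RtoC kappa * CPSeries m z)%C) with (kappa * fst (CPSeries m z))
        by (simpl; ring).
      assert (0 <= beta * lam 0%nat) by nra; nra. }
    (* principal, since the sum takes its values in the right half plane *)
    set (L := fun z => (/ RtoC alpha * Clog (CPSeries B z))%C).
    assert (EL : forall z, Cmod z < 1 -> Cexp (RtoC alpha * L z)%C = CPSeries B z).
    { intros z Hz; unfold L.
      replace (RtoC alpha * (/ RtoC alpha * Clog (CPSeries B z)))%C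
        with (Clog (CPSeries B z)) by (field; exact Hac).
      apply Cexp_Clog; intros E; specialize (Pos z Hz); rewrite E in Pos; simpl in Pos; lra. }
    exists (fun z => z * Cexp (L z))%C.
    destruct f_in_T as [_ [Lf [HLf _]]].
    exists (fun z => Cexp (RtoC alpha * (Clog z + Lf z)))%C,
      (fun z => Cexp (RtoC alpha * (Clog z + L z)))%C.
    split; [exists Lf; split; [exact HLf|reflexivity]|split].
    + exists L; split; [split; [|split]|reflexivity].
      * intros z Hz.
        exists (/ RtoC alpha * (CPSeries (PSderive B) z * / CPSeries B z))%C.
        apply Cderive_scal.
        apply (Cderive_comp Clog (CPSeries B)); [apply Cderive_Clog, Pos, Hz|].
        now apply (Cderive_CPSeries 1).
      * unfold L; rewrite CPSeries_0, B0, Clog_RtoC by (apply Rmult_lt_0_compat; assumption).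
        rewrite <- RtoC_inv, <- RtoC_mult by lra; reflexivity.
      * reflexivity.
    + intros z Hz Hz0.
      destruct (transform_value p Lf (fun z => Cexp (RtoC alpha * (Clog z + Lf z)))%C z
        Hp (Ep Lf HLf) (fun _ _ _ => eq_refl) Hz Hz0) as [I [HI HpI]].
      exists I; split; [exact HI|].
      rewrite HpI, <- EB, <- EL by exact Hz.
      unfold Defs.Cpow; rewrite <- Cexp_plus; f_equal; ring.
  - intros phi [F [Phi [[Lf [HLf HF]] [[L [HL HPhi]] Hint]]]].
    assert (E0 : forall z, z <> RtoC 0 -> Cmod z < 1 ->
              Cexp (RtoC alpha * L z)%C = CPSeries B z).
    { intros z Hz0 Hz.
      destruct (Hint z Hz Hz0) as [I [HI EPhi]].
      destruct (transform_value p Lf F z Hp (Ep Lf HLf) HF Hz Hz0) as [I' [HI' HpI]].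
      rewrite <- (Cint01_unique _ _ _ HI HI') in HpI.
      rewrite <- EPhi, HPhi, <- EB in HpI by assumption.
      replace (RtoC alpha * (Clog z + L z))%C with (RtoC alpha * Clog z + RtoC alpha * L z)%C
        in HpI by ring.
      rewrite Cexp_plus in HpI; fold (Defs.Cpow z alpha) in HpI.
      pose proof (Cpow_real_neq_0 z alpha) as Hc.
      replace (Cexp (RtoC alpha * L z)%C) with
        (/ Defs.Cpow z alpha * (Defs.Cpow z alpha * Cexp (RtoC alpha * L z)))%C
        by (field; exact Hc).
      rewrite HpI; field; exact Hc. }
    assert (E : forall z, Cmod z < 1 -> Cexp (RtoC alpha * L z)%C = CPSeries B z).
    { apply (Ccontinuous_eq_punctured 1 (fun z => Cexp (RtoC alpha * L z)%C) (CPSeries B));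
        [lra| | |exact E0].
      - destruct HL as [DL _].
        destruct (DL (RtoC 0) Z0 : exists l : C, is_Cderive L (RtoC 0) l) as [l Hl].
        apply (Ccontinuous_comp (fun z => RtoC alpha * L z)%C Cexp).
        + eapply Cderive_continuous, Cderive_scal, Hl.
        + eapply Cderive_continuous, Cderive_Cexp.
      - eapply Cderive_continuous, (Cderive_CPSeries 1); assumption. }
    destruct (class_T_of_series n alpha beta phi L B) as [H1 H2]; auto.
    + intros z Hz; rewrite B0.
      pose proof (radius_ge_euler alpha n p alpha_pos Hp) as He.
      rewrite (CPSeries_ext 1
        (fun k => RtoC kappa * moment_mult lam (euler_coeff alpha n p) k)%C).
      * rewrite (CPSeries_scal 1) by (try exact Hz; now apply (radius_ge_moment w lam)).
        pose proof (re_average w lam w_cont w_pos w_moment _ beta He HRe z Hz) as R.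
        set (X := CPSeries (moment_mult lam (euler_coeff alpha n p)) z) in *.
        replace (fst (RtoC kappa * X)%C) with (kappa * fst X) by (simpl; ring).
        replace (fst (RtoC (kappa * lam 0%nat))) with (kappa * lam 0%nat) by reflexivity.
        nra.
      * apply radius_ge_le with (K := Cmod (RtoC kappa))
          (a := moment_mult lam (euler_coeff alpha n p));
          [apply Cmod_ge_0| |now apply (radius_ge_moment w lam)].
        intros k; rewrite Cmod_mult; lra.
      * exact Hz.
      * intros k; unfold B, m, moment_mult, euler_coeff; ring.
    + split; [exact H1|]; intros Hk; apply H2; now rewrite B0, Hk.
Qed.

End Transform.

(** * The three operators *)

Lemma moment_power (b s : R) (k : nat) :
  0 < s < 1 -> Rpower s (b - 1) * s ^ k = Rpower s (b + INR k - 1).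
Proof.
  intros Hs; rewrite <- (Rpower_pow k s), <- Rpower_plus by lra; f_equal; ring.
Qed.

Theorem theorem5 (alpha beta c sigma gamma : R) (n : nat) (f : C -> C)
  (alpha_pos : 0 < alpha) (beta_ge0 : 0 <= beta) (beta_lt1 : beta < 1)
  (f_in_T : class_T n alpha beta f)
  (alpha_c_pos : 0 < alpha + c) (sigma_pos : 0 < sigma) (gamma_pos : 0 < gamma) :
  ((exists phi1 : C -> C, is_phi1 alpha c f phi1) /\
   (forall phi1 : C -> C, is_phi1 alpha c f phi1 -> class_T n alpha beta phi1)) /\
  ((exists phi2 : C -> C, is_phi2 alpha sigma f phi2) /\
   (forall phi2 : C -> C, is_phi2 alpha sigma f phi2 ->
      class_T n alpha beta (normalize phi2) /\
      (alpha = 1 -> class_T n alpha beta phi2))) /\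
  ((exists phi3 : C -> C, is_phi3 alpha sigma gamma f phi3) /\
   (forall phi3 : C -> C, is_phi3 alpha sigma gamma f phi3 ->
      class_T n alpha beta (normalize phi3) /\
      (alpha = 1 -> class_T n alpha beta phi3))).
Proof.
  assert (s_neq_0 : forall s, 0 < s < 1 -> RtoC s <> RtoC 0).
  { intros s Hs E; apply RtoC_inj in E; lra. }
  split; [|split].
  - destruct (transform_class_T alpha beta n f alpha_pos beta_ge0 beta_lt1 f_in_T
      (fun s => Rpower s (alpha + c - 1)) (fun k => / (alpha + c + INR k)) (alpha + c))
      with (pref := fun z => (RtoC (alpha + c) / Defs.Cpow z c)%C)
           (g := fun F (_ t : C) => (Defs.Cpow t (c - 1) * F t)%C) as [Hex Hall].
    + intros s Hs; apply Rpower_continuous; lra.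
    + intros s Hs; apply Rpower_pos.
    + intros k; pose proof (pos_INR k).
      apply (Rint01_ext (fun s => Rpower s (alpha + c + INR k - 1))).
      * intros s Hs; symmetry; now apply moment_power.
      * apply int01_power; lra.
    + exact alpha_c_pos.
    + intros F P z Hz0 HF.
      exists (Defs.Cpow z c * Defs.Cpow z alpha)%C; split.
      * field; apply Cpow_real_neq_0.
      * intros s Hs; rewrite HF, Cpow_real_scal by (try exact Hs; try exact Hz0; lra).
        rewrite <- (Cpow_real_minus_1 z c) by exact Hz0.
        replace (alpha + c - 1) with ((c - 1) + alpha) by ring.
        rewrite Rpower_plus, RtoC_mult; ring.
    + split; [exact Hex|]; intros phi Hphi.
      apply (Hall phi Hphi); simpl; field; lra.
  - pose proof (Gamma_pos sigma sigma_pos) as HG.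
    assert (HGc : RtoC (Gamma sigma) <> RtoC 0) by (apply RtoC_neq_0; lra).
    destruct (transform_class_T alpha beta n f alpha_pos beta_ge0 beta_lt1 f_in_T
      (fun s => Rpower (- ln s) (sigma - 1) * Rpower s (alpha + 1 - 1))
      (fun k => Gamma sigma * Rpower (alpha + 1 + INR k) (- sigma))
      (Rpower 2 sigma / Gamma sigma))
      with (pref := fun z => (RtoC (Rpower 2 sigma) / (z * RtoC (Gamma sigma)))%C)
           (g := fun F (z t : C) => (Defs.Cpow (Clog (z / t)) (sigma - 1) * F t)%C)
      as [Hex Hall].
    + intros s Hs; apply (continuous_mult (K := R_AbsRing)
        (fun s => Rpower (- ln s) (sigma - 1)) (fun s => Rpower s (alpha + 1 - 1))).
      * now apply neg_ln_power_continuous.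
      * apply Rpower_continuous; lra.
    + intros s Hs; apply Rmult_lt_0_compat; apply Rpower_pos.
    + intros k; pose proof (pos_INR k).
      apply (Rint01_ext
        (fun s => Rpower (- ln s) (sigma - 1) * Rpower s (alpha + 1 + INR k - 1))).
      * intros s Hs; rewrite Rmult_assoc, moment_power by exact Hs; reflexivity.
      * apply Gamma_int01_scaled; lra.
    + apply Rdiv_lt_0_compat; [apply Rpower_pos|exact HG].
    + intros F P z Hz0 HF.
      exists (z * Defs.Cpow z alpha)%C; split.
      * rewrite RtoC_div by lra; field; split; assumption.
      * intros s Hs; rewrite HF by exact Hs.
        replace (z / (RtoC s * z))%C with (RtoC (/ s)).
        2:{ rewrite RtoC_inv by lra; field; split; [exact Hz0|now apply s_neq_0]. }
        rewrite Clog_RtoC, ln_Rinv by (try apply Rinv_0_lt_compat; lra).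
        rewrite Cpow_real_RtoC by now apply neg_ln_pos.
        replace (alpha + 1 - 1) with alpha by ring.
        rewrite RtoC_mult; ring.
    + split; [exact Hex|]; intros phi Hphi.
      destruct (Hall phi Hphi) as [H1 H2]; split; [exact H1|]; intros Ha; apply H2.
      (* for general [alpha] the left side is [(2 / (alpha + 1))^sigma] *)
      simpl INR; subst alpha.
      replace (1 + 1 + 0) with 2 by ring.
      replace (Rpower 2 sigma / Gamma sigma * (Gamma sigma * Rpower 2 (- sigma)))
        with (Rpower 2 sigma * Rpower 2 (- sigma)) by (field; lra).
      rewrite <- Rpower_plus, Rplus_opp_r; apply Rpower_O; lra.
  - assert (HG1 : 0 < Gamma (sigma + 1)) by (apply Gamma_pos; lra).
    assert (HG2 : 0 < Gamma (gamma + 1)) by (apply Gamma_pos; lra).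
    assert (HG3 : 0 < Gamma (sigma + gamma + 1)) by (apply Gamma_pos; lra).
    assert (Eb : gbinom (sigma + gamma) gamma =
              Gamma (sigma + gamma + 1) / (Gamma (sigma + 1) * Gamma (gamma + 1))).
    { unfold gbinom; replace (sigma + gamma - gamma + 1) with (sigma + 1) by ring.
      reflexivity. }
    assert (Pb : 0 < gbinom (sigma + gamma) gamma).
    { rewrite Eb; apply Rdiv_lt_0_compat; [exact HG3|now apply Rmult_lt_0_compat]. }
    destruct (transform_class_T alpha beta n f alpha_pos beta_ge0 beta_lt1 f_in_T
      (beta_weight sigma (gamma + alpha))
      (fun k => Beta sigma (gamma + alpha + INR k))
      (gbinom (sigma + gamma) gamma * sigma))
      with (pref := fun z => (RtoC (gbinom (sigma + gamma) gamma)
                              * (RtoC sigma / Defs.Cpow z gamma))%C)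
           (g := fun F (z t : C) =>
              (Defs.Cpow (RtoC 1 - t / z) (sigma - 1) * Defs.Cpow t (gamma - 1) * F t)%C)
      as [Hex Hall].
    + intros s Hs; now apply beta_weight_continuous.
    + intros s Hs; apply beta_weight_pos.
    + intros k; pose proof (pos_INR k).
      apply (Rint01_ext (beta_weight sigma (gamma + alpha + INR k))).
      * intros s Hs; unfold beta_weight.
        rewrite Rmult_assoc, moment_power by exact Hs; reflexivity.
      * apply Beta_int01; lra.
    + now apply Rmult_lt_0_compat.
    + intros F P z Hz0 HF.
      exists (Defs.Cpow z gamma * Defs.Cpow z alpha)%C; split.
      * rewrite RtoC_mult; field; apply Cpow_real_neq_0.
      * intros s Hs; rewrite HF by exact Hs.
        replace (RtoC 1 - RtoC s * z / z)%C with (RtoC (1 - s))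
          by (rewrite RtoC_minus; field; exact Hz0).
        rewrite Cpow_real_RtoC, Cpow_real_scal by (try exact Hz0; lra).
        rewrite <- (Cpow_real_minus_1 z gamma) by exact Hz0.
        unfold beta_weight; replace (gamma + alpha - 1) with ((gamma - 1) + alpha) by ring.
        rewrite Rpower_plus, !RtoC_mult; ring.
    + split; [exact Hex|]; intros phi Hphi.
      destruct (Hall phi Hphi) as [H1 H2]; split; [exact H1|]; intros Ha; apply H2.
      simpl INR; subst alpha; rewrite Rplus_0_r, Eb.
      pose proof (Beta_Gamma sigma (gamma + 1) sigma_pos ltac:(lra)) as HBG.
      rewrite <- Rplus_assoc in HBG.
      rewrite (Gamma_succ sigma) by exact sigma_pos.
      pose proof (Gamma_pos sigma sigma_pos) as HGs.
      replace (Gamma (sigma + gamma + 1) / (sigma * Gamma sigma * Gamma (gamma + 1)) * sigma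
               * Beta sigma (gamma + 1))
        with (Beta sigma (gamma + 1) * Gamma (sigma + gamma + 1)
              / (Gamma sigma * Gamma (gamma + 1))) by (field; lra).
      rewrite HBG; field; lra.
Qed.
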